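(* Let $A$ be a finite-dimensional algebra over an algebraically closed field which is determined by $\tau$-slices, with associated sets of $\tau$-slices $\{T_1,\dots,T_s\}$ and $\{S_1,\dots,S_t\}$. Suppose that every indecomposable module in $\bigcup_{j=1}^t\mathrm{Cogen}\,S_j$ belongs to $\mathcal{L}_A$, or that every indecomposable module in $\bigcup_{i=1}^s\mathrm{Gen}\,T_i$ belongs to $\mathcal{R}_A$. Then the finitistic dimension of $A$ is finite: $\mathrm{fin.dim.}\,A<\infty$.
   Context: Let $A$ be a finite-dimensional algebra over an algebraically closed field $k$. $\mathrm{mod}\,A$ is the category of finitely generated right $A$-modules, $\mathrm{ind}\,A$ a full subcategory of it consisting of one representative of each isomorphism class of indecomposable modules. $\Gamma(A)$ is the Auslander-Reiten quiver of $A$, $\tau$ the Auslander-Reiten translation, $\tau^-$ its inverse, and $DA$ is the injective cogenerator $\mathrm{Hom}_k(A,k)$. For a module $M$, $\mathrm{add}\,M$ is the full subcategory of finite direct sums of direct summands of $M$; $\mathrm{Gen}\,M$ (resp. $\mathrm{Cogen}\,M$) is the full subcategory of modules $X$ admitting an epimorphism $M_0\to X$ (resp. a monomorphism $X\to M_0$) with $M_0\in\mathrm{add}\,M$. $M^{\perp}=\{N:\mathrm{Hom}_A(M,N)=0\}$ and ${}^{\perp}M=\{N:\mathrm{Hom}_A(N,M)=0\}$. The finitistic dimension $\mathrm{fin.dim.}\,A$ is the supremum of the projective dimensions of the finitely generated $A$-modules of finite projective dimension. **Left and right parts.** A path from $M$ to $N$ in $\mathrm{ind}\,A$ is a sequence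 of nonzero morphisms $M=X_1\to X_2\to\cdots\to X_t=N$ $(t\ge 1)$ with all $X_i\in\mathrm{ind}\,A$; then $M$ is a predecessor of $N$ and $N$ a successor of $M$. The right part is $\mathcal{R}_A=\{M\in\mathrm{ind}\,A : \mathrm{id}_A N\le 1 \text{ for each successor } N \text{ of } M\}$ and the left part is $\mathcal{L}_A=\{M\in\mathrm{ind}\,A : \mathrm{pd}_A N\le 1\text{ for each predecessor } N\text{ of } M\}$. **$\tau$-slices.** A module $M$ is $\tau$-rigid if $\mathrm{Hom}_A(M,\tau M)=0$. A presection $\Sigma$ in a connected component $\Gamma$ of a translation quiver is an acyclic, full, connected subquiver of $\Gamma$ such that: if $x\to y$ is an arrow of $\Gamma$ with $x\in\Sigma$, then either $y$ or $\tau y$ is in $\Sigma$, but not both; and if $x\to y$ is an arrow of $\Gamma$ with $y\in\Sigma$, then either $x$ or $\tau^- x$ is in $\Sigma$, but not both. A $\tau$-slice is a $\tau$-rigid module $T$ such that the full subquiver of $\Gamma(A)$ on the isomorphism classes of indecomposable direct summands of $T$ is a presection. **Algebras determined by $\tau$-slices.** $A$ is determined by $\tau$-slices if the following hold. (1) There are two finite (possibly empty) sets of $\tau$-slices $\{T_1,\dots,T_s\}$ and $\{S_1,\dots,S_t\}$ with $\mathrm{Hom}_A(T_i,S_j)=0$ for all $i,j$. (2) The full additive subcategory of $\mathrm{mod}\,A$ whose indecomposable objects are those lying neither in $\bigcup_{i=1}^s\mathrm{Gen}\,T_i$ nor in $\bigcup_{j=1}^t\mathrm{Cogen}\,S_j$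 coincides with $\left(\bigcap_{i=1}^s T_i^{\perp}\right)\cap\left(\bigcap_{j=1}^t {}^{\perp}S_j\right)$ (an empty intersection being $\mathrm{mod}\,A$), and this category contains only finitely many isomorphism classes of indecomposable modules. It is denoted $\mathcal{Y}_A$. (3) For every object $X$ in $\bigcup_{i=1}^s\mathrm{Gen}\,T_i$ there is a $k\in\{1,\dots,s\}$ such that every morphism $f:L\to X$, where $L\in\mathrm{add}\left(A\oplus DA\oplus\bigoplus_{i\ne k}T_i\right)$ has no injective direct summand in $\mathrm{Gen}\,T_k$, factors as $L\to T'\to X$ with $T'\in\mathrm{add}\,T_k$. (3$^{op}$) For every object $Y$ in $\bigcup_{j=1}^t\mathrm{Cogen}\,S_j$ there is a $k\in\{1,\dots,t\}$ such that every morphism $g:Y\to N$, where $N\in\mathrm{add}\left(A\oplus DA\oplus\bigoplus_{j\ne k}S_j\right)$ has no projective direct summand in $\mathrm{Cogen}\,S_k$, factors as $Y\to S'\to N$ with $S'\in\mathrm{add}\,S_k$. *)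

(* Defs.v *)
From HB Require Import structures.
From Stdlib Require Import Relation_Operators.
From mathcomp Require Import all_boot all_algebra all_field.

Set Implicit Arguments.
Unset Strict Implicit.
Unset Printing Implicit Defensive.
Import GRing.Theory.
Local Open Scope ring_scope.

(* Left and right modules are treated uniformly, so that the duality D and    *)
(* the transpose Tr are defined once and exchange the two sides.              *)
Inductive side := Left | Right.

Definition op (s : side) : side :=
  match s with Left => Right | Right => Left end.

Definition side_comp (k : fieldType) (V : vectType k) (s : side)
    (f g : 'End(V)) : 'End(V) :=
  match s with Left => (f \o g)%VF | Right => (g \o f)%VF end.

(* A finitely generated module over the finite-dimensional algebra A is the   *)
(* same thing as a module of finite dimension over k.                         *)
Record amod (k : fieldType) (A : falgType k) (s : side) := AMod {
  carrier :> vectType k;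
  act : A -> 'End(carrier);
  act_linear : linear act;
  act1 : act 1 = \1%VF;
  actM : forall a b : A, act (a * b) = side_comp s (act a) (act b) }.
Arguments AMod {k A s carrier act} act_linear act1 actM.
Arguments act {k A s} M a : rename.
Arguments act_linear {k A s} M : rename.
Arguments act1 {k A s} M : rename.
Arguments actM {k A s} M a b : rename.

HB.instance Definition _ (k : fieldType) (A : falgType k) s (M : amod A s) :=
  GRing.isLinear.Build k A 'End(M) _ (act M) (act_linear M).

Section Constructions.
Variables (k : fieldType) (A : falgType k).

Definition amod_hom s (M N : amod A s) (f : 'Hom(M, N)) : Prop :=
  forall a : A, (f \o act M a)%VF = (act N a \o f)%VF.

Definition hom_defect s (M N : amod A s) (a : A) (f : 'Hom(M, N)) :
  'Hom(M, N) := ((f \o act M a) - (act N a \o f))%VF.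

Fact hom_defect_linear s (M N : amod A s) a : linear (@hom_defect s M N a).
Proof.
move=> c f g; rewrite /hom_defect comp_lfunDl comp_lfunDr -comp_lfunZl -comp_lfunZr.
by rewrite opprD addrACA scalerBr.
Qed.
HB.instance Definition _ s (M N : amod A s) a :=
  GRing.isLinear.Build k _ _ _ (@hom_defect s M N a) (@hom_defect_linear s M N a).

Definition homv s (M N : amod A s) : {vspace 'Hom(M, N)} :=
  (\bigcap_(i < \dim {:A})
     lker (linfun (@hom_defect s M N (vbasis {:A})`_i)))%VS.

Lemma homvP s (M N : amod A s) (f : 'Hom(M, N)) :
  reflect (amod_hom f) (f \in homv M N).
Proof.
apply: (iffP idP) => [/subv_bigcapP fK a|fH].
  have base i : ((i < \dim {:A})%N) ->
      (f \o act M (vbasis {:A})`_i = act N (vbasis {:A})`_i \o f)%VF.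
    move=> lti; have := fK (Ordinal lti) isT.
    by rewrite -memvE memv_ker lfunE /= subr_eq0 => /eqP.
  have /coord_vbasis -> := memvf a.
  rewrite !linear_sum.
  apply/lfunP=> x; rewrite !comp_lfunE !sum_lfunE linear_sum /=.
  apply: eq_bigr => i _; rewrite !linearZ /= !scale_lfunE linearZ /=.
  by have := congr1 (fun h : 'Hom(M, N) => h x) (base i (ltn_ord i));
     rewrite !comp_lfunE /= => ->.
apply/subv_bigcapP=> i _; rewrite -memvE memv_ker lfunE /= /hom_defect fH.
by rewrite subrr.
Qed.

Fact amod0_linear : linear (fun _ : A => (0 : 'End('rV[k]_0))).
Proof. by move=> c a b; rewrite scaler0 addr0. Qed.

Fact amod0_eq (f g : 'End('rV[k]_0)) : f = g.
Proof. by apply/lfunP=> x; rewrite [LHS]thinmx0 [RHS]thinmx0. Qed.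

Definition amod0 s : amod A s.
Proof.
by apply: (AMod amod0_linear) => *; apply: amod0_eq.
Defined.

Section Sum.
Variables (s : side) (M N : amod A s).

Definition dsum2_fun (a : A) (p : M * N) : M * N :=
  (act M a p.1, act N a p.2).
Fact dsum2_fun_linear a : linear (dsum2_fun a).
Proof. by move=> c u v; rewrite /dsum2_fun /= !linearP. Qed.
HB.instance Definition _ a :=
  GRing.isLinear.Build k _ _ _ (dsum2_fun a) (@dsum2_fun_linear a).

Definition dsum2_act (a : A) : 'End((M * N)%type) := linfun (dsum2_fun a).

Fact dsum2_act_linear : linear dsum2_act.
Proof.
move=> c a b; apply/lfunP=> -[x y]; rewrite !lfunE /= !lfunE /= !lfunE /=.
by rewrite /dsum2_fun /= !act_linear !lfunE /= !lfunE.
Qed.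

Fact dsum2_act1 : dsum2_act 1 = \1%VF.
Proof.
by apply/lfunP=> -[x y]; rewrite !lfunE /= /dsum2_fun !act1 /= !lfunE.
Qed.

Fact dsum2_actM a b :
  dsum2_act (a * b) = side_comp s (dsum2_act a) (dsum2_act b).
Proof.
suff key t : act M (a * b) = side_comp t (act M a) (act M b) ->
    act N (a * b) = side_comp t (act N a) (act N b) ->
    dsum2_act (a * b) = side_comp t (dsum2_act a) (dsum2_act b).
  by apply: key; apply: actM.
by case: t => eM eN; apply/lfunP=> -[x y];
  rewrite comp_lfunE !lfunE /= /dsum2_fun /= eM eN !comp_lfunE.
Qed.

Definition dsum2 : amod A s := AMod dsum2_act_linear dsum2_act1 dsum2_actM.
End Sum.

Definition dsum s (Ms : seq (amod A s)) : amod A s :=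
  foldr (@dsum2 s) (amod0 s) Ms.

Section Regular.
Variable s : side.

Definition reg_act (a : A) : 'End(A) :=
  match s with Left => amull a | Right => amulr a end.

Fact reg_act_linear : linear reg_act.
Proof. by rewrite /reg_act; case: s => c a b; rewrite linearP. Qed.

Fact reg_act1 : reg_act 1 = \1%VF.
Proof.
by rewrite /reg_act; case: s; apply/lfunP=> x; rewrite !lfunE /= ?mul1r ?mulr1.
Qed.

Fact reg_actM a b : reg_act (a * b) = side_comp s (reg_act a) (reg_act b).
Proof.
by rewrite /reg_act; case: s; apply/lfunP=> x;
  rewrite comp_lfunE !lfunE /= mulrA.
Qed.

Definition reg : amod A s := AMod reg_act_linear reg_act1 reg_actM.
End Regular.

Lemma reg_act_comm s a b :
  (reg_act (op s) a \o reg_act s b = reg_act s b \o reg_act (op s) a)%VF.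
Proof.
by case: s; apply/lfunP=> x; rewrite !comp_lfunE !lfunE /= mulrA.
Qed.

(* D M = Hom_k(M, k) *)
Section Dual.
Variables (s : side) (M : amod A s).

Definition dual_fun (a : A) (phi : 'Hom(M, k^o)) : 'Hom(M, k^o) :=
  (phi \o act M a)%VF.
Fact dual_fun_linear a : linear (dual_fun a).
Proof.
by move=> c f g; rewrite /dual_fun comp_lfunDl -comp_lfunZl.
Qed.
HB.instance Definition _ a :=
  GRing.isLinear.Build k _ _ _ (dual_fun a) (@dual_fun_linear a).

Definition dual_act (a : A) : 'End('Hom(M, k^o)) := linfun (dual_fun a).

Fact dual_act_linear : linear dual_act.
Proof.
move=> c a b; apply/lfunP=> f; rewrite add_lfunE scale_lfunE !lfunE /=.
by rewrite /dual_fun act_linear comp_lfunDr -comp_lfunZr.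
Qed.

Fact dual_act1 : dual_act 1 = \1%VF.
Proof. by apply/lfunP=> f; rewrite !lfunE /= /dual_fun act1 comp_lfun1r. Qed.

Fact dual_actM a b :
  dual_act (a * b) = side_comp (op s) (dual_act a) (dual_act b).
Proof.
suff key t : act M (a * b) = side_comp t (act M a) (act M b) ->
    dual_act (a * b) = side_comp (op t) (dual_act a) (dual_act b).
  by apply: key; apply: actM.
by case: t => eM; apply/lfunP=> f;
  rewrite comp_lfunE !lfunE /= /dual_fun eM comp_lfunA.
Qed.

Definition dual : amod A (op s) := AMod dual_act_linear dual_act1 dual_actM.
End Dual.

(* star M = Hom_A(M, A), on which A acts through the other side of A *)
Section Star.
Variables (s : side) (M : amod A s).
Local Notation H := (homv M (reg s)).

Definition star_fun (a : A) (f : subvs_of H) : subvs_of H :=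
  vsproj H (reg_act (op s) a \o vsval f)%VF.
Fact star_fun_linear a : linear (star_fun a).
Proof.
move=> c f g; rewrite /star_fun (linearP vsval) comp_lfunDr -comp_lfunZr.
by rewrite linearP.
Qed.
HB.instance Definition _ a :=
  GRing.isLinear.Build k _ _ _ (star_fun a) (@star_fun_linear a).

Lemma vsval_star_fun a f :
  vsval (star_fun a f) = (reg_act (op s) a \o vsval f)%VF.
Proof.
rewrite /star_fun vsprojK //; apply/homvP=> b.
have /homvP fH := subvsP f.
by rewrite -comp_lfunA fH comp_lfunA [act _ b]/= reg_act_comm comp_lfunA.
Qed.

Definition star_act (a : A) : 'End(subvs_of H) := linfun (star_fun a).

Fact star_act_linear : linear star_act.
Proof.
move=> c a b; apply/lfunP=> f; apply: val_inj.
rewrite add_lfunE scale_lfunE !lfunE /= !vsval_star_fun.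
by rewrite reg_act_linear comp_lfunDl -comp_lfunZl.
Qed.

Fact star_act1 : star_act 1 = \1%VF.
Proof.
apply/lfunP=> f; apply: val_inj.
by rewrite !lfunE /= vsval_star_fun reg_act1 comp_lfun1l.
Qed.

Fact star_actM a b :
  star_act (a * b) = side_comp (op s) (star_act a) (star_act b).
Proof.
suff key t : reg_act (op s) (a * b) =
      side_comp t (reg_act (op s) a) (reg_act (op s) b) ->
    star_act (a * b) = side_comp t (star_act a) (star_act b).
  by apply: key; apply: reg_actM.
by case: t => eM; apply/lfunP=> f; apply: val_inj;
  rewrite comp_lfunE !lfunE /= !vsval_star_fun eM comp_lfunA.
Qed.

Definition star : amod A (op s) := AMod star_act_linear star_act1 star_actM.
End Star.

Section StarMap.
Variables (s : side) (M N : amod A s) (p : 'Hom(M, N)).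

Definition star_map_fun (f : star N) : star M :=
  vsproj (homv M (reg s)) (vsval f \o p)%VF.
Fact star_map_fun_linear : linear star_map_fun.
Proof.
move=> c f g; rewrite /star_map_fun (linearP vsval) comp_lfunDl -comp_lfunZl.
by rewrite linearP.
Qed.
HB.instance Definition _ :=
  GRing.isLinear.Build k _ _ _ star_map_fun star_map_fun_linear.

(* precomposition with p : M -> N, meaningful when p is A-linear *)
Definition star_map : 'Hom(star N, star M) := linfun star_map_fun.

Lemma vsval_star_map (f : star N) :
  amod_hom p -> vsval (star_map f) = (vsval f \o p)%VF.
Proof.
move=> pH; rewrite lfunE /= /star_map_fun vsprojK //.
apply/(@homvP s M (reg s))=> b.
have /(@homvP s N (reg s)) fH := subvsP f.
by rewrite -comp_lfunA pH !comp_lfunA fH.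
Qed.
End StarMap.
End Constructions.

Section ModuleTheory.
Variables (k : fieldType) (A : falgType k) (s : side).
Implicit Types M N P X Y Z : amod A s.

Definition is_zero M : Prop := \dim {:M} = 0%N.
Definition is_mono M N (f : 'Hom(M, N)) : Prop := lker f = 0%VS.
Definition is_epi M N (f : 'Hom(M, N)) : Prop := limg f = fullv.

Definition iso M N : Prop :=
  exists f : 'Hom(M, N), [/\ amod_hom f, is_mono f & is_epi f].

Definition hom_zero M N : Prop :=
  forall f : 'Hom(M, N), amod_hom f -> f = 0.

Definition summand X M : Prop := exists Y, iso M (dsum2 X Y).

Definition indec M : Prop :=
  ~ is_zero M /\ (forall X Y, iso M (dsum2 X Y) -> is_zero X \/ is_zero Y).

Definition in_add M N : Prop :=
  exists (n : nat) (X : 'I_n -> amod A s),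
    (forall i, summand (X i) M) /\ iso N (dsum [seq X i | i : 'I_n]).

Definition in_Gen M X : Prop :=
  exists M0 (f : 'Hom(M0, X)), [/\ in_add M M0, amod_hom f & is_epi f].

Definition in_Cogen M X : Prop :=
  exists M0 (f : 'Hom(X, M0)), [/\ in_add M M0, amod_hom f & is_mono f].

Definition projective P : Prop :=
  forall X Y (f : 'Hom(X, Y)) (h : 'Hom(P, Y)),
    amod_hom f -> is_epi f -> amod_hom h ->
    exists g : 'Hom(P, X), amod_hom g /\ (f \o g)%VF = h.

Definition injective_mod M : Prop :=
  forall X Y (f : 'Hom(X, Y)) (h : 'Hom(X, M)),
    amod_hom f -> is_mono f -> amod_hom h ->
    exists g : 'Hom(Y, M), amod_hom g /\ (g \o f)%VF = h.

(* M has a projective resolution P 0, ..., P n of length n. *)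
Definition pd_le (n : nat) M : Prop :=
  exists (P : nat -> amod A s)
         (d : forall i, 'Hom(P i.+1, P i)) (e : 'Hom(P 0%N, M)),
    [/\ forall i, projective (P i) /\ ((n < i)%N -> is_zero (P i)),
        amod_hom e /\ (forall i, amod_hom (d i)),
        is_epi e,
        limg (d 0%N) = lker e
      & forall i, limg (d i.+1) = lker (d i)].

Definition id_le (n : nat) M : Prop :=
  exists (I : nat -> amod A s)
         (d : forall i, 'Hom(I i, I i.+1)) (e : 'Hom(M, I 0%N)),
    [/\ forall i, injective_mod (I i) /\ ((n < i)%N -> is_zero (I i)),
        amod_hom e /\ (forall i, amod_hom (d i)),
        is_mono e,
        limg e = lker (d 0%N)
      & forall i, limg (d i) = lker (d i.+1)].

Definition ind_step X Y : Prop :=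
  [/\ indec X, indec Y & exists f : 'Hom(X, Y), amod_hom f /\ f <> 0].

Definition ind_path M N : Prop :=
  [/\ indec M, indec N & clos_refl_trans _ ind_step M N].

Definition right_part M : Prop :=
  indec M /\ (forall N, ind_path M N -> id_le 1 N).

Definition left_part M : Prop :=
  indec M /\ (forall N, ind_path N M -> pd_le 1 N).

Definition split_mono M N (f : 'Hom(M, N)) : Prop :=
  exists g : 'Hom(N, M), amod_hom g /\ (g \o f)%VF = \1%VF.
Definition split_epi M N (f : 'Hom(M, N)) : Prop :=
  exists g : 'Hom(N, M), amod_hom g /\ (f \o g)%VF = \1%VF.

Definition irreducible_hom M N (f : 'Hom(M, N)) : Prop :=
  [/\ amod_hom f, ~ split_mono f, ~ split_epi f
    & forall Z (g : 'Hom(M, Z)) (h : 'Hom(Z, N)),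
        amod_hom g -> amod_hom h -> (h \o g)%VF = f ->
        split_mono g \/ split_epi h].

Definition AR_arrow X Y : Prop :=
  [/\ indec X, indec Y & exists f : 'Hom(X, Y), irreducible_hom f].

(* The corestriction of f to its image is an essential epimorphism. *)
Definition essential M N (f : 'Hom(M, N)) : Prop :=
  forall X (g : 'Hom(X, M)), amod_hom g -> limg (f \o g)%VF = limg f ->
    is_epi g.

(* P1 -> P0 -> M -> 0 *)
Definition minimal_presentation P1 P0 M
    (p1 : 'Hom(P1, P0)) (p0 : 'Hom(P0, M)) : Prop :=
  [/\ projective P1 /\ projective P0, amod_hom p1 /\ amod_hom p0,
      is_epi p0, limg p1 = lker p0 & essential p1 /\ essential p0].

End ModuleTheory.

(* The transpose, determined up to isomorphism:                               *)
(* star P0 -> star P1 -> Tr M -> 0 is exact.                                  *)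
Definition is_Tr (k : fieldType) (A : falgType k) s
    (M : amod A s) (X : amod A (op s)) : Prop :=
  exists (P1 P0 : amod A s) (p1 : 'Hom(P1, P0)) (p0 : 'Hom(P0, M))
         (c : 'Hom(star P1, X)),
    [/\ minimal_presentation p1 p0, amod_hom c, is_epi c
      & lker c = limg (star_map p1)].

Section TauSlices.
Variables (k : fieldType) (A : falgType k).
Implicit Types L M N X Y Z T : amod A Right.

Definition AA : amod A Right := reg A Right.
Definition DA : amod A Right := dual (reg A Left).

(* tau = D Tr *)
Definition is_tau M N : Prop :=
  exists X : amod A Left, is_Tr M X /\ iso N (dual X).

(* tau^- = Tr D *)
Definition is_tau_inv M N : Prop := is_Tr (dual M) N.

Definition tau_rigid M : Prop := forall N, is_tau M N -> hom_zero M N.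

Definition exactly_one (P Q : Prop) : Prop := (P \/ Q) /\ ~ (P /\ Q).

(* A full subquiver of the Auslander-Reiten quiver is given by its vertices,  *)
(* as an isomorphism-invariant predicate Sg on indecomposable modules.  Since *)
(* the vertices of the quiver are isomorphism classes, walks in the           *)
(* definition of connectedness may also move along isomorphisms.              *)
Definition presection (Sg : amod A Right -> Prop) : Prop :=
  [/\ exists X, Sg X,
      forall X, ~ clos_trans _ (fun Y Z => [/\ Sg Y, Sg Z & AR_arrow Y Z]) X X,
      forall X Y, Sg X -> Sg Y ->
        clos_refl_sym_trans _
          (fun Z W => [/\ Sg Z, Sg W & iso Z W \/ AR_arrow Z W]) X Y,
      forall X Y, AR_arrow X Y -> Sg X ->
        exactly_one (Sg Y) (exists Z, is_tau Y Z /\ Sg Z)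
    & forall X Y, AR_arrow X Y -> Sg Y ->
        exactly_one (Sg X) (exists Z, is_tau_inv X Z /\ Sg Z)].

Definition tau_slice T : Prop :=
  tau_rigid T /\ presection (fun X => indec X /\ summand X T).

Section Families.
Variables (m n : nat) (T : 'I_m -> amod A Right) (S : 'I_n -> amod A Right).

Definition in_union_Gen X : Prop := exists i, in_Gen (T i) X.
Definition in_union_Cogen Y : Prop := exists j, in_Cogen (S j) Y.

Definition in_YA N : Prop :=
  exists (r : nat) (X : 'I_r -> amod A Right),
    (forall i, [/\ indec (X i), ~ in_union_Gen (X i) & ~ in_union_Cogen (X i)])
    /\ iso N (dsum [seq X i | i : 'I_r]).

Definition in_perps N : Prop :=
  (forall i, hom_zero (T i) N) /\ (forall j, hom_zero N (S j)).

Definition sum_except r (X : 'I_r -> amod A Right) (l : 'I_r) : amod A Right :=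
  dsum2 (dsum2 AA DA) (dsum [seq X i | i <- enum 'I_r & i != l]).

Definition factors_through_add M X Y (f : 'Hom(X, Y)) : Prop :=
  exists M0 (g : 'Hom(X, M0)) (h : 'Hom(M0, Y)),
    [/\ in_add M M0, amod_hom g, amod_hom h & (h \o g)%VF = f].

(* The forbidden direct summands are nonzero: 0 is injective, projective and  *)
(* belongs to every Gen and Cogen.                                            *)
Definition condition3 : Prop :=
  forall X, in_union_Gen X -> exists l : 'I_m,
    forall L (f : 'Hom(L, X)), amod_hom f ->
      in_add (sum_except T l) L ->
      ~ (exists I, [/\ ~ is_zero I, summand I L, injective_mod I
                     & in_Gen (T l) I]) ->
      factors_through_add (T l) f.

Definition condition3op : Prop :=
  forall Y, in_union_Cogen Y -> exists l : 'I_n,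
    forall N (g : 'Hom(Y, N)), amod_hom g ->
      in_add (sum_except S l) N ->
      ~ (exists P, [/\ ~ is_zero P, summand P N, projective P
                     & in_Cogen (S l) P]) ->
      factors_through_add (S l) g.

Definition determined_by_tau_slices : Prop :=
  [/\ [/\ forall i, tau_slice (T i), forall j, tau_slice (S j)
        & forall i j, hom_zero (T i) (S j)],
      forall N, in_YA N <-> in_perps N,
      exists (r : nat) (Z : 'I_r -> amod A Right),
        forall N, indec N -> in_YA N -> exists i, iso N (Z i),
      condition3
    & condition3op].

End Families.

(* The supremum of the finite projective dimensions is finite exactly when    *)
(* they have a common bound.                                                  *)
Definition findim_finite : Prop :=
  exists d : nat, forall M, (exists n, pd_le n M) -> pd_le d M.

End TauSlices.

Arguments findim_finite {k} A.

(* Main.v *)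
From HB Require Import structures.
From Stdlib Require List.
From Stdlib Require Import Relation_Operators.
Require Import Defs.
From mathcomp Require Import all_boot all_algebra all_field boolp.

Set Implicit Arguments.
Unset Strict Implicit.
Unset Printing Implicit Defensive.
Import GRing.Theory.
Local Open Scope ring_scope.

(** Every indecomposable module lies in some Gen (T i), in some Cogen (S j) or in
    the finite class Y_A, and a module has the largest projective dimension of its
    indecomposable summands.  It is therefore enough to bound, for one tau-slice T,
    the finite projective dimensions that occur in Gen T and in Cogen T.

    Both bounds come from a theorem of Igusa and Todorov ([igusa_todorov]): if V is
    fixed, the cokernels of monomorphisms V1 -> V0 with V1, V0 in add V have
    bounded finite projective dimensions.  Record V0 and V1 by their multiplicity
    vectors.  That their n-th syzygies are stably isomorphic is a system of linear
    equations on the difference of the two vectors, by the Krull-Schmidt theorem,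
    and its space of rational solutions increases with n, so it is constant from
    some m on that depends on V only ([stable_syzygies]).  When the cokernel X has
    finite projective dimension, the syzygies of V0 and V1 are stably isomorphic
    from some step on, hence already at step m.  This leaves a monomorphism
    U -> U + Q with Q projective whose cokernel has finite projective dimension.
    Fitting's lemma splits U: the invertible part cancels, and the nilpotent part
    is a direct summand of an iterated extension of the cokernel by itself, so its
    finite projective dimension is one of finitely many numbers
    ([endo_cokernel]).

    To apply this to X in Gen T, take an add T-approximation f : T^n -> X with
    kernel K; the point is that K is in add T ([slice_presentation]).  Suppose that
    an indecomposable summand C of K is not in add T.  A map from C to an
    indecomposable summand T' of T is not a split epimorphism, so it factors through
    the sources E of the arrows E -> T' ([hom_zero_of_arrows]).  By the definition of
    a presection, either E is again a summand of T, and one argues by induction since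
    the slice is acyclic, or tau^- E is one.  In the second case Hom(K, E) = 0: by
    Auslander-Reiten duality, and because maps from tau^- E to X lift along f, every
    map K -> E extends to T^n, where it vanishes as T is tau-rigid
    ([hom_zero_kernel]).  Thus Hom(C, T) = 0, although C embeds into T^n.

    If X embeds into M in add T, then the cokernel Z of X -> M is in Gen T and has a
    presentation K -> T^n -> Z as above; as M -> Z lifts to T^n, there is an exact
    sequence X -> K + M -> T^n with all terms but X in add T ([ses_switch]).  Taking
    syzygies presents X as the cokernel of a monomorphism between modules that are,
    up to projective summands, syzygies of modules in add T ([ses_rotate]). *)

(** * Linear algebra *)

(** Lets a function with a proof of linearity be used as a linear map, without
    declaring a linear structure on it. *)
Lemma linfunE (k : fieldType) (U V : vectType k) (f : U -> V) :
  linear f -> linfun f =1 f.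
Proof.
move=> f_lin x.
exact: (lfunE (HB.pack_for {linear U -> V} f
                 (GRing.isLinear.Build k U V *:%R f f_lin)) x).
Qed.

Section LinearAlgebra.
Variable k : fieldType.
Implicit Types U V W : vectType k.

(** A subspace of maximal dimension among those contained in P is all of P. *)
Lemma vspace_of_pred V (P : V -> Prop) :
  P 0 -> (forall c x y, P x -> P y -> P (c *: x + y)) ->
  exists U : {vspace V}, forall x, x \in U <-> P x.
Proof.
move=> P0 PD.
pose good d := `[< exists U : {vspace V}, \dim U = d /\ forall x, x \in U -> P x >].
have ex0 : exists d, good d.
  exists 0%N; apply/asboolP; exists 0%VS; rewrite dimv0; split=> // x.
  by rewrite memv0 => /eqP ->.
have bd d : good d -> (d <= \dim {:V})%N.
  by case/asboolP=> U [<- _]; apply/dimvS/subvf.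
case: (ex_maxnP ex0 bd) => d /asboolP[U [dU PU]] maxd.
exists U => x; split=> [/PU //|Px]; apply: contrapT => /negP xU.
have: good (\dim (U + <[x]>)).
  apply/asboolP; exists (U + <[x]>)%VS; split=> // y.
  case/memv_addP=> u uU [v /vlineP[c ->] ->].
  by rewrite addrC; apply: PD => //; apply: PU.
move/maxd; rewrite -dU leqNgt => /negP[].
rewrite dimv_disjoint_sum; last first.
  apply/eqP; rewrite -subv0; apply/subvP=> y; rewrite memv_cap memv0.
  case/andP=> yU /vlineP[c yE]; move: yU; rewrite yE.
  have [->|c0] := eqVneq c 0; first by rewrite scale0r eqxx.
  by move=> cx; case/negP: xU; rewrite -(scalerK c0 x) memvZ.
rewrite dim_vline; have [x0|_] := eqVneq x 0; last by rewrite addn1.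
by rewrite x0 mem0v in xU.
Qed.

Lemma separating_functional V (W : {vspace V}) u :
  u \notin W ->
  exists l : 'Hom(V, k^o), (forall w, w \in W -> l w = 0) /\ l u <> 0.
Proof.
move=> uW; pose q : 'End(V) := (\1 - projv W)%VF.
have qW w : w \in W -> q w = 0.
  by move=> wW; rewrite /q add_lfunE opp_lfunE id_lfunE projv_id // subrr.
have qu : q u <> 0.
  rewrite /q add_lfunE opp_lfunE id_lfunE => /eqP; rewrite subr_eq0 => /eqP uE.
  by move: uW; rewrite uE memv_proj.
have [i ci] : exists i, coord (vbasis {:V}) i (q u) <> 0.
  apply: contrapT => no; apply: qu.
  rewrite (coord_vbasis (memvf (q u))) big1 // => i _.
  have [->|/eqP ne] := eqVneq (coord (vbasis {:V}) i (q u)) 0.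
    by rewrite scale0r.
  by case: no; exists i.
have lin : linear (fun v => coord (vbasis {:V}) i v : k^o).
  by move=> c x y; rewrite linearP.
exists (linfun (fun v => coord (vbasis {:V}) i v : k^o) \o q)%VF.
split=> [w wW|]; rewrite comp_lfunE (linfunE lin) //.
by rewrite qW // linear0.
Qed.

Lemma factor_functional V W (F : 'Hom(V, W)) (m : 'Hom(V, k^o)) :
  (forall x, F x = 0 -> m x = 0) -> exists l : 'Hom(W, k^o), (l \o F)%VF = m.
Proof.
move=> Fm; exists (m \o F^-1)%VF; apply/lfunP=> x; rewrite !comp_lfunE /=.
apply/eqP; rewrite -subr_eq0 -linearB /=; apply/eqP/Fm.
by rewrite linearB /= limg_lfunVK ?memv_img ?memvf // subrr.
Qed.

Lemma lker0E U V (f : 'Hom(U, V)) :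
  lker f = 0%VS <-> (forall x, f x = 0 -> x = 0).
Proof.
split=> [f0 x fx|f0].
  by apply/eqP; rewrite -memv0 -f0 memv_ker fx.
apply/eqP; rewrite -subv0; apply/subvP=> x; rewrite memv_ker memv0 => /eqP.
by move/f0 ->.
Qed.

Lemma limgTE U V (f : 'Hom(U, V)) :
  limg f = fullv <-> (forall y, exists x, f x = y).
Proof.
split=> [fT y|fT].
  have /memv_imgP[x _ ->] : y \in limg f by rewrite fT memvf.
  by exists x.
apply/eqP; rewrite eqEsubv subvf; apply/subvP=> y _.
by have [x <-] := fT y; rewrite memv_img ?memvf.
Qed.

Lemma mem_limgE U V (f : 'Hom(U, V)) y :
  y \in limg f <-> exists x, f x = y.
Proof.
by split=> [/memv_imgP[x _ ->]|[x <-]]; [exists x | rewrite memv_img ?memvf].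
Qed.

Lemma dim_mono U V (f : 'Hom(U, V)) : lker f = 0%VS ->
  (\dim {:U} <= \dim {:V})%N.
Proof.
by move=> f0; rewrite -(@limg_dim_eq _ _ _ f) ?f0 ?capv0 //; apply/dimvS/subvf.
Qed.

Lemma dim_epi U V (f : 'Hom(U, V)) : limg f = fullv ->
  (\dim {:V} <= \dim {:U})%N.
Proof. by move<-; rewrite -(limg_ker_dim f) leq_addl. Qed.

Lemma mono_epi U V (f : 'Hom(U, V)) :
  lker f = 0%VS -> (\dim {:V} <= \dim {:U})%N -> limg f = fullv.
Proof.
move=> f0 d; apply/eqP; rewrite eqEdim subvf /=.
by rewrite (@limg_dim_eq _ _ _ f) ?f0 ?capv0.
Qed.

Lemma epi_mono U V (f : 'Hom(U, V)) :
  limg f = fullv -> (\dim {:U} <= \dim {:V})%N -> lker f = 0%VS.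
Proof.
move=> fT d; apply/eqP; rewrite -dimv_eq0 -(capfv (lker f)).
by have := limg_ker_dim f fullv; rewrite fT => /eqP; move: d; case: (\dim (_ :&: _)) => // n;
  rewrite addSn => d /eqP E; rewrite -E ltnNge leq_addl in d.
Qed.

End LinearAlgebra.

(** * Homomorphisms, submodules and quotients *)

Section Homs.
Variables (k : fieldType) (A : falgType k) (s : side).
Implicit Types (C E K M N P Q X Y Z : amod A s).

Lemma amod_homP M N (f : 'Hom(M, N)) :
  amod_hom f <-> forall a x, f (act M a x) = act N a (f x).
Proof.
split=> [fH a x|fH a]; first by rewrite -!comp_lfunE fH.
by apply/lfunP=> x; rewrite !comp_lfunE fH.
Qed.

Lemma homE M N (f : 'Hom(M, N)) a x :
  amod_hom f -> f (act M a x) = act N a (f x).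
Proof. by move/amod_homP. Qed.

Lemma act_reg M a b x : act M (reg_act s a b) x = act M a (act M b x).
Proof.
suff key (t : side) (F : A -> 'End(M)) :
    (forall c d, F (c * d) = side_comp t (F c) (F d)) ->
    F (reg_act t a b) x = F a (F b x) by apply: key; apply: actM.
by case: t => FM; rewrite /reg_act lfunE /= FM comp_lfunE.
Qed.

Lemma act_1 M x : act M 1 x = x.
Proof. by rewrite act1 id_lfunE. Qed.

Lemma hom_id M : amod_hom (\1%VF : 'End(M)).
Proof. by move=> a; rewrite comp_lfun1l comp_lfun1r. Qed.

Lemma hom_0 M N : amod_hom (0 : 'Hom(M, N)).
Proof. by move=> a; rewrite comp_lfun0l comp_lfun0r. Qed.

Lemma hom_comp M N P (g : 'Hom(N, P)) (f : 'Hom(M, N)) :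
  amod_hom g -> amod_hom f -> amod_hom (g \o f)%VF.
Proof. by move=> gH fH a; rewrite -comp_lfunA fH !comp_lfunA gH. Qed.

Lemma hom_add M N (f g : 'Hom(M, N)) :
  amod_hom f -> amod_hom g -> amod_hom (f + g).
Proof. by move=> fH gH a; rewrite comp_lfunDl comp_lfunDr fH gH. Qed.

Lemma hom_opp M N (f : 'Hom(M, N)) : amod_hom f -> amod_hom (- f).
Proof. by move=> fH a; rewrite comp_lfunNl comp_lfunNr fH. Qed.

Lemma hom_sub M N (f g : 'Hom(M, N)) :
  amod_hom f -> amod_hom g -> amod_hom (f - g).
Proof. by move=> fH gH; apply: hom_add => //; apply: hom_opp. Qed.

Lemma hom_scale M N c (f : 'Hom(M, N)) : amod_hom f -> amod_hom (c *: f).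
Proof. by move=> fH a; rewrite -comp_lfunZl -comp_lfunZr fH. Qed.

Lemma submodule_ex M (P : M -> Prop) :
  P 0 -> (forall c x y, P x -> P y -> P (c *: x + y)) ->
  (forall a x, P x -> P (act M a x)) ->
  exists K (i : 'Hom(K, M)),
    [/\ amod_hom i, is_mono i & forall x, (exists y, i y = x) <-> P x].
Proof.
move=> P0 PD PA; have [U UP] := vspace_of_pred P0 PD.
have UA a (u : subvs_of U) : act M a (vsval u) \in U.
  by apply/UP/PA/UP; apply: subvsP.
pose f a (u : subvs_of U) := vsproj U (act M a (vsval u)).
have f_lin a : linear (f a) by move=> c x y; rewrite /f !linearP.
pose F a : 'End(subvs_of U) := linfun (f a).
have FE a u : vsval (F a u) = act M a (vsval u).
  by rewrite (linfunE (f_lin a)) vsprojK.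
have F_lin : linear F.
  move=> c a b; apply/lfunP=> u; apply: val_inj.
  by rewrite add_lfunE scale_lfunE /= !FE act_linear add_lfunE scale_lfunE.
have F1 : F 1 = \1%VF.
  by apply/lfunP=> u; apply: val_inj; rewrite /= FE act_1 id_lfunE.
have FM a b : F (a * b) = side_comp s (F a) (F b).
  suff key t : act M (a * b) = side_comp t (act M a) (act M b) ->
      F (a * b) = side_comp t (F a) (F b) by apply/key/actM.
  by case: t => E; apply/lfunP=> u; apply: val_inj;
    rewrite /= FE E comp_lfunE /= !comp_lfunE !FE.
pose i : 'Hom(subvs_of U, M) := linfun vsval.
exists (AMod F_lin F1 FM), i; split.
- by apply/amod_homP=> a x; rewrite !lfunE /= FE.
- by apply/lker0E=> x; rewrite lfunE /= => x0; apply: subvs_inj; rewrite x0 linear0.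
move=> x; rewrite -UP; split=> [[y <-]|xU]; first by rewrite lfunE subvsP.
by exists (vsproj U x); rewrite lfunE /= vsprojK.
Qed.

Lemma kernel_ex M N (f : 'Hom(M, N)) : amod_hom f ->
  exists K (i : 'Hom(K, M)), [/\ amod_hom i, is_mono i & limg i = lker f].
Proof.
move=> fH; have [||| K [i [iH im iE]]] := @submodule_ex M (fun x => f x = 0).
- by rewrite linear0.
- by move=> c x y fx fy; rewrite linearP /= fx fy scaler0 addr0.
- by move=> a x fx; rewrite homE // fx linear0.
exists K, i; split=> //; apply/vspaceP=> x; rewrite memv_ker.
by apply/idP/eqP => [/mem_limgE/iE|/iE/mem_limgE].
Qed.

Lemma image_ex M N (f : 'Hom(M, N)) : amod_hom f ->
  exists K (i : 'Hom(K, N)), [/\ amod_hom i, is_mono i & limg i = limg f].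
Proof.
move=> fH.
have [||| K [i [iH im iE]]] := @submodule_ex N (fun y => exists x, f x = y).
- by exists 0; rewrite linear0.
- by move=> c _ _ [x <-] [y <-]; exists (c *: x + y); rewrite linearP.
- by move=> a _ [x <-]; exists (act M a x); rewrite homE.
exists K, i; split=> //; apply/vspaceP=> x.
by apply/idP/idP => /mem_limgE/iE/mem_limgE //; move/mem_limgE.
Qed.

(** The quotient is realised on a linear complement W of the image, on which a acts
    by acting in N and projecting back to W. *)
Lemma cokernel_ex M N (f : 'Hom(M, N)) : amod_hom f ->
  exists C (p : 'Hom(N, C)), [/\ amod_hom p, is_epi p & lker p = limg f].
Proof.
move=> fH; pose U := limg f; pose W := (U^C)%VS.
have UA a x : x \in U -> act N a x \in U.
  by case/mem_limgE=> y <-; apply/mem_limgE; exists (act M a y); rewrite homE.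
pose q : 'End(N) := daddv_pi W U.
have capWU : (W :&: U = 0)%VS by rewrite capvC capv_compl.
have sumWU x : x \in (W + U)%VS by rewrite addvC addv_complf memvf.
have qB x : x - q x \in U.
  have /(daddv_pi_add capWU) {1}<- := sumWU x.
  by rewrite addrC addKr memv_pi.
have qW x : q x \in W by apply: memv_pi.
have qidW x : x \in W -> q x = x by apply: daddv_pi_id.
have qU x : x \in U -> q x = 0.
  move=> xU; apply/eqP; rewrite -memv0 -capWU memv_cap qW /=.
  have -> : q x = x - (x - q x) by rewrite subKr.
  exact: memvB.
have qA a x : q (act N a (q x)) = q (act N a x).
  apply/eqP; rewrite eq_sym -subr_eq0 -!linearB /=; apply/eqP/qU.
  exact/UA/qB.
pose p : 'Hom(N, subvs_of W) := (linfun (vsproj W) \o q)%VF.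
have pE x : vsval (p x) = q x by rewrite comp_lfunE lfunE /= vsprojK.
have [F FE] : exists F : A -> 'End(subvs_of W),
    forall a u, vsval (F a u) = q (act N a (vsval u)).
  exists (fun a => p \o act N a \o linfun vsval)%VF => a u.
  by rewrite comp_lfunE (lfunE vsval) comp_lfunE pE.
have F_lin : linear F.
  move=> c a b; apply/lfunP=> u; apply: val_inj.
  rewrite add_lfunE scale_lfunE /= !FE act_linear add_lfunE scale_lfunE.
  by rewrite linearP.
have F1 : F 1 = \1%VF.
  apply/lfunP=> u; apply: val_inj; rewrite /= FE act_1 id_lfunE qidW //.
  exact: subvsP.
have FM a b : F (a * b) = side_comp s (F a) (F b).
  suff key t : act N (a * b) = side_comp t (act N a) (act N b) ->
      F (a * b) = side_comp t (F a) (F b) by apply/key/actM.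
  by case: t => E; apply/lfunP=> u; apply: val_inj;
    rewrite /= FE E comp_lfunE /= !comp_lfunE !FE qA.
exists (AMod F_lin F1 FM), p; split.
- by apply/amod_homP=> a x; apply: val_inj; rewrite /= FE !pE qA.
- apply/limgTE=> y; exists (vsval y); apply: val_inj; rewrite /= pE qidW //.
  exact: subvsP.
apply/vspaceP=> x; rewrite memv_ker; apply/eqP/idP => [px|xU].
  by rewrite -/U; have := qB x; rewrite -pE px (linear0 vsval) subr0.
by apply: subvs_inj; rewrite pE qU // (linear0 vsval).
Qed.

Lemma mono_lift X K M (i : 'Hom(K, M)) (h : 'Hom(X, M)) :
  amod_hom i -> is_mono i -> amod_hom h -> (limg h <= limg i)%VS ->
  exists h' : 'Hom(X, K), amod_hom h' /\ (i \o h')%VF = h.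
Proof.
move=> iH im hH sub; exists (i^-1 \o h)%VF.
have hE x : i ((i^-1)%VF (h x)) = h x.
  by rewrite limg_lfunVK // (subvP sub) ?memv_img ?memvf.
split; last by apply/lfunP=> x; rewrite !comp_lfunE hE.
apply/amod_homP=> a x; rewrite !comp_lfunE.
apply/eqP; rewrite -subr_eq0 -memv0 -im memv_ker linearB /=.
by rewrite (homE _ _ iH) !hE (homE _ _ hH) subrr.
Qed.

Lemma epi_desc M C X (p : 'Hom(M, C)) (h : 'Hom(M, X)) :
  amod_hom p -> is_epi p -> amod_hom h -> (lker p <= lker h)%VS ->
  exists h' : 'Hom(C, X), amod_hom h' /\ (h' \o p)%VF = h.
Proof.
move=> pH pe hH sub; exists (h \o p^-1)%VF.
have hE x : h ((p^-1)%VF (p x)) = h x.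
  apply/eqP; rewrite -subr_eq0 -linearB /= -memv_ker (subvP sub) //.
  by rewrite memv_ker linearB /= limg_lfunVK ?memv_img ?memvf // subrr.
split; last by apply/lfunP=> x; rewrite !comp_lfunE hE.
apply/amod_homP=> a y; have /limgTE/(_ y)[x <-] := pe.
by rewrite !comp_lfunE -homE // !hE homE.
Qed.

Lemma mono_cancel X K M (i : 'Hom(K, M)) (f g : 'Hom(X, K)) :
  is_mono i -> (i \o f = i \o g)%VF -> f = g.
Proof.
move=> /lker0E im E; apply/lfunP=> x; apply/eqP; rewrite -subr_eq0; apply/eqP/im.
by rewrite linearB /= -!comp_lfunE E subrr.
Qed.

Definition inverse_homs M N (f : 'Hom(M, N)) (g : 'Hom(N, M)) : Prop :=
  [/\ amod_hom f, amod_hom g, (g \o f)%VF = \1%VF & (f \o g)%VF = \1%VF].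

Definition is_iso M N (f : 'Hom(M, N)) : Prop := exists g, inverse_homs f g.

Lemma mono_section M N (f : 'Hom(M, N)) (g : 'Hom(N, M)) :
  (g \o f)%VF = \1%VF -> is_mono f.
Proof.
by move=> gf; apply/lker0E=> x fx; rewrite -(id_lfunE x) -gf comp_lfunE fx linear0.
Qed.

Lemma epi_retraction M N (f : 'Hom(M, N)) (g : 'Hom(N, M)) :
  (g \o f)%VF = \1%VF -> is_epi g.
Proof.
by move=> gf; apply/limgTE=> x; exists (f x); rewrite -comp_lfunE gf id_lfunE.
Qed.

Lemma is_isoP M N (f : 'Hom(M, N)) : amod_hom f ->
  is_iso f <-> is_mono f /\ is_epi f.
Proof.
move=> fH; split=> [[g [_ _ gf fg]]|[fm fe]].
  by split; [apply: mono_section gf | apply: epi_retraction fg].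
have [|g [gH fg]] := mono_lift fH fm (hom_id N); first by rewrite fe subvf.
exists g; split=> //; apply: (mono_cancel fm).
by rewrite comp_lfunA fg comp_lfun1l comp_lfun1r.
Qed.

Lemma isoP M N : iso M N <-> exists f g, @inverse_homs M N f g.
Proof.
split=> [[f [fH fm fe]]|[f [g fg]]].
  by exists f; apply/is_isoP.
have fH : amod_hom f by case: fg.
by exists f; have /is_isoP[] : is_iso f by exists g.
Qed.

Lemma iso_refl M : iso M M.
Proof. by apply/isoP; exists \1%VF, \1%VF; split; rewrite ?comp_lfun1l //; apply: hom_id. Qed.

Lemma iso_sym M N : iso M N -> iso N M.
Proof. by case/isoP=> f [g [? ? ? ?]]; apply/isoP; exists g, f; split. Qed.

Lemma iso_trans N M P : iso M N -> iso N P -> iso M P.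
Proof.
case/isoP=> f [g [fH gH gf fg]] /isoP[f' [g' [fH' gH' gf' fg']]].
apply/isoP; exists (f' \o f)%VF, (g \o g')%VF; split; try exact: hom_comp.
  by rewrite comp_lfunA -(comp_lfunA g) gf' comp_lfun1r.
by rewrite comp_lfunA -(comp_lfunA f') fg comp_lfun1r.
Qed.

Lemma iso_dim M N : iso M N -> \dim {:M} = \dim {:N}.
Proof.
by case=> f [_ fm fe]; apply/eqP; rewrite eqn_leq (dim_mono fm) (dim_epi fe).
Qed.

Lemma endo_mono_iso M (f : 'End(M)) : amod_hom f -> is_mono f -> is_iso f.
Proof. by move=> fH fm; apply/is_isoP => //; split=> //; apply: mono_epi. Qed.

Lemma endo_epi_iso M (f : 'End(M)) : amod_hom f -> is_epi f -> is_iso f.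
Proof. by move=> fH fe; apply/is_isoP => //; split=> //; apply: epi_mono. Qed.

Lemma zeroP M : is_zero M <-> forall x : M, x = 0.
Proof.
rewrite /is_zero; split=> [/eqP|M0]; last first.
  apply/eqP; rewrite dimv_eq0 -subv0; apply/subvP=> x _.
  by rewrite (M0 x) mem0v.
by rewrite dimv_eq0 => /eqP M0 x; apply/eqP; rewrite -memv0 -M0 memvf.
Qed.

Lemma zero_id M : is_zero M <-> (\1%VF : 'End(M)) = 0.
Proof.
rewrite zeroP; split=> [M0|E x]; first by apply/lfunP=> x; rewrite [LHS]M0 zero_lfunE.
by rewrite -(id_lfunE x) E zero_lfunE.
Qed.

Lemma zero_iso M N : iso M N -> is_zero M -> is_zero N.
Proof. by move/iso_dim => E; rewrite /is_zero E. Qed.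

Lemma iso_zero M N : is_zero M -> is_zero N -> iso M N.
Proof.
move=> /zero_id M0 /zero_id N0; apply/isoP; exists 0, 0.
by split; try exact: hom_0; rewrite comp_lfun0l ?M0 ?N0.
Qed.

End Homs.

#[local] Hint Resolve hom_id hom_0 : hom.
#[local] Hint Resolve hom_comp hom_add hom_sub hom_opp hom_scale : hom.

(** * Direct sums and retracts *)

Section Sums.
Variables (k : fieldType) (A : falgType k) (s : side).
Implicit Types (C E I K M N P Q X Y Z : amod A s).

Lemma iso_of_fun M N (f : M -> N) (g : N -> M) :
  linear f -> (forall a x, f (act M a x) = act N a (f x)) ->
  cancel f g -> cancel g f -> iso M N.
Proof.
move=> f_lin fA fK gK; exists (linfun f); split.
- by apply/amod_homP=> a x; rewrite !(linfunE f_lin).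
- apply/lker0E=> x; rewrite (linfunE f_lin) => fx.
  by apply: (can_inj fK); rewrite fx -(linfunE f_lin) linear0.
- by apply/limgTE=> y; exists (g y); rewrite (linfunE f_lin).
Qed.

Lemma dsum2_actE M N a (u : dsum2 M N) :
  act (dsum2 M N) a u = (act M a u.1, act N a u.2).
Proof. by rewrite lfunE. Qed.

Definition dinl M N : 'Hom(M, dsum2 M N) := linfun (fun x => (x, 0) : dsum2 M N).
Definition dinr M N : 'Hom(N, dsum2 M N) := linfun (fun x => (0, x) : dsum2 M N).
Definition dfst M N : 'Hom(dsum2 M N, M) := linfun (fun u : dsum2 M N => u.1).
Definition dsnd M N : 'Hom(dsum2 M N, N) := linfun (fun u : dsum2 M N => u.2).

Lemma dinlE M N x : dinl M N x = (x, 0).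
Proof. by apply: linfunE => c u v; congr (_, _); rewrite /= scaler0 addr0. Qed.
Lemma dinrE M N x : dinr M N x = (0, x).
Proof. by apply: linfunE => c u v; congr (_, _); rewrite /= scaler0 addr0. Qed.
Lemma dfstE M N u : dfst M N u = u.1.
Proof. by apply: linfunE. Qed.
Lemma dsndE M N u : dsnd M N u = u.2.
Proof. by apply: linfunE. Qed.

Lemma hom_dinl M N : amod_hom (dinl M N).
Proof. by apply/amod_homP=> a x; rewrite dsum2_actE !dinlE /= linear0. Qed.
Lemma hom_dinr M N : amod_hom (dinr M N).
Proof. by apply/amod_homP=> a x; rewrite dsum2_actE !dinrE /= linear0. Qed.
Lemma hom_dfst M N : amod_hom (dfst M N).
Proof. by apply/amod_homP=> a x; rewrite !dfstE dsum2_actE. Qed.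
Lemma hom_dsnd M N : amod_hom (dsnd M N).
Proof. by apply/amod_homP=> a x; rewrite !dsndE dsum2_actE. Qed.
Hint Resolve hom_dinl hom_dinr hom_dfst hom_dsnd : hom.

Definition dpair M X Y (f : 'Hom(M, X)) (g : 'Hom(M, Y)) : 'Hom(M, dsum2 X Y) :=
  ((dinl X Y \o f) + (dinr X Y \o g))%VF.
Definition dcase M X Y (f : 'Hom(X, M)) (g : 'Hom(Y, M)) : 'Hom(dsum2 X Y, M) :=
  ((f \o dfst X Y) + (g \o dsnd X Y))%VF.

Lemma dpairE M X Y (f : 'Hom(M, X)) (g : 'Hom(M, Y)) x :
  dpair f g x = (f x, g x).
Proof.
rewrite add_lfunE !comp_lfunE dinlE dinrE.
by congr (_, _); rewrite /= ?addr0 ?add0r.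
Qed.
Lemma dcaseE M X Y (f : 'Hom(X, M)) (g : 'Hom(Y, M)) u :
  dcase f g u = f u.1 + g u.2.
Proof. by rewrite add_lfunE !comp_lfunE dfstE dsndE. Qed.

Lemma hom_dpair M X Y (f : 'Hom(M, X)) (g : 'Hom(M, Y)) :
  amod_hom f -> amod_hom g -> amod_hom (dpair f g).
Proof. by move=> fH gH; rewrite /dpair; auto with hom. Qed.
Lemma hom_dcase M X Y (f : 'Hom(X, M)) (g : 'Hom(Y, M)) :
  amod_hom f -> amod_hom g -> amod_hom (dcase f g).
Proof. by move=> fH gH; rewrite /dcase; auto with hom. Qed.

Lemma dsum2C X Y : iso (dsum2 X Y) (dsum2 Y X).
Proof.
apply: (@iso_of_fun (dsum2 X Y) (dsum2 Y X)
          (fun u => (u.2, u.1)) (fun u => (u.2, u.1))) => //.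
- by move=> a x; rewrite !dsum2_actE.
- by case.
- by case.
Qed.

Lemma dsum2A X Y Z : iso (dsum2 (dsum2 X Y) Z) (dsum2 X (dsum2 Y Z)).
Proof.
apply: (@iso_of_fun (dsum2 (dsum2 X Y) Z) (dsum2 X (dsum2 Y Z))
   (fun u => (u.1.1, (u.1.2, u.2))) (fun u => ((u.1, u.2.1), u.2.2))) => //.
- by move=> a x; rewrite !dsum2_actE.
- by case=> [[]].
- by case=> [? []].
Qed.

Lemma iso_dsum2 X X' Y Y' : iso X X' -> iso Y Y' -> iso (dsum2 X Y) (dsum2 X' Y').
Proof.
case/isoP=> f [f' [fH fH' f'f ff']] /isoP[g [g' [gH gH' g'g gg']]].
have fK x : f' (f x) = x by rewrite -comp_lfunE f'f id_lfunE.
have fK' x : f (f' x) = x by rewrite -comp_lfunE ff' id_lfunE.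
have gK x : g' (g x) = x by rewrite -comp_lfunE g'g id_lfunE.
have gK' x : g (g' x) = x by rewrite -comp_lfunE gg' id_lfunE.
apply: (@iso_of_fun (dsum2 X Y) (dsum2 X' Y')
   (fun u => (f u.1, g u.2)) (fun u => (f' u.1, g' u.2))) => //.
- by move=> c u v; congr (_, _); rewrite /= linearP.
- by move=> a x; rewrite !dsum2_actE !homE.
- by case=> x y /=; rewrite fK gK.
- by case=> x y /=; rewrite fK' gK'.
Qed.

Lemma iso_dsum2l X X' Y : iso X X' -> iso (dsum2 X Y) (dsum2 X' Y).
Proof. by move=> XX'; apply: iso_dsum2 => //; apply: iso_refl. Qed.

Lemma iso_dsum2r X Y Y' : iso Y Y' -> iso (dsum2 X Y) (dsum2 X Y').
Proof. by move=> YY'; apply: iso_dsum2 => //; apply: iso_refl. Qed.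

Lemma dsum2CA X Y Z : iso (dsum2 X (dsum2 Y Z)) (dsum2 Y (dsum2 X Z)).
Proof.
apply: iso_trans (iso_sym (dsum2A _ _ _)) _.
apply: iso_trans (dsum2A _ _ _); apply: iso_dsum2l; apply: dsum2C.
Qed.

Lemma dsum2ACA X Y Z W : iso (dsum2 (dsum2 X Y) (dsum2 Z W))
  (dsum2 (dsum2 X Z) (dsum2 Y W)).
Proof.
apply: iso_trans (dsum2A _ _ _) _; apply: iso_trans (iso_sym (dsum2A _ _ _)).
by apply: iso_dsum2r; apply: dsum2CA.
Qed.

Lemma dsum2_zerol X Y : is_zero X -> iso (dsum2 X Y) Y.
Proof.
move=> /zeroP X0.
apply: (@iso_of_fun (dsum2 X Y) Y (fun u => u.2) (fun y => (0, y))) => //.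
- by move=> a x; rewrite !dsum2_actE.
- by case=> x y; rewrite (X0 x).
Qed.

Lemma dsum2_zeror X Y : is_zero Y -> iso (dsum2 X Y) X.
Proof. by move=> Y0; apply: iso_trans (dsum2C _ _) _; apply: dsum2_zerol. Qed.

Lemma zero_amod0 : is_zero (amod0 A s).
Proof. by apply/zeroP=> x; rewrite [LHS]thinmx0. Qed.

Lemma dim_dsum2 X Y : \dim {:dsum2 X Y} = (\dim {:X} + \dim {:Y})%N.
Proof. by rewrite !dimvf. Qed.

Lemma dsum2_is_zero X Y : is_zero (dsum2 X Y) <-> is_zero X /\ is_zero Y.
Proof.
rewrite /is_zero dim_dsum2; split=> [/eqP|[-> ->]//].
by rewrite addn_eq0 => /andP[/eqP -> /eqP ->].
Qed.

Definition retract X M : Prop :=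
  exists (i : 'Hom(X, M)) (p : 'Hom(M, X)),
    [/\ amod_hom i, amod_hom p & (p \o i)%VF = \1%VF].

Lemma retract_trans X Y Z : retract X Y -> retract Y Z -> retract X Z.
Proof.
case=> i [p [iH pH pi]] [j [q [jH qH qj]]].
exists (j \o i)%VF, (p \o q)%VF; split; try exact: hom_comp.
by rewrite -comp_lfunA (comp_lfunA q) qj comp_lfun1l.
Qed.

Lemma iso_retract X Y : iso X Y -> retract X Y.
Proof. by case/isoP=> f [g [fH gH gf fg]]; exists f, g. Qed.

Lemma retract_refl X : retract X X.
Proof. exact/iso_retract/iso_refl. Qed.

Lemma retract_l X Y : retract X (dsum2 X Y).
Proof.
exists (dinl X Y), (dfst X Y); split; auto with hom.
by apply/lfunP=> x; rewrite comp_lfunE dinlE dfstE id_lfunE.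
Qed.

Lemma retract_r X Y : retract Y (dsum2 X Y).
Proof.
exists (dinr X Y), (dsnd X Y); split; auto with hom.
by apply/lfunP=> x; rewrite comp_lfunE dinrE dsndE id_lfunE.
Qed.

Definition biproduct M X Y (i : 'Hom(X, M)) (j : 'Hom(Y, M))
    (p : 'Hom(M, X)) (q : 'Hom(M, Y)) : Prop :=
  [/\ amod_hom i /\ amod_hom j, amod_hom p /\ amod_hom q,
      (p \o i = \1)%VF /\ (q \o j = \1)%VF, (p \o j = 0)%VF /\ (q \o i = 0)%VF
    & ((i \o p) + (j \o q) = \1)%VF].

Lemma biproduct_iso M X Y i j p q : @biproduct M X Y i j p q -> iso M (dsum2 X Y).
Proof.
case=> [[iH jH] [pH qH] [pi qj] [pj qi] ijpq]; apply/isoP.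
exists (dpair p q), (dcase i j); split; [exact: hom_dpair|exact: hom_dcase| |].
  apply/lfunP=> x; rewrite comp_lfunE dcaseE dpairE /= -ijpq.
  by rewrite add_lfunE !comp_lfunE.
apply/lfunP=> -[x y]; rewrite comp_lfunE dcaseE dpairE id_lfunE !linearD /=.
rewrite -!comp_lfunE pi pj qi qj !id_lfunE !zero_lfunE.
by rewrite addr0 add0r.
Qed.

Lemma iso_biproduct M X Y : iso M (dsum2 X Y) ->
  exists i j p q, @biproduct M X Y i j p q.
Proof.
case/isoP=> f [g [fH gH gf fg]].
exists (g \o dinl X Y)%VF, (g \o dinr X Y)%VF, (dfst X Y \o f)%VF, (dsnd X Y \o f)%VF.
have fgE u : f (g u) = u by rewrite -comp_lfunE fg id_lfunE.
split; [split|split|split|split|]; auto with hom; try (apply/lfunP=> x;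
  rewrite !comp_lfunE fgE ?dinlE ?dinrE ?dfstE ?dsndE ?id_lfunE ?zero_lfunE //).
apply/lfunP=> x; rewrite add_lfunE !comp_lfunE dfstE dsndE dinlE dinrE.
rewrite -linearD id_lfunE -[RHS]id_lfunE -gf comp_lfunE; congr (g _).
by case: (f x) => u v; congr (_, _); rewrite /= ?addr0 ?add0r.
Qed.

Lemma retract_biproduct X M (i : 'Hom(X, M)) (p : 'Hom(M, X)) :
  amod_hom i -> amod_hom p -> (p \o i)%VF = \1%VF ->
  exists Y (j : 'Hom(Y, M)) (q : 'Hom(M, Y)), biproduct i j p q.
Proof.
move=> iH pH pi; have [Y [j [jH jm jE]]] := kernel_ex pH.
have pj : (p \o j = 0)%VF.
  apply/lfunP=> y; rewrite comp_lfunE zero_lfunE; apply/eqP.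
  by rewrite -memv_ker -jE memv_img ?memvf.
have [||q [qH qE]] := @mono_lift _ _ _ M _ _ j (\1 - (i \o p))%VF jH jm.
- by auto with hom.
- rewrite jE; apply/subvP=> x /mem_limgE[y <-].
  rewrite memv_ker add_lfunE opp_lfunE comp_lfunE id_lfunE linearB /=.
  by rewrite -(comp_lfunE p) pi id_lfunE subrr.
exists Y, j, q; split=> //.
- split=> //; apply: (mono_cancel jm).
  rewrite comp_lfunA qE comp_lfunDl comp_lfunNl -comp_lfunA pj.
  by rewrite comp_lfun0r subr0 comp_lfun1l comp_lfun1r.
- split=> //; apply: (mono_cancel jm).
  rewrite comp_lfunA qE comp_lfunDl comp_lfunNl -comp_lfunA pi.
  by rewrite comp_lfun0r comp_lfun1r comp_lfun1l subrr.
- by rewrite qE addrC subrK.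
Qed.

Lemma summandP X M : summand X M <-> retract X M.
Proof.
split=> [[Y XY]|[i [p [iH pH pi]]]].
  exact: retract_trans (retract_l X Y) (iso_retract (iso_sym XY)).
have [Y [j [q ijpq]]] := retract_biproduct iH pH pi.
by exists Y; apply: biproduct_iso ijpq.
Qed.

Lemma retract_zero X M : retract X M -> is_zero M -> is_zero X.
Proof.
case=> i [p [iH pH pi]] /zeroP M0; apply/zeroP=> x.
by rewrite -(id_lfunE x) -pi comp_lfunE (M0 (i x)) linear0.
Qed.

Lemma iso_indec X Y : iso X Y -> indec X -> indec Y.
Proof.
move=> XY [X0 Xi]; split=> [|Z W YZW].
  by move=> Y0; apply: X0; apply: zero_iso Y0; apply: iso_sym.
by apply: Xi; apply: iso_trans YZW.
Qed.

Lemma indec_retract X Y (i : 'Hom(X, Y)) (p : 'Hom(Y, X)) :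
  ~ is_zero X -> indec Y -> amod_hom i -> amod_hom p -> (p \o i)%VF = \1%VF ->
  inverse_homs i p.
Proof.
move=> X0 [Y0 Yi] iH pH pi; have [Z [j [q ijpq]]] := retract_biproduct iH pH pi.
have [//|/zero_id Z0] := Yi _ _ (biproduct_iso ijpq).
split=> //; case: ijpq => _ _ _ _ <-.
by rewrite -[j]comp_lfun1r Z0 comp_lfun0r comp_lfun0l addr0.
Qed.

Lemma indec_retract_iso X Y : ~ is_zero X -> indec Y -> retract X Y -> iso X Y.
Proof.
move=> X0 Yi [i [p [iH pH pi]]]; apply/isoP; exists i, p.
exact: indec_retract.
Qed.

Lemma dsum_cat (Xs Ys : seq (amod A s)) :
  iso (dsum (Xs ++ Ys)) (dsum2 (dsum Xs) (dsum Ys)).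
Proof.
elim: Xs => [|X Xs IH] /=.
  exact/iso_sym/dsum2_zerol/zero_amod0.
by apply: iso_trans (iso_dsum2r X IH) _; apply/iso_sym/dsum2A.
Qed.

Lemma dsum_rem (Xs Ys : seq (amod A s)) Y :
  iso (dsum (Xs ++ Y :: Ys)) (dsum2 Y (dsum (Xs ++ Ys))).
Proof.
apply: iso_trans (dsum_cat _ _) _; apply: iso_trans (dsum2CA _ _ _) _.
by apply: iso_dsum2r; apply/iso_sym/dsum_cat.
Qed.

Lemma retract_dsum X (Xs : seq (amod A s)) : List.In X Xs -> retract X (dsum Xs).
Proof.
elim: Xs => [|Y Xs IH] //= [->|/IH XXs]; first exact: retract_l.
exact: retract_trans XXs (retract_r _ _).
Qed.

Lemma indec_decomposition M :
  exists Xs : seq (amod A s), (forall X, List.In X Xs -> indec X) /\ iso M (dsum Xs).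
Proof.
have [n] := ubnP (\dim {:M}); elim: n M => // n IH M; rewrite ltnS => dM.
have [M0|M0] := pselect (is_zero M).
  by exists [::]; split=> //; apply: iso_zero => //; apply: zero_amod0.
have [Mi|Mi] := pselect (indec M).
  exists [:: M]; split=> [X [<-|]//|] /=.
  exact/iso_sym/dsum2_zeror/zero_amod0.
have [X [Y [XY X0 Y0]]] :
    exists X Y, [/\ iso M (dsum2 X Y), ~ is_zero X & ~ is_zero Y].
  apply: contrapT => no; apply: Mi; split=> // X Y XY.
  have [|X0] := pselect (is_zero X); first by left.
  have [|Y0] := pselect (is_zero Y); first by right.
  by case: no; exists X, Y.
have dE := iso_dim XY; rewrite dim_dsum2 in dE.
have X1 : (0 < \dim {:X})%N by rewrite lt0n; apply/eqP.
have Y1 : (0 < \dim {:Y})%N by rewrite lt0n; apply/eqP.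
have [|Xs [Xsi XsE]] := IH X.
  by apply: leq_trans dM; rewrite dE -addn1 leq_add2l.
have [|Ys [Ysi YsE]] := IH Y.
  by apply: leq_trans dM; rewrite dE -add1n leq_add2r.
exists (Xs ++ Ys); split=> [Z ZXY|]; first by case: (List.in_app_or _ _ _ ZXY); auto.
apply: iso_trans XY _; apply: iso_trans (iso_sym (dsum_cat _ _)).
exact: iso_dsum2.
Qed.

Section Power.
Variables (J : finType) (M : amod A s).

Definition power_fun (a : A) (u : {ffun J -> M}) : {ffun J -> M} :=
  [ffun j => act M a (u j)].

Fact power_fun_lin a : linear (power_fun a).
Proof. by move=> c u v; apply/ffunP=> j; rewrite !ffunE linearP. Qed.

Definition power_act a : 'End({ffun J -> M}) := linfun (power_fun a).

Fact power_actE a u : power_act a u = power_fun a u.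
Proof. by rewrite (linfunE (power_fun_lin a)). Qed.

Fact power_act_linear : linear power_act.
Proof.
move=> c a b; apply/lfunP=> u; rewrite add_lfunE scale_lfunE !power_actE.
by apply/ffunP=> j; rewrite !ffunE act_linear add_lfunE scale_lfunE.
Qed.

Fact power_act1 : power_act 1 = \1%VF.
Proof.
apply/lfunP=> u; rewrite power_actE id_lfunE.
by apply/ffunP=> j; rewrite !ffunE act_1.
Qed.

Fact power_actM a b : power_act (a * b) = side_comp s (power_act a) (power_act b).
Proof.
suff key t : act M (a * b) = side_comp t (act M a) (act M b) ->
    power_act (a * b) = side_comp t (power_act a) (power_act b) by apply/key/actM.
by case: t => E; apply/lfunP=> u; rewrite comp_lfunE !power_actE;
  apply/ffunP=> j; rewrite !ffunE E comp_lfunE.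
Qed.

Definition power : amod A s := AMod power_act_linear power_act1 power_actM.

Lemma power_actffunE a (u : power) j : act power a u j = act M a (u j).
Proof. by rewrite power_actE ffunE. Qed.

Definition power_in j : 'Hom(M, power) :=
  linfun (fun x => [ffun i => if i == j then x else 0] : power).
Definition power_pr j : 'Hom(power, M) := linfun (fun u : power => u j).

Lemma power_inE j x : power_in j x = [ffun i => if i == j then x else 0].
Proof.
apply: linfunE => c u v; apply/ffunP=> i; rewrite !ffunE.
by case: eqP => // _; rewrite scaler0 addr0.
Qed.
Lemma power_prE j u : power_pr j u = u j.
Proof. by apply: (@linfunE _ _ _ (fun u : power => u j)) => c v w; rewrite !ffunE. Qed.

Lemma hom_power_in j : amod_hom (power_in j).
Proof.
apply/amod_homP=> a x; apply/ffunP=> i; rewrite power_actffunE !power_inE !ffunE.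
by case: eqP; rewrite ?linear0.
Qed.
Lemma hom_power_pr j : amod_hom (power_pr j).
Proof. by apply/amod_homP=> a x; rewrite !power_prE power_actffunE. Qed.

Definition power_sum N (f : J -> 'Hom(M, N)) : 'Hom(power, N) :=
  \sum_j (f j \o power_pr j)%VF.

Lemma power_sumE N (f : J -> 'Hom(M, N)) u : power_sum f u = \sum_j f j (u j).
Proof.
by rewrite sum_lfunE; apply: eq_bigr => j _; rewrite comp_lfunE power_prE.
Qed.

Lemma power_sum_in N (f : J -> 'Hom(M, N)) j : (power_sum f \o power_in j)%VF = f j.
Proof.
apply/lfunP=> x; rewrite comp_lfunE power_sumE (bigD1 j) //= power_inE ffunE eqxx.
by rewrite big1 ?addr0 // => i /negPf ij; rewrite ffunE ij linear0.
Qed.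

Lemma hom_power_sum N (f : J -> 'Hom(M, N)) :
  (forall j, amod_hom (f j)) -> amod_hom (power_sum f).
Proof.
move=> fH; apply/amod_homP=> a u; rewrite !power_sumE linear_sum.
by apply: eq_bigr => j _; rewrite power_actffunE homE.
Qed.

Lemma power_in_pr : \sum_j (power_in j \o power_pr j)%VF = \1%VF.
Proof.
apply/lfunP=> u; rewrite sum_lfunE id_lfunE; apply/ffunP=> j; rewrite sum_ffunE.
rewrite (bigD1 j) //= comp_lfunE power_inE power_prE ffunE eqxx big1 ?addr0 // => i ij.
by rewrite comp_lfunE power_inE ffunE eq_sym (negPf ij).
Qed.

End Power.

Lemma power_iso_dsum n M : iso (power 'I_n M) (dsum (nseq n M)).
Proof.
elim: n => [|n IH].
  apply: iso_zero; last exact: zero_amod0.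
  by apply/zeroP=> u; apply/ffunP=> -[].
apply: iso_trans (iso_dsum2r M IH).
pose f (u : power 'I_n.+1 M) : dsum2 M (power 'I_n M) :=
  (u ord0, [ffun i => u (lift ord0 i)]).
pose g (v : dsum2 M (power 'I_n M)) : power 'I_n.+1 M :=
  [ffun i => if unlift ord0 i is Some j then v.2 j else v.1].
apply: (@iso_of_fun _ _ f g).
- move=> c u v; congr (_, _); rewrite ?ffunE //.
  by apply/ffunP=> i; rewrite !ffunE.
- move=> a u; rewrite dsum2_actE; congr (_, _); rewrite ?power_actffunE //.
  by apply/ffunP=> i; rewrite power_actffunE !ffunE power_actffunE.
- by move=> u; apply/ffunP=> i; rewrite ffunE; case: unliftP => [j|] ->; rewrite /= ?ffunE.
- case=> x v; congr (_, _); first by rewrite ffunE unlift_none.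
  by apply/ffunP=> i; rewrite !ffunE liftK.
Qed.

End Sums.
#[local] Hint Resolve hom_dinl hom_dinr hom_dfst hom_dsnd hom_dpair hom_dcase : hom.
#[local] Hint Resolve hom_power_in hom_power_pr hom_power_sum : hom.

(** * Fitting's lemma and the Krull-Schmidt theorem *)

Section KrullSchmidt.
Variables (k : fieldType) (A : falgType k) (s : side).
Implicit Types (C E I K M N P Q X Y Z : amod A s).

Definition fpow M (f : 'End(M)) n : 'End(M) := iter n (fun g => (f \o g)%VF) \1%VF.

Lemma fpowE M (f : 'End(M)) n x : fpow f n x = iter n f x.
Proof. by elim: n => [|n IH] /=; rewrite ?id_lfunE // comp_lfunE IH. Qed.

Lemma fpowD M (f : 'End(M)) m n x : fpow f (m + n) x = fpow f m (fpow f n x).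
Proof. by rewrite !fpowE iterD. Qed.

Lemma hom_fpow M (f : 'End(M)) n : amod_hom f -> amod_hom (fpow f n).
Proof. by move=> fH; elim: n => [|n IH] /=; auto with hom. Qed.

Lemma iso_sum_biproduct M X Y (i : 'Hom(X, M)) (j : 'Hom(Y, M)) :
  amod_hom i -> amod_hom j -> is_iso (dcase i j) -> exists p q, biproduct i j p q.
Proof.
move=> iH jH [g [_ gH gf fg]].
have gE u : g (i u.1 + j u.2) = u by rewrite -dcaseE -comp_lfunE gf id_lfunE.
have giE x : g (i x) = (x, 0) by rewrite -[RHS]gE /= linear0 addr0.
have gjE y : g (j y) = (0, y) by rewrite -[RHS]gE /= linear0 add0r.
exists (dfst X Y \o g)%VF, (dsnd X Y \o g)%VF.
split; [by []|split|split|split|]; auto with hom; try (apply/lfunP=> x;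
  by rewrite !comp_lfunE ?giE ?gjE ?dfstE ?dsndE ?id_lfunE ?zero_lfunE).
apply/lfunP=> x; rewrite add_lfunE !comp_lfunE dfstE dsndE -dcaseE.
by rewrite -comp_lfunE fg.
Qed.

(** For n such that the kernel of f^n is as large as possible, the kernel and the
    image of f^n are complementary. *)
Lemma fitting M (f : 'End(M)) : amod_hom f ->
  exists n K I (i : 'Hom(K, M)) (j : 'Hom(I, M)) (p : 'Hom(M, K)) (q : 'Hom(M, I)),
    [/\ (0 < n)%N, biproduct i j p q, limg i = lker (fpow f n)
      & limg j = limg (fpow f n)].
Proof.
move=> fH; pose good d := `[< exists n, (0 < n)%N /\ \dim (lker (fpow f n)) = d >].
have ex0 : exists d, good d by exists (\dim (lker (fpow f 1))); apply/asboolP; exists 1%N.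
have bd d : good d -> (d <= \dim {:M})%N.
  by case/asboolP=> n [_ <-]; apply/dimvS/subvf.
case: (ex_maxnP ex0 bd) => d /asboolP[n [n0 dn]] maxd.
pose h := fpow f n; have hH : amod_hom h by apply: hom_fpow.
have kk : lker (fpow f (n + n)) = lker h.
  apply/esym/eqP; rewrite eqEdim; apply/andP; split.
    by apply/subvP=> x; rewrite !memv_ker fpowD => /eqP ->; rewrite linear0.
  by rewrite dn; apply: maxd; apply/asboolP; exists (n + n)%N; rewrite addn_gt0 n0.
have [K [i [iH im iE]]] := kernel_ex hH.
have [I [j [jH jm jE]]] := image_ex hH.
have fI : is_iso (dcase i j).
  apply/is_isoP; first by auto with hom.
  have mono : is_mono (dcase i j).
    apply/lker0E=> -[x y]; rewrite dcaseE /= => xy.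
    have [z zE] : exists z, h z = j y by apply/mem_limgE; rewrite -jE memv_img ?memvf.
    have ix : h (i x) = 0 by apply/eqP; rewrite -memv_ker -iE memv_img ?memvf.
    have /eqP z0 : h z == 0.
      rewrite -memv_ker -kk memv_ker fpowD -/h zE.
      by move/eqP: xy; rewrite addrC addr_eq0 => /eqP ->; rewrite linearN /= ix oppr0.
    have y0 : y = 0 by move/lker0E: jm; apply; rewrite -zE.
    have x0 : x = 0 by move/lker0E: im; apply; rewrite -xy y0 linear0 addr0.
    by rewrite x0 y0.
  split=> //; apply: mono_epi => //; rewrite dim_dsum2.
  rewrite -(@limg_dim_eq _ _ _ i) ?im ?capv0 // -(@limg_dim_eq _ _ _ j) ?jm ?capv0 //.
  by rewrite iE jE -[lker h]capfv limg_ker_dim.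
have [p [q B]] := iso_sum_biproduct iH jH fI.
by exists n, K, I, i, j, p, q.
Qed.

Lemma nilpotent_sub_iso M (f : 'End(M)) n :
  amod_hom f -> fpow f n = 0 -> is_iso (\1 - f)%VF.
Proof.
move=> fH fn; apply: endo_mono_iso; first by auto with hom.
apply/lker0E=> x; rewrite add_lfunE opp_lfunE id_lfunE => /eqP.
rewrite subr_eq0 => /eqP xE.
have : fpow f n x = x.
  by rewrite fpowE; elim: n {fn} => //= n IH; rewrite IH -xE.
by rewrite fn zero_lfunE => <-.
Qed.

Lemma indec_endo C (f : 'End(C)) : indec C -> amod_hom f ->
  is_iso f \/ exists n, fpow f n = 0.
Proof.
move=> [C0 Ci] fH; have [n [K [I [i [j [p [q [n0 B iE jE]]]]]]]] := fitting fH.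
have [K0|I0] := Ci _ _ (biproduct_iso B).
  left; apply: endo_mono_iso => //; apply/lker0E=> x fx.
  have : x \in lker (fpow f n).
    rewrite memv_ker fpowE -(prednK n0) iterSr fx -fpowE linear0 //.
  rewrite -iE => /mem_limgE[y <-].
  by move/zeroP: K0 => /(_ y) ->; rewrite linear0.
have j0 : limg j = 0%VS.
  apply/eqP; rewrite -subv0; apply/subvP=> z /mem_limgE[y <-].
  by move/zeroP: I0 => /(_ y) ->; rewrite linear0 mem0v.
right; exists n; apply/lfunP=> x; rewrite zero_lfunE; apply/eqP.
by rewrite -memv0 -j0 jE memv_img ?memvf.
Qed.

Lemma is_iso_comp M N P (g : 'Hom(N, P)) (f : 'Hom(M, N)) :
  is_iso g -> is_iso f -> is_iso (g \o f)%VF.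
Proof.
case=> g' [gH gH' g'g gg'] [f' [fH fH' f'f ff']]; exists (f' \o g')%VF.
split; auto with hom.
  by rewrite comp_lfunA -(comp_lfunA f') g'g comp_lfun1r.
by rewrite comp_lfunA -(comp_lfunA g) ff' comp_lfun1r.
Qed.

Lemma is_iso_opp M (f : 'End(M)) : is_iso f -> is_iso (- f)%VF.
Proof.
case=> g [fH gH gf fg]; exists (- g)%VF; split; auto with hom;
by rewrite comp_lfunNl comp_lfunNr opprK.
Qed.

(** The endomorphism ring of C is local: if u (f + g) = 1 and u f is not invertible,
    then u f is nilpotent, so that u g = 1 - u f is invertible. *)
Lemma indec_local C (f g : 'End(C)) : indec C -> amod_hom f -> amod_hom g ->
  is_iso (f + g)%VF -> is_iso f \/ is_iso g.
Proof.
move=> Ci fH gH [u [_ uH ufg _]].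
have [|If|[n Nf]] := @indec_endo C (u \o f)%VF Ci; first by auto with hom.
  left; apply: endo_mono_iso => //; apply/lker0E=> x fx.
  have [/lker0E + _] := (is_isoP (hom_comp uH fH)).1 If; apply.
  by rewrite comp_lfunE fx linear0.
right; apply: endo_mono_iso => //; apply/lker0E=> x gx.
have [+ _] := (is_isoP (hom_sub (hom_id _) (hom_comp uH fH))).1
                 (nilpotent_sub_iso (hom_comp uH fH) Nf).
move/lker0E; apply; rewrite add_lfunE opp_lfunE -ufg !comp_lfunE add_lfunE gx.
by rewrite addr0 subrr.
Qed.

Lemma retract_of_iso C X (i : 'Hom(C, X)) (p : 'Hom(X, C)) :
  amod_hom i -> amod_hom p -> is_iso (p \o i)%VF -> retract C X.
Proof.
move=> iH pH [u [_ uH upi _]]; exists i, (u \o p)%VF.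
by split; auto with hom; rewrite -comp_lfunA.
Qed.

Lemma indec_retract_dsum2 C X Y : indec C -> retract C (dsum2 X Y) ->
  retract C X \/ retract C Y.
Proof.
move=> Ci [i [p [iH pH pi]]].
have [||| I1|I2] := @indec_local C ((p \o dinl X Y) \o (dfst X Y \o i))%VF
  ((p \o dinr X Y) \o (dsnd X Y \o i))%VF Ci; auto with hom.
- suff -> : (((p \o dinl X Y) \o (dfst X Y \o i))
    + ((p \o dinr X Y) \o (dsnd X Y \o i)))%VF = \1%VF.
    by exists \1%VF; split; rewrite ?comp_lfun1l //; auto with hom.
  apply/lfunP=> x; rewrite -pi add_lfunE !comp_lfunE dfstE dsndE dinlE dinrE.
  rewrite -linearD /=; congr (p _).
  by case: (i x) => u v; congr (_, _); rewrite /= ?addr0 ?add0r.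
- by left; apply: retract_of_iso I1; auto with hom.
- by right; apply: retract_of_iso I2; auto with hom.
Qed.

Lemma indec_retract_dsum C (Xs : seq (amod A s)) : indec C -> retract C (dsum Xs) ->
  exists X, List.In X Xs /\ retract C X.
Proof.
move=> Ci; elim: Xs => [|X Xs IH] /= CX.
  by case: Ci => []; case; apply: retract_zero CX _; apply: zero_amod0.
have [CX1|/IH[Y [YXs CY]]] := indec_retract_dsum2 Ci CX; first by exists X; auto.
by exists Y; auto.
Qed.

(** Gaussian elimination with the invertible entry a : C -> C of the matrix of f as
    pivot: m goes to the second component of f (- a^-1 b m, m). *)
Lemma gauss_cancel C M N (f : 'Hom(dsum2 C M, dsum2 C N)) :
  is_iso f -> is_iso (dfst C N \o f \o dinl C M)%VF -> iso M N.
Proof.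
case=> g [fH gH gf fg] [a' [aH aH' a'a aa']].
have fgE u : f (g u) = u by rewrite -comp_lfunE fg id_lfunE.
have gfE u : g (f u) = u by rewrite -comp_lfunE gf id_lfunE.
pose b m := (f (0, m)).1.
have aE c : (f (c, 0)).1 = (dfst C N \o f \o dinl C M)%VF c.
  by rewrite !comp_lfunE dfstE dinlE.
have fE c m : f (c, m) = f (c, 0) + f (0, m).
  by rewrite -linearD; congr (f (_, _)); rewrite /= ?addr0 ?add0r.
pose h (m : M) : N := (f (- a' (b m), m)).2.
have h1 m : f (- a' (b m), m) = (0, h m).
  rewrite [LHS]surjective_pairing; congr (_, _); rewrite fE /= aE linearN /=.
  by rewrite -comp_lfunE aa' id_lfunE addNr.
apply: (@iso_of_fun _ _ _ M N h (fun n => (g (0, n)).2)).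
- move=> c m n; rewrite /h /b.
  suff -> : (- a' (f (0, c *: m + n)).1, c *: m + n)
    = c *: (- a' (f (0, m)).1, m) + (- a' (f (0, n)).1, n) :> dsum2 C M.
    by rewrite (linearP f).
  congr (_, _) => /=.
  have -> : (0, c *: m + n) = c *: (0, m) + (0, n) :> dsum2 C M.
    by congr (_, _); rewrite /= scaler0 addr0.
  by rewrite (linearP f) /= linearP opprD scalerN.
- move=> a m; rewrite /h /b.
  have E u : f (act C a u.1, act M a u.2) = act (dsum2 C N) a (f u).
    by rewrite -homE // dsum2_actE.
  have := E (0, m); rewrite /= linear0 => ->; rewrite dsum2_actE /=.
  rewrite homE // -linearN /=.
  by have := E (- a' (f (0, m)).1, m); rewrite /= => ->; rewrite dsum2_actE.
- by move=> m; rewrite -h1 gfE.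
- move=> n; case E: (g (0, n)) => [c m] /=.
  have fcm : f (c, m) = (0, n) by rewrite -E fgE.
  suff cE : c = - a' (b m) by rewrite /h -cE fcm.
  have : (f (c, m)).1 = 0 by rewrite fcm.
  rewrite fE /= aE => /eqP; rewrite addr_eq0 => /eqP ac.
  by rewrite -linearN /= /b -ac -comp_lfunE a'a id_lfunE.
Qed.

(** The identity of C is a a' + b c', with the entries of f and of its inverse, so a a'
    or b c' is invertible.  In the second case the shear (c, m) |-> (c, m + c' c)
    replaces the entry a of f by a + b c', which is invertible unless a is. *)
Lemma indec_cancel C M N : indec C -> iso (dsum2 C M) (dsum2 C N) -> iso M N.
Proof.
move=> Ci /isoP[f [g fg]]; have [fH gH gf fgE] := fg.
have fI : is_iso f by exists g.
pose a := (dfst C N \o f \o dinl C M)%VF.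
pose a' := (dfst C M \o g \o dinl C N)%VF.
pose b := (dfst C N \o f \o dinr C M)%VF.
pose c' := (dsnd C M \o g \o dinl C N)%VF.
have aH : amod_hom a by rewrite /a; auto with hom.
have aH' : amod_hom a' by rewrite /a'; auto with hom.
have bH : amod_hom b by rewrite /b; auto with hom.
have cH' : amod_hom c' by rewrite /c'; auto with hom.
have E : ((a \o a') + (b \o c'))%VF = \1%VF.
  apply/lfunP=> x; rewrite add_lfunE !comp_lfunE id_lfunE !dfstE dsndE.
  rewrite (@dinlE _ _ _ C M) dinrE.
  have addE (u v : dsum2 C N) : u.1 + v.1 = (u + v).1 by [].
  rewrite addE -linearD /=.
  set w := _ + _.
  suff -> : w = g (dinl C N x) by rewrite -(comp_lfunE f g) fgE id_lfunE dinlE.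
  rewrite /w; case: (g _) => u v; congr (_, _); rewrite /= ?addr0 ?add0r //.
have [||| Iaa|Ibc] := @indec_local C (a \o a')%VF (b \o c')%VF Ci; auto with hom.
- by rewrite E; exists \1%VF; split; rewrite ?comp_lfun1l //; auto with hom.
- apply: (gauss_cancel fI); apply: endo_epi_iso => //; apply/limgTE=> x.
  have [_ /limgTE/(_ x)[y <-]] := (is_isoP (hom_comp aH aH')).1 Iaa.
  by exists (a' y); rewrite [RHS]comp_lfunE.
have [Ia|Na] := pselect (is_iso a); first exact: gauss_cancel fI Ia.
pose sg := dpair (dfst C M) (dsnd C M + (c' \o dfst C M))%VF.
pose sg' := dpair (dfst C M) (dsnd C M - (c' \o dfst C M))%VF.
have sgI : is_iso sg.
  exists sg'; split; rewrite /sg /sg'; auto with hom;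
  by apply/lfunP=> -[x y]; rewrite comp_lfunE !dpairE ?(add_lfunE, opp_lfunE)
       !comp_lfunE !dsndE !dfstE /= id_lfunE ?addrK ?subrK.
apply: (gauss_cancel (is_iso_comp fI sgI)).
have -> : (dfst C N \o (f \o sg) \o dinl C M)%VF = (a + (b \o c'))%VF.
  apply/lfunP=> x; rewrite add_lfunE !comp_lfunE dfstE dpairE add_lfunE.
  rewrite comp_lfunE dfstE dsndE !comp_lfunE !dfstE !(@dinlE _ _ _ C M) dinrE /=.
  have addE (u v : dsum2 C N) : u.1 + v.1 = (u + v).1 by [].
  by rewrite addE -linearD; congr (f (_, _)).1; rewrite /= ?add0r ?addr0.
have bcH : amod_hom (b \o c')%VF by auto with hom.
have [|||I1|I2] := @indec_local C (a + (b \o c'))%VF (- a)%VF Ci.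
- by auto with hom.
- by auto with hom.
- by rewrite addrC addKr.
- by [].
- by case: Na; rewrite -[a]opprK; apply: is_iso_opp.
Qed.

Definition isocount C (Xs : seq (amod A s)) : nat :=
  count (fun X => `[< iso C X >]) Xs.

Lemma isocount_In C (Xs : seq (amod A s)) :
  (0 < isocount C Xs)%N <-> exists X, List.In X Xs /\ iso C X.
Proof.
elim: Xs => [|X Xs IH]; first by split=> // -[X []].
rewrite /isocount /= -/(isocount C Xs).
case: asboolP => [CX|CX]; first by split=> // _; exists X; auto.
rewrite add0n IH; split=> [[Y [YX CY]]|[Y [[<-|YX] CY]]]; first by exists Y; auto.
  by case: CX.
by exists Y.
Qed.

Lemma isocount_iso C X (Xs Ys : seq (amod A s)) Y : iso X Y ->
  isocount C (X :: Xs ++ Ys) = isocount C (Xs ++ Y :: Ys).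
Proof.
move=> XY; rewrite /isocount /= !count_cat /= addnCA; congr (_ + (_ + _))%N.
congr (nat_of_bool _); apply/asbool_equiv_eq; split=> H; apply: iso_trans H _ => //.
exact: iso_sym.
Qed.

Lemma In_split X (Xs : seq (amod A s)) : List.In X Xs ->
  exists Ys Zs, Xs = Ys ++ X :: Zs.
Proof.
elim: Xs => //= Y Xs IH [->|/IH[Ys [Zs ->]]]; first by exists [::], Xs.
by exists (Y :: Ys), Zs.
Qed.

(** An indecomposable summand of dsum Ys is isomorphic to a member of Ys by locality,
    and may be cancelled on both sides. *)
Lemma krull_schmidt C (Xs Ys : seq (amod A s)) :
  (forall X, List.In X Xs -> indec X) -> (forall Y, List.In Y Ys -> indec Y) ->
  iso (dsum Xs) (dsum Ys) -> isocount C Xs = isocount C Ys.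
Proof.
elim: Xs Ys => [|X Xs IH] Ys Xi Yi XY.
  case: Ys Yi XY => //= Y Ys Yi XY.
  have /dsum2_is_zero[Y0 _] := zero_iso XY (zero_amod0 A s).
  by case: (Yi Y) => //; left.
have Xin : indec X by apply: Xi; left.
have XYs : retract X (dsum Ys).
  exact: retract_trans (retract_l X (dsum Xs)) (iso_retract XY).
have [Y [YYs XrY]] := indec_retract_dsum Xin XYs.
have XisoY : iso X Y by apply: indec_retract_iso => //; [case: Xin | apply: Yi].
have [Y1 [Y2 YsE]] := In_split YYs.
rewrite YsE -(isocount_iso C Y1 Y2 XisoY) /isocount /=; congr (_ + _)%N.
apply: IH => [Z ZX|Z ZY|]; first by apply: Xi; right.
  apply: Yi; rewrite YsE; apply: List.in_or_app.
  by case: (List.in_app_or _ _ _ ZY); [left | right; right].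
apply: (@indec_cancel X) => //; apply: iso_trans XY _; rewrite YsE.
apply: iso_trans (dsum_rem _ _ _) _; apply: iso_dsum2l; exact: iso_sym.
Qed.

Definition decomposition M : seq (amod A s) := sval (cid (indec_decomposition M)).

Lemma decomposition_indec M X : List.In X (decomposition M) -> indec X.
Proof. by rewrite /decomposition; case: cid => Xs [H _] /=; apply: H. Qed.

Lemma decomposition_iso M : iso M (dsum (decomposition M)).
Proof. by rewrite /decomposition; case: cid => Xs [_ H] /=; apply: H. Qed.

Definition mult C M : nat := isocount C (decomposition M).

Lemma mult_dsum C M (Xs : seq (amod A s)) :
  (forall X, List.In X Xs -> indec X) -> iso M (dsum Xs) -> mult C M = isocount C Xs.
Proof.
move=> Xi MX; apply: krull_schmidt => //; first exact: decomposition_indec.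
exact: iso_trans (iso_sym (decomposition_iso M)) MX.
Qed.

Lemma mult_iso C M N : iso M N -> mult C M = mult C N.
Proof.
move=> MN; apply: mult_dsum; first exact: decomposition_indec.
exact: iso_trans MN (decomposition_iso N).
Qed.

Lemma mult_dsum2 C M N : mult C (dsum2 M N) = (mult C M + mult C N)%N.
Proof.
rewrite -[RHS]count_cat; apply: mult_dsum => [X XMN|].
  by case: (List.in_app_or _ _ _ XMN); apply: decomposition_indec.
apply: iso_trans (iso_sym (dsum_cat _ _)).
by apply: iso_dsum2; apply: decomposition_iso.
Qed.

Lemma mult_retract C M : indec C -> (0 < mult C M)%N -> retract C M.
Proof.
move=> Ci /isocount_In[X [XM CX]]; apply: retract_trans (iso_retract CX) _.
apply: retract_trans (retract_dsum XM) _.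
exact/iso_retract/iso_sym/decomposition_iso.
Qed.

End KrullSchmidt.
#[local] Hint Resolve hom_fpow : hom.

(** * Syzygies and projective dimension *)

Section Homological.
Variables (k : fieldType) (A : falgType k) (s : side).
Implicit Types (C E F I K M N P Q W X Y Z : amod A s).

Definition ses X Y Z (i : 'Hom(X, Y)) (f : 'Hom(Y, Z)) : Prop :=
  [/\ amod_hom i /\ amod_hom f,
      forall x, i x = 0 -> x = 0, forall z, exists y, f y = z,
      forall x, f (i x) = 0
    & forall y, f y = 0 -> exists x, i x = y].

Lemma ses_mono X Y Z i f : @ses X Y Z i f -> is_mono i.
Proof. by case=> _ im _ _ _; apply/lker0E. Qed.

Lemma ses_epi X Y Z i f : @ses X Y Z i f -> is_epi f.
Proof. by case=> _ _ fe _ _; apply/limgTE. Qed.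

Lemma ses_exact X Y Z i f : @ses X Y Z i f -> limg i = lker f.
Proof.
case=> _ _ _ fi ex; apply/vspaceP=> y; rewrite memv_ker.
by apply/idP/eqP=> [/mem_limgE[x <-]|/ex[x <-]]; rewrite ?memv_img ?memvf.
Qed.

Lemma sesI X Y Z (i : 'Hom(X, Y)) (f : 'Hom(Y, Z)) :
  amod_hom i -> amod_hom f -> is_mono i -> is_epi f -> limg i = lker f -> ses i f.
Proof.
move=> iH fH /lker0E im /limgTE fe E; split=> // [x|y fy].
  by apply/eqP; rewrite -memv_ker -E memv_img ?memvf.
by apply/mem_limgE; rewrite E memv_ker fy.
Qed.

Lemma epi_ses Y Z (f : 'Hom(Y, Z)) : amod_hom f -> is_epi f ->
  exists X (i : 'Hom(X, Y)), ses i f.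
Proof.
move=> fH fe; have [X [i [iH im iE]]] := kernel_ex fH.
by exists X, i; apply: sesI.
Qed.

Lemma mono_ses X Y (i : 'Hom(X, Y)) : amod_hom i -> is_mono i ->
  exists Z (f : 'Hom(Y, Z)), ses i f.
Proof.
move=> iH im; have [Z [f [fH fe fE]]] := cokernel_ex iH.
by exists Z, f; apply: sesI.
Qed.

Lemma ses_lift X Y Z i f W (h : 'Hom(W, Y)) : @ses X Y Z i f -> amod_hom h ->
  (forall w, f (h w) = 0) -> exists g : 'Hom(W, X), amod_hom g /\ (i \o g)%VF = h.
Proof.
move=> S hH fh; have [[iH fH] _ _ _ _] := S.
apply: mono_lift => //; first exact: ses_mono S.
rewrite (ses_exact S); apply/subvP=> y /mem_limgE[w <-].
by rewrite memv_ker fh.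
Qed.

Lemma ses_split X Y Z i f (g : 'Hom(Z, Y)) : @ses X Y Z i f ->
  amod_hom g -> (f \o g)%VF = \1%VF -> iso Y (dsum2 X Z).
Proof.
move=> S gH fg; have [[iH fH] im fe fi ex] := S.
have fgE z : f (g z) = z by rewrite -comp_lfunE fg id_lfunE.
apply: iso_sym; apply/isoP; exists (dcase i g).
apply/is_isoP; first by auto with hom.
split; first apply/lker0E=> -[x z]; last apply/limgTE=> y; rewrite ?dcaseE /=.
  move=> xz; have z0 : z = 0.
    by have := congr1 f xz; rewrite linearD /= fi fgE add0r linear0.
  have x0 : x = 0 by apply: im; rewrite -xz z0 linear0 addr0.
  by rewrite x0 z0.
have [|x xE] := ex (y - g (f y)); first by rewrite linearB /= fgE subrr.
by exists (x, f y); rewrite dcaseE /= xE subrK.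
Qed.

Lemma ses_iso_r X Y Z Z' i f (h : 'Hom(Z, Z')) :
  @ses X Y Z i f -> is_iso h -> ses i (h \o f)%VF.
Proof.
case=> [[iH fH] im fe fi ex] [g [hH gH gh hg]].
split; first by split; auto with hom.
- by [].
- move=> z; have [y yE] := fe (g z); exists y.
  by rewrite comp_lfunE yE -comp_lfunE hg id_lfunE.
- by move=> x; rewrite comp_lfunE fi linear0.
- move=> y; rewrite comp_lfunE => hfy; apply: ex.
  by rewrite -(id_lfunE (f y)) -gh comp_lfunE hfy linear0.
Qed.

Lemma ses_dsum2 X Y Z i f X' Y' Z' i' f' : @ses X Y Z i f -> @ses X' Y' Z' i' f' ->
  ses (dpair (i \o dfst X X') (i' \o dsnd X X'))%VF
      (dpair (f \o dfst Y Y') (f' \o dsnd Y Y'))%VF.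
Proof.
case=> [[iH fH] im fe fi ex] [[iH' fH'] im' fe' fi' ex'].
split; first by split; apply: hom_dpair; auto with hom.
- case=> x x'; rewrite dpairE !comp_lfunE dfstE dsndE /= => -[/im -> /im' ->] //.
- case=> z z'; have [y <-] := fe z; have [y' <-] := fe' z'; exists (y, y').
  by rewrite dpairE !comp_lfunE dfstE dsndE.
- by case=> x x'; rewrite !(dpairE, comp_lfunE, dfstE, dsndE) /= fi fi'.
- case=> y y' E; have [/ex[x <-] /ex'[x' <-]] : f y = 0 /\ f' y' = 0.
    by move: E; rewrite dpairE !comp_lfunE dfstE dsndE => -[].
  by exists (x, x'); rewrite dpairE !comp_lfunE dfstE dsndE.
Qed.

Lemma ses_addr X Y Z i f Q : @ses X Y Z i f ->
  ses (dpair i 0) (dpair (f \o dfst Y Q) (dsnd Y Q))%VF.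
Proof.
case=> [[iH fH] im fe fi ex].
split; first by split; apply: hom_dpair; auto with hom.
- by move=> x; rewrite dpairE zero_lfunE => -[/im].
- case=> z q; have [y <-] := fe z; exists (y, q).
  by rewrite dpairE !comp_lfunE dfstE dsndE.
- by move=> x; rewrite !(dpairE, comp_lfunE, dfstE, dsndE) /= fi zero_lfunE.
- case=> y q E; have [/ex[x <-] ->] : f y = 0 /\ q = 0.
    by move: E; rewrite dpairE comp_lfunE dfstE dsndE => -[].
  by exists x; rewrite dpairE zero_lfunE.
Qed.

Definition reg_ev M (x : M) : 'Hom(reg A s, M) := linfun (fun a => act M a x).

Lemma reg_evE M (x : M) a : reg_ev x a = act M a x.
Proof.
by apply: (@linfunE _ A M (fun a => act M a x)) => c u v;
  rewrite act_linear add_lfunE scale_lfunE.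
Qed.

Lemma hom_reg_ev M (x : M) : amod_hom (reg_ev x).
Proof. by apply/amod_homP=> a b; rewrite !reg_evE [act _ a]/= act_reg. Qed.

Lemma reg_act_1 (a : A) : reg_act s a 1 = a.
Proof. by rewrite /reg_act; case: s; rewrite lfunE /= ?mulr1 ?mul1r. Qed.

Lemma projective_reg : projective (reg A s).
Proof.
move=> X Y f h fH fe hH; have /limgTE/(_ (h 1))[x fx] := fe.
exists (reg_ev x); split; first exact: hom_reg_ev.
apply/lfunP=> a; rewrite comp_lfunE reg_evE homE // fx -homE //.
by congr (h _); apply: reg_act_1.
Qed.

Lemma projective_power (J : finType) P : projective P -> projective (power J P).
Proof.
move=> Pp X Y f h fH fe hH.
have /choice[g gP] j : exists g : 'Hom(P, X), amod_hom g /\ (f \o g = h \o power_in P j)%VF.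
  by apply: Pp => //; auto with hom.
exists (power_sum g); split; first by apply: hom_power_sum => j; case: (gP j).
apply/lfunP=> u; rewrite comp_lfunE power_sumE linear_sum /=.
rewrite -[in RHS](id_lfunE u) -power_in_pr sum_lfunE linear_sum /=.
apply: eq_bigr => j _; rewrite -comp_lfunE (gP j).2 !comp_lfunE.
by rewrite power_prE.
Qed.

Lemma projective_retract P Q : retract P Q -> projective Q -> projective P.
Proof.
case=> i [p [iH pH pi]] Qp X Y f h fH fe hH.
have [|g [gH fg]] := Qp X Y f (h \o p)%VF fH fe; first by auto with hom.
exists (g \o i)%VF; split; auto with hom.
by rewrite comp_lfunA fg -comp_lfunA pi comp_lfun1r.
Qed.

Lemma projective_dsum2 P Q : projective P -> projective Q -> projective (dsum2 P Q).
Proof.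
move=> Pp Qp X Y f h fH fe hH.
have [|g [gH fg]] := Pp X Y f (h \o dinl P Q)%VF fH fe; first by auto with hom.
have [|g' [gH' fg']] := Qp X Y f (h \o dinr P Q)%VF fH fe; first by auto with hom.
exists (dcase g g'); split; auto with hom.
apply/lfunP=> -[x y]; rewrite comp_lfunE dcaseE linearD /= -!comp_lfunE fg fg'.
rewrite !comp_lfunE dinlE dinrE -linearD /=.
by congr (h (_, _)); rewrite /= ?addr0 ?add0r.
Qed.

Lemma projective_zero P : is_zero P -> projective P.
Proof.
move=> /zero_id P0 X Y f h fH fe hH; exists 0; split; auto with hom.
by rewrite comp_lfun0r -[h]comp_lfun1r P0 comp_lfun0r.
Qed.

Lemma projective_iso P Q : iso P Q -> projective P -> projective Q.
Proof. by move=> PQ; apply: projective_retract; apply/iso_retract/iso_sym. Qed.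

Lemma projective_dsum (Ps : seq (amod A s)) :
  (forall P, List.In P Ps -> projective P) -> projective (dsum Ps).
Proof.
elim: Ps => [|P Ps IH] Pp /=; first exact/projective_zero/zero_amod0.
by apply: projective_dsum2; [apply: Pp; left | apply: IH => Q ?; apply: Pp; right].
Qed.

Lemma free_cover M : exists n (f : 'Hom(power 'I_n (reg A s), M)),
  amod_hom f /\ is_epi f.
Proof.
pose b := vbasis {:M}.
exists (\dim {:M}), (power_sum (fun j : 'I_(\dim {:M}) => reg_ev b`_j)); split.
  by apply: hom_power_sum => j; apply: hom_reg_ev.
apply/limgTE=> x; exists [ffun j => (coord b j x)%:A].
rewrite power_sumE [RHS](coord_vbasis (memvf x)).
by apply: eq_bigr => j _; rewrite reg_evE ffunE linearZ /= scale_lfunE act_1.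
Qed.

Lemma projective_split X Y P i f : @ses X Y P i f -> projective P ->
  iso Y (dsum2 X P).
Proof.
move=> S Pp; have [[iH fH] _ _ _ _] := S.
have [g [gH fg]] := Pp _ _ f \1%VF fH (ses_epi S) (hom_id P).
exact: ses_split S gH fg.
Qed.

Lemma pullback_ses K P P' M i f (f' : 'Hom(P', M)) : @ses K P M i f -> amod_hom f' ->
  exists W (j : 'Hom(K, W)) (w : 'Hom(W, dsum2 P P')),
  [/\ ses j (dsnd P P' \o w)%VF, amod_hom w, is_mono w
    & forall u, (exists x, w x = u) <-> f u.1 = f' u.2].
Proof.
move=> S fH'; have [[iH fH] im fe fi ex] := S.
have [|||W [w [wH wm wE]]] := @submodule_ex _ _ _ (dsum2 P P') (fun u => f u.1 = f' u.2).
- by rewrite !linear0.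
- by move=> c u v /= fu fv; rewrite !linearP /= fu fv.
- by move=> a u /= fu; rewrite dsum2_actE /= !homE // fu.
have wker x : f (w x).1 = f' (w x).2 by apply/wE; exists x.
have [||j [jH jE]] := @mono_lift _ _ _ K _ _ w (dinl P P' \o i)%VF wH wm.
- by auto with hom.
- apply/subvP=> u /mem_limgE[x <-]; apply/mem_limgE/wE.
  by rewrite comp_lfunE dinlE /= fi linear0.
have wj x : w (j x) = (i x, 0) by rewrite -comp_lfunE jE comp_lfunE dinlE.
exists W, j, w; split=> //; split; first by split; auto with hom.
- by move=> x jx; apply: im; have := wj x; rewrite jx linear0 => -[].
- move=> p'; have [p fp] := fe (f' p').
  have [x wx] := (wE (p, p')).2 fp.
  by exists x; rewrite comp_lfunE wx dsndE.
- by move=> x; rewrite comp_lfunE wj dsndE.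
- move=> y; rewrite comp_lfunE dsndE => wy.
  have [|x xE] := ex (w y).1; first by rewrite wker wy linear0.
  exists x; apply/eqP; rewrite -subr_eq0; apply/eqP.
  have /lker0E := wm; apply; rewrite linearB /= wj xE -wy -surjective_pairing.
  by rewrite subrr.
Qed.

(** Both sides are the pullback of P -> M <- P'. *)
Lemma schanuel K P M i f K' P' i' f' : @ses K P M i f -> @ses K' P' M i' f' ->
  projective P -> projective P' -> iso (dsum2 K P') (dsum2 K' P).
Proof.
move=> S S' Pp Pp'; have [[_ fH] _ _ _ _] := S; have [[_ fH'] _ _ _ _] := S'.
have [W [j [w [Sj wH wm wE]]]] := pullback_ses S fH'.
have [W' [j' [w' [Sj' wH' wm' wE']]]] := pullback_ses S' fH.
have e1 := projective_split Sj Pp'; have e2 := projective_split Sj' Pp.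
apply: iso_trans (iso_sym e1) _; apply: iso_trans e2.
pose t : 'Hom(dsum2 P P', dsum2 P' P) := dpair (dsnd P P') (dfst P P').
have tE u : t u = (u.2, u.1) by rewrite dpairE dfstE dsndE.
have tH : amod_hom t by rewrite /t; auto with hom.
have [||g [gH gE]] := @mono_lift _ _ _ W _ _ w' (t \o w)%VF wH' wm'.
- by auto with hom.
- apply/subvP=> u /mem_limgE[x <-]; apply/mem_limgE/wE'.
  by rewrite comp_lfunE tE /=; apply/esym/(wE (w x)).1; exists x.
have gwE x : w' (g x) = ((w x).2, (w x).1) by rewrite -comp_lfunE gE comp_lfunE tE.
apply/isoP; exists g; apply/is_isoP=> //; split.
  apply/lker0E=> x gx; have /lker0E := wm; apply.
  rewrite [LHS]surjective_pairing; have := gwE x; rewrite gx linear0.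
  by case=> <- <-.
apply/limgTE=> y; have E := (wE' (w' y)).1 (ex_intro _ y erefl).
have [x xE] := (wE ((w' y).2, (w' y).1)).2 (esym E).
exists x; apply/eqP; rewrite -subr_eq0; apply/eqP.
have /lker0E := wm'; apply; rewrite linearB /= gwE xE /=.
by rewrite -surjective_pairing subrr.
Qed.

Definition stable M N : Prop :=
  exists P Q, [/\ projective P, projective Q & iso (dsum2 M P) (dsum2 N Q)].

Lemma iso_stable M N : iso M N -> stable M N.
Proof.
move=> MN; exists (amod0 A s), (amod0 A s).
by split; [apply/projective_zero/zero_amod0.. | apply: iso_dsum2l].
Qed.

Lemma stable_refl M : stable M M.
Proof. exact/iso_stable/iso_refl. Qed.

Lemma stable_sym M N : stable M N -> stable N M.
Proof. by case=> P [Q [? ? /iso_sym]]; exists Q, P. Qed.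

Lemma stable_trans M N L : stable M N -> stable N L -> stable M L.
Proof.
case=> P [Q [Pp Qp MN]] [P' [Q' [Pp' Qp' NL]]].
exists (dsum2 P P'), (dsum2 Q' Q); split; try exact: projective_dsum2.
apply: iso_trans (iso_sym (dsum2A _ _ _)) _.
apply: iso_trans (iso_dsum2l _ MN) _.
apply: iso_trans (dsum2A _ _ _) _.
apply: iso_trans (iso_dsum2r _ (dsum2C _ _)) _.
apply: iso_trans (iso_sym (dsum2A _ _ _)) _.
by apply: iso_trans (iso_dsum2l _ NL) _; apply: dsum2A.
Qed.

Lemma stable_dsum2 M M' N N' : stable M M' -> stable N N' ->
  stable (dsum2 M N) (dsum2 M' N').
Proof.
case=> P [Q [Pp Qp MN]] [P' [Q' [Pp' Qp' NL]]].
exists (dsum2 P P'), (dsum2 Q Q'); split; try exact: projective_dsum2.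
apply: iso_trans (dsum2ACA _ _ _ _) _.
by apply: iso_trans (iso_dsum2 MN NL) _; apply: dsum2ACA.
Qed.

Lemma stable_addr M Q : projective Q -> stable (dsum2 M Q) M.
Proof.
move=> Qp; exists (amod0 A s), Q; split=> //; first exact/projective_zero/zero_amod0.
exact/dsum2_zeror/zero_amod0.
Qed.

Lemma stable_projective M N : stable M N -> projective M -> projective N.
Proof.
case=> P [Q [Pp Qp MN]] Mp; apply: projective_retract (retract_l N Q) _.
by apply: projective_iso MN _; apply: projective_dsum2.
Qed.

Lemma projective_stable M N : projective M -> projective N -> stable M N.
Proof. by move=> Mp Np; exists N, M; split=> //; apply: dsum2C. Qed.

Lemma stable_syzygy K P M i f K' P' M' i' f' :
  @ses K P M i f -> @ses K' P' M' i' f' -> projective P -> projective P' ->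
  stable M M' -> stable K K'.
Proof.
move=> S S' Pp Pp' [Q [Q' [Qp Qp' /isoP[h hI]]]].
have S1 := ses_iso_r (ses_addr Q S) hI; have S2 := ses_addr Q' S'.
exists (dsum2 P' Q'), (dsum2 P Q); split; try exact: projective_dsum2.
by apply: (schanuel S1 S2); apply: projective_dsum2.
Qed.

Lemma syzygy_ex M : exists K P (i : 'Hom(K, P)) (f : 'Hom(P, M)),
  projective P /\ ses i f.
Proof.
have [n [f [fH fe]]] := free_cover M; have [K [i S]] := epi_ses fH fe.
exists K, (power 'I_n (reg A s)), i, f; split=> //.
exact/projective_power/projective_reg.
Qed.

(** A chosen syzygy of M; only its stable isomorphism class matters. *)
Definition Om M : amod A s := sval (cid (syzygy_ex M)).

Lemma OmP M : exists P (i : 'Hom(Om M, P)) (f : 'Hom(P, M)), projective P /\ ses i f.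
Proof. by rewrite /Om; case: cid => K /= H; apply: H. Qed.

Lemma Om_ses K P M i f : @ses K P M i f -> projective P -> stable K (Om M).
Proof.
move=> S Pp; have [P' [i' [f' [Pp' S']]]] := OmP M.
exact: stable_syzygy S S' Pp Pp' (stable_refl M).
Qed.

Lemma stable_Om M N : stable M N -> stable (Om M) (Om N).
Proof.
move=> MN; have [P [i [f [Pp S]]]] := OmP M; have [P' [i' [f' [Pp' S']]]] := OmP N.
exact: stable_syzygy S S' Pp Pp' MN.
Qed.

Lemma Om_dsum2 M N : stable (Om (dsum2 M N)) (dsum2 (Om M) (Om N)).
Proof.
have [P [i [f [Pp S]]]] := OmP M; have [P' [i' [f' [Pp' S']]]] := OmP N.
apply: stable_sym; apply: Om_ses (ses_dsum2 S S') _; exact: projective_dsum2.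
Qed.

Definition Omn n M : amod A s := iter n Om M.

Lemma OmnS n M : Omn n.+1 M = Omn n (Om M). Proof. exact: iterSr. Qed.

Lemma OmnD m n M : Omn (m + n) M = Omn m (Omn n M). Proof. exact: iterD. Qed.

Lemma stable_Omn n M N : stable M N -> stable (Omn n M) (Omn n N).
Proof. by move=> MN; elim: n => //= n; apply: stable_Om. Qed.

Lemma Omn_dsum2 n M N : stable (Omn n (dsum2 M N)) (dsum2 (Omn n M) (Omn n N)).
Proof.
elim: n => [|n IH] /=; first exact: stable_refl.
exact: stable_trans (stable_Om IH) (Om_dsum2 _ _).
Qed.

Lemma projective_Om P : projective P -> projective (Om P).
Proof.
move=> Pp; have [Q [i [f [Qp S]]]] := OmP P.
apply: projective_retract (retract_l (Om P) P) _.
exact: projective_iso (projective_split S Pp) Qp.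
Qed.

Lemma projective_Omn n P : projective P -> projective (Omn n P).
Proof. by move=> Pp; elim: n => //= n; apply: projective_Om. Qed.

Lemma pd_le0 M : pd_le 0 M -> projective M.
Proof.
case=> P [d [e [Pp [eH dH] ee ex _]]].
apply: projective_iso (Pp 0%N).1; exists e; split=> //.
rewrite /is_mono -ex; apply/eqP; rewrite -subv0; apply/subvP=> y /mem_limgE[x <-].
have /zeroP/(_ x) -> : is_zero (P 1%N) by apply: (Pp 1%N).2.
by rewrite linear0 mem0v.
Qed.

Lemma pd_leS n K P M i f : @ses K P M i f -> projective P ->
  pd_le n K -> pd_le n.+1 M.
Proof.
move=> S Pp [R [d [e [Rp [eH dH] ee ex0 ex]]]]; have [[iH fH] im fe fi exf] := S.
pose R' j := if j is j'.+1 then R j' else P.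
pose d' j : 'Hom(R' j.+1, R' j) :=
  match j return 'Hom(R' j.+1, R' j) with 0 => (i \o e)%VF | j'.+1 => d j' end.
exists R', d', f; split.
- by case=> [|j] //=; apply: Rp.
- by split=> // -[|j] /=; [apply: hom_comp | apply: dH].
- exact: ses_epi S.
- by rewrite /= limg_comp ee (ses_exact S).
case=> [|j] /=; last exact: ex.
rewrite ex0; apply/vspaceP=> x; rewrite !memv_ker comp_lfunE.
by apply/eqP/eqP=> [->|/im //]; rewrite linear0.
Qed.

Lemma pd_leS_inv n M : pd_le n.+1 M ->
  exists K P (i : 'Hom(K, P)) (f : 'Hom(P, M)), [/\ projective P, ses i f & pd_le n K].
Proof.
case=> P [d [e [Pp [eH dH] ee ex0 ex]]].
have [K [i S]] := epi_ses eH ee; have [[iH _] im _ _ _] := S.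
have [|g [gH gE]] := ses_lift S (dH 0%N).
  by move=> x; apply/eqP; rewrite -memv_ker -ex0 memv_img ?memvf.
exists K, (P 0%N), i, e; split=> //; first by case: (Pp 0%N).
have kg : lker g = lker (d 0%N).
  apply/vspaceP=> x; rewrite !memv_ker -gE comp_lfunE.
  by apply/eqP/eqP=> [->|/im //]; rewrite linear0.
exists (fun j => P j.+1), (fun j => d j.+1), g; split=> //.
- apply/limgTE=> y; have /mem_limgE[x xE] : i y \in limg (d 0%N).
    by rewrite ex0 -(ses_exact S) memv_img ?memvf.
  exists x; apply/eqP; rewrite -subr_eq0; apply/eqP/im.
  by rewrite linearB /= -comp_lfunE gE xE subrr.
- by rewrite kg ex.
Qed.

Lemma pd_leP n M : pd_le n M <-> projective (Omn n M).
Proof.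
elim: n M => [|n IH] M.
  split=> [/pd_le0 //|Mp]; have Z := zero_amod0 A s.
  have S : ses (0 : 'Hom(amod0 A s, M)) \1%VF.
    split; first by split; auto with hom.
    - by move=> x _; move/zeroP: Z => /(_ x).
    - by move=> z; exists z; rewrite id_lfunE.
    - by move=> x; rewrite zero_lfunE linear0.
    - by move=> y; rewrite id_lfunE => ->; exists 0; rewrite linear0.
  exists (fun j => if j is _.+1 then amod0 A s else M).
  exists (fun j => 0), \1%VF; split; auto with hom.
  - by case=> [|j] /=; split=> //; apply: projective_zero.
  - exact: ses_epi S.
  - exact: ses_exact S.
  - by move=> j; apply/vspaceP=> x; move/zeroP: Z => /(_ x) ->; rewrite !mem0v.
rewrite OmnS; split=> [/pd_leS_inv[K [P [i [f [Pp S /IH Kp]]]]]|/IH Kp].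
  exact: stable_projective (stable_Omn n (Om_ses S Pp)) Kp.
have [P [i [f [Pp S]]]] := OmP M; exact: pd_leS S Pp Kp.
Qed.

Lemma pd_le_stable n M N : stable M N -> pd_le n M -> pd_le n N.
Proof.
by move=> MN /pd_leP Mp; apply/pd_leP; apply: stable_projective Mp; apply: stable_Omn.
Qed.

Lemma pd_le_iso n M N : iso M N -> pd_le n M -> pd_le n N.
Proof. by move/iso_stable; apply: pd_le_stable. Qed.

Lemma pd_le_leq m n M : (m <= n)%N -> pd_le m M -> pd_le n M.
Proof.
move=> /subnK <- /pd_leP Mp; apply/pd_leP; rewrite OmnD; exact: projective_Omn.
Qed.

Lemma pd_le_dsum2 n M N : pd_le n (dsum2 M N) <-> pd_le n M /\ pd_le n N.
Proof.
rewrite !pd_leP; have st := Omn_dsum2 n M N; split=> [p|[Mp Np]].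
  have {p}p := stable_projective st p.
  by split; [apply: projective_retract (retract_l _ _) p
           | apply: projective_retract (retract_r _ _) p].
by apply: stable_projective (stable_sym st) _; apply: projective_dsum2.
Qed.

Lemma pd_le_retract n M N : retract M N -> pd_le n N -> pd_le n M.
Proof. by case/summandP=> Y NE /(pd_le_iso NE)/pd_le_dsum2[]. Qed.

Lemma pd_le_dsum n (Xs : seq (amod A s)) :
  (forall X, List.In X Xs -> pd_le n X) -> pd_le n (dsum Xs).
Proof.
elim: Xs => [|X Xs IH] Xp /=.
  by apply/pd_leP/projective_Omn/projective_zero/zero_amod0.
by apply/pd_le_dsum2; split; [apply: Xp; left | apply: IH => Y ?; apply: Xp; right].
Qed.

(** Horseshoe lemma: projective covers of X and Z assemble to an epimorphism P + Q -> Y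
    from a projective module. *)
Lemma ses_Om X Y Z i f : @ses X Y Z i f ->
  exists W (j : 'Hom(Om X, W)) (g : 'Hom(W, Om Z)), stable W (Om Y) /\ ses j g.
Proof.
move=> S; have [[iH fH] im fe fi ex] := S.
have [P [kx [p [Pp SX]]]] := OmP X; have [[kH pH] km pe pk pex] := SX.
have [Q [kz [q [Qp SZ]]]] := OmP Z; have [[kH' qH] km' qe qk qex] := SZ.
have [q' [qH' fq]] := Qp _ _ f q fH (ses_epi S) qH.
have fqE z : f (q' z) = q z by rewrite -comp_lfunE fq.
pose g := dcase (i \o p)%VF q'.
have gH : amod_hom g by rewrite /g; auto with hom.
have gE u : g u = i (p u.1) + q' u.2 by rewrite dcaseE comp_lfunE.
have fg u : f (g u) = q u.2 by rewrite gE linearD /= fi fqE add0r.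
have ge : is_epi g.
  apply/limgTE=> y; have [z zE] := qe (f y).
  have [|x xE] := ex (y - q' z); first by rewrite linearB /= fqE zE subrr.
  by have [u uE] := pe x; exists (u, z); rewrite gE /= uE xE subrK.
have [W [w SW]] := epi_ses gH ge; have [[wH _] wm _ gw wex] := SW.
have [||j [jH jE]] := @ses_lift _ _ _ _ _ _ (dinl P Q \o kx)%VF SW.
- by auto with hom.
- by move=> x; rewrite comp_lfunE dinlE gE /= pk !linear0 addr0.
have [||h [hH hE]] := @ses_lift _ _ _ _ _ _ (dsnd P Q \o w)%VF SZ.
- by auto with hom.
- by move=> x; rewrite comp_lfunE dsndE -fg gw linear0.
have wj x : w (j x) = (kx x, 0) by rewrite -comp_lfunE jE comp_lfunE dinlE.
have kh x : kz (h x) = (w x).2 by rewrite -comp_lfunE hE comp_lfunE dsndE.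
exists W, j, h; split; first by apply: Om_ses SW _; apply: projective_dsum2.
split=> //.
- by move=> x jx; apply: km; have := wj x; rewrite jx linear0 => -[].
- move=> z; have [|x xE] := ex (q' (kz z)); first by rewrite fqE qk.
  have [u uE] := pe x; have [|v vE] := wex (- u, kz z).
    by rewrite gE /= !linearN /= uE xE addNr.
  exists v; apply/eqP; rewrite -subr_eq0; apply/eqP/km'.
  by rewrite linearB /= kh vE subrr.
- by move=> x; apply: km'; rewrite kh wj.
move=> v hv; have w2 : (w v).2 = 0 by rewrite -kh hv linear0.
have [|x xE] := pex (w v).1.
  by apply: im; rewrite -[LHS]addr0 -{1}(linear0 q') -w2 -gE gw.
exists x; apply/eqP; rewrite -subr_eq0; apply/eqP/wm.
by rewrite linearB /= wj xE -w2 -surjective_pairing subrr.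
Qed.

Lemma ses_Omn n X Y Z i f : @ses X Y Z i f ->
  exists W (j : 'Hom(Omn n X, W)) (g : 'Hom(W, Omn n Z)), stable W (Omn n Y) /\ ses j g.
Proof.
move=> S; elim: n => [|n [W [j [g [WY Sj]]]]].
  by exists Y, i, f; split=> //; apply: stable_refl.
have [W' [j' [g' [WW Sj']]]] := ses_Om Sj.
by exists W', j', g'; split=> //; apply: stable_trans WW (stable_Om WY).
Qed.

Lemma pd_le_ext n X Y Z i f : @ses X Y Z i f -> pd_le n X -> pd_le n Z -> pd_le n Y.
Proof.
move=> S /pd_leP Xp /pd_leP Zp; apply/pd_leP.
have [W [j [g [WY Sj]]]] := ses_Omn n S; apply: stable_projective WY _.
apply: projective_iso (iso_sym (projective_split Sj Zp)) _.
exact: projective_dsum2.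
Qed.

Lemma pd_le_cone n X Y Z i f : @ses X Y Z i f -> pd_le n X -> pd_le n Y -> pd_le n.+1 Z.
Proof.
move=> S /pd_leP Xp /pd_leP Yp; apply/pd_leP.
have [W [j [g [WY Sj]]]] := ses_Omn n S.
apply: stable_projective (Om_ses Sj _) Xp.
exact: stable_projective (stable_sym WY) Yp.
Qed.

End Homological.

(** * The Igusa-Todorov bound *)

Section RationalChains.
Variable r : nat.

(** The dimensions of the subspaces E n are bounded. *)
Lemma chain_stabilizes (E : nat -> 'rV[rat]_r -> Prop) :
  (forall n, E n 0) -> (forall n c x y, E n x -> E n y -> E n (c *: x + y)) ->
  (forall n x, E n x -> E n.+1 x) -> exists m, forall n x, E n x -> E m x.
Proof.
move=> E0 ED ES.
have Eleq m n x : (m <= n)%N -> E m x -> E n x.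
  by move=> /subnK <-; elim: (n - m)%N => //= d IH /IH; apply: ES.
have /choice[U UE] n : exists U : {vspace 'rV[rat]_r}, forall x, x \in U <-> E n x.
  by apply: vspace_of_pred => //; apply: ED.
pose good d := `[< exists n, \dim (U n) = d >].
have ex0 : exists d, good d by exists (\dim (U 0%N)); apply/asboolP; exists 0%N.
have bd d : good d -> (d <= \dim {:'rV[rat]_r})%N.
  by case/asboolP=> n <-; apply/dimvS/subvf.
case: (ex_maxnP ex0 bd) => d /asboolP[m dm] maxd; exists m => n x Ex.
have [nm|mn] := leqP n m; first exact: Eleq nm Ex.
apply/UE; have /eqP -> : U m == U n; last exact/UE.
rewrite eqEdim; apply/andP; split.
  by apply/subvP=> y /UE Ey; apply/UE; apply: Eleq (ltnW mn) Ey.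
by rewrite dm; apply: maxd; apply/asboolP; exists n.
Qed.

Lemma int_sub_nat (z : int) : exists a c : nat, z = a%:Z - c%:Z.
Proof.
by case: z => n; [exists n, 0%N; rewrite subr0 | exists 0%N, n.+1; rewrite sub0r NegzE].
Qed.

Lemma clear_denominators (v : 'rV[rat]_r) :
  exists (N : rat) (a c : 'I_r -> nat),
    N != 0 /\ forall j, N * v 0 j = (a j)%:R - (c j)%:R.
Proof.
pose N : rat := \prod_j (denq (v 0 j))%:~R.
have N0 : N != 0 by apply/prodf_neq0=> j _; rewrite intr_eq0 denq_neq0.
have /choice[ac acE] j : exists ac : nat * nat, N * v 0 j = ac.1%:R - ac.2%:R.
  have : exists z : int, N * v 0 j = z%:~R.
    exists (numq (v 0 j) * \prod_(i | i != j) denq (v 0 i)).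
    rewrite /N (bigD1 j) //= rmorphM rmorph_prod /= mulrAC; congr (_ * _).
    by rewrite mulrC numqE.
  case=> z ->; have [a [c ->]] := int_sub_nat z; exists (a, c).
  by rewrite rmorphB /= !pmulrn.
by exists N, (fun j => (ac j).1), (fun j => (ac j).2).
Qed.

Definition multiples (a : 'I_r -> nat) : seq 'I_r :=
  flatten [seq nseq (a j) j | j <- enum 'I_r].

Lemma sum_multiples (a m : 'I_r -> nat) :
  (\sum_(j <- multiples a) m j = \sum_j a j * m j)%N.
Proof.
rewrite big_flatten big_map big_enum; apply: eq_bigr => j _.
by rewrite big_nseq iter_addn_0 mulnC.
Qed.

Lemma sum_count_mem (ls : seq 'I_r) (m : 'I_r -> nat) :
  (\sum_(j <- ls) m j = \sum_j count_mem j ls * m j)%N.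
Proof.
elim: ls => [|l ls IH].
  by rewrite big_nil big1 // => j _; rewrite mul0n.
rewrite big_cons IH /=; under [RHS]eq_bigr do rewrite mulnDl.
rewrite big_split; congr (_ + _)%N.
rewrite (bigD1 l) //= eqxx mul1n big1 ?addn0 // => j jl.
by rewrite eq_sym (negPf jl).
Qed.

End RationalChains.

Section IgusaTodorov.
Variables (k : fieldType) (A : falgType k) (s : side).
Implicit Types (C E F I K M N P Q U W X Y Z : amod A s).

Lemma mult_id C : indec C -> mult C C = 1%N.
Proof.
move=> Ci; rewrite (@mult_dsum _ _ _ C C [:: C]) => [|X [<-|]//|] /=.
  by rewrite /isocount /= addn0; case: asboolP => // -[]; apply: iso_refl.
exact/iso_sym/dsum2_zeror/zero_amod0.
Qed.

Lemma mult_gt0 C M : indec C -> retract C M -> (0 < mult C M)%N.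
Proof.
by move=> Ci /summandP[Y ME]; rewrite (mult_iso C ME) mult_dsum2 mult_id.
Qed.

Lemma mult_projective C P : indec C -> ~ projective C -> projective P -> mult C P = 0%N.
Proof.
move=> Ci Cp Pp; apply/eqP; rewrite -leqn0 leqNgt; apply/negP=> /(mult_retract Ci) CP.
exact/Cp/(projective_retract CP).
Qed.

Lemma mult_stable C M N : indec C -> ~ projective C -> stable M N ->
  mult C M = mult C N.
Proof.
move=> Ci Cp [P [Q [Pp Qp MN]]]; have := mult_iso C MN; rewrite !mult_dsum2.
by rewrite (mult_projective Ci Cp Pp) (mult_projective Ci Cp Qp) !addn0.
Qed.

(** The converse of [mult_stable]: matching indecomposables cancel one by one, and
    only projective ones are left. *)
Lemma stable_of_isocount (Xs Ys : seq (amod A s)) :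
  (forall X, List.In X Xs -> indec X) -> (forall Y, List.In Y Ys -> indec Y) ->
  (forall C, indec C -> ~ projective C -> isocount C Xs = isocount C Ys) ->
  stable (dsum Xs) (dsum Ys).
Proof.
elim: Xs Ys => [|X Xs IH] Ys Xi Yi XY.
  apply: projective_stable; first exact/projective_zero/zero_amod0.
  apply: projective_dsum => Y YYs; apply: contrapT => Yp.
  have : (0 < isocount Y Ys)%N by apply/isocount_In; exists Y; split=> //; apply: iso_refl.
  by rewrite -XY //; apply: Yi.
have Xs_i Z : List.In Z Xs -> indec Z by move=> ZX; apply: Xi; right.
have Xin : indec X by apply: Xi; left.
have [Xp|Xp] := pselect (projective X).
  apply: stable_trans (iso_stable (dsum2C _ _)) _.
  apply: stable_trans (stable_addr _ Xp) _; apply: IH => // C Ci Cp.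
  rewrite -XY // /isocount /=; case: asboolP => // CX.
  by case: Cp; apply: projective_iso (iso_sym CX) Xp.
have : (0 < isocount X Ys)%N.
  by rewrite -XY // /isocount /=; case: asboolP => // -[]; apply: iso_refl.
case/isocount_In=> Y [/In_split[Y1 [Y2 YsE]] XisoY]; rewrite YsE.
apply: stable_trans (iso_stable (iso_sym (dsum_rem Y1 Y2 Y))).
rewrite /=; apply: stable_dsum2; first exact: iso_stable.
apply: IH => // [Z ZY|C Ci Cp].
  apply: Yi; rewrite YsE; apply: List.in_or_app.
  by case: (List.in_app_or _ _ _ ZY); [left | right; right].
by have := XY C Ci Cp; rewrite YsE -(isocount_iso C Y1 Y2 XisoY) /isocount /= => /addnI.
Qed.

Lemma stable_of_mult M N :
  (forall C, indec C -> ~ projective C -> mult C M = mult C N) -> stable M N.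
Proof.
move=> MN; apply: stable_trans (iso_stable (decomposition_iso M)) _.
apply: stable_trans (iso_stable (iso_sym (decomposition_iso N))).
by apply: stable_of_isocount => //; apply: decomposition_indec.
Qed.

Lemma ses_iso_m X Y Y' Z i f (h : 'Hom(Y, Y')) :
  @ses _ _ _ X Y Z i f -> is_iso h ->
  exists (i' : 'Hom(X, Y')) (f' : 'Hom(Y', Z)), ses i' f'.
Proof.
case=> [[iH fH] im fe fi ex] [g [hH gH gh hg]].
have ghE x : g (h x) = x by rewrite -comp_lfunE gh id_lfunE.
have hgE x : h (g x) = x by rewrite -comp_lfunE hg id_lfunE.
exists (h \o i)%VF, (f \o g)%VF; split; first by split; auto with hom.
- by move=> x; rewrite comp_lfunE => hx; apply: im; rewrite -(ghE (i x)) hx linear0.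
- by move=> z; have [y <-] := fe z; exists (h y); rewrite comp_lfunE ghE.
- by move=> x; rewrite !comp_lfunE ghE.
- by move=> y; rewrite comp_lfunE => /ex[x xE]; exists x; rewrite comp_lfunE xE hgE.
Qed.

Lemma ses_comp X Y Z W W' (i : 'Hom(X, Y)) (c : 'Hom(Y, W)) (j : 'Hom(Y, Z))
    (d : 'Hom(Z, W')) : ses i c -> ses j d ->
  exists (V : amod A s) (e : 'Hom(Z, V)) (h : 'Hom(W, V)) (h' : 'Hom(V, W')),
    ses (j \o i)%VF e /\ ses h h'.
Proof.
move=> S S'; have [[iH cH] im ce ci cex] := S; have [[jH dH] jm de dj dex] := S'.
have jiH : amod_hom (j \o i)%VF by auto with hom.
have jim : is_mono (j \o i)%VF by apply/lker0E=> x; rewrite comp_lfunE => /jm/im.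
have [V [e Se]] := mono_ses jiH jim; have [[_ eH] _ ee eji eex] := Se.
have [||h [hH hE]] := @epi_desc _ _ _ _ _ _ c (e \o j)%VF cH (ses_epi S).
- by auto with hom.
- rewrite -(ses_exact S); apply/subvP=> y /mem_limgE[x <-].
  by rewrite memv_ker comp_lfunE -[j _]comp_lfunE eji.
have [|h' [hH' hE']] := @epi_desc _ _ _ _ _ _ e d eH (ses_epi Se) dH.
  rewrite -(ses_exact Se); apply/subvP=> y /mem_limgE[x <-].
  by rewrite memv_ker comp_lfunE dj.
have hc y : h (c y) = e (j y) by rewrite -comp_lfunE hE comp_lfunE.
have he z : h' (e z) = d z by rewrite -comp_lfunE hE'.
exists V, e, h, h'; split=> //; split=> //.
- move=> w; have [y <-] := ce w; rewrite hc => /eex[x].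
  rewrite comp_lfunE => ix; suff -> : y = i x by rewrite ci.
  apply/eqP; rewrite -subr_eq0; apply/eqP/jm.
  by rewrite linearB /= ix subrr.
- by move=> w'; have [z <-] := de w'; exists (e z).
- by move=> w; have [y <-] := ce w; rewrite hc he dj.
- move=> v; have [z <-] := ee v; rewrite he => /dex[y <-].
  by exists (c y); rewrite hc.
Qed.

Section EndoCokernel.
Variables (U Q X : amod A s) (F : 'Hom(U, dsum2 U Q)) (g : 'Hom(dsum2 U Q, X)).
Variable (d : nat).
Hypotheses (Qp : projective Q) (S : ses F g) (Xd : pd_le d X).

Let f : 'End(U) := (dfst U Q \o F)%VF.

(** A monomorphism U -> U + P whose first component is f^m, obtained by iterating F;
    its cokernel is an m-fold extension of X by itself, so that the bound on the
    projective dimension does not depend on m. *)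
Lemma iterated_cokernel m :
  exists P W (G : 'Hom(U, dsum2 U P)) (h : 'Hom(dsum2 U P, W)),
    [/\ ses G h, pd_le d W & forall u, (G u).1 = fpow f m u].
Proof.
have [[FH gH] Fm ge gF gex] := S.
elim: m => [|m [P [W [G [h [SG Wd GE]]]]]].
  exists (amod0 A s), (amod0 A s), (dinl U _), (dsnd U _); split.
  - split; first by split; auto with hom.
    + by move=> x; rewrite dinlE => -[].
    + by move=> z; exists (0, z); rewrite dsndE.
    + by move=> x; rewrite dinlE dsndE.
    + case=> x y E; have -> : y = 0 by move: E; rewrite dsndE.
      by exists x; rewrite dinlE.
  - exact/pd_leP/projective_Omn/projective_zero/zero_amod0.
  - by move=> u; rewrite dinlE /= id_lfunE.
pose FP : 'Hom(dsum2 U P, dsum2 U (dsum2 Q P)) :=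
  dpair (dfst U Q \o F \o dfst U P)%VF
        (dpair (dsnd U Q \o F \o dfst U P)%VF (dsnd U P)).
pose gP : 'Hom(dsum2 U (dsum2 Q P), X) :=
  (g \o dpair (dfst U (dsum2 Q P)) (dfst Q P \o dsnd U (dsum2 Q P)))%VF.
have FPE u z : FP (u, z) = ((F u).1, ((F u).2, z)).
  by rewrite !dpairE !comp_lfunE !dfstE !dsndE.
have gPE u y z : gP (u, (y, z)) = g (u, y).
  by rewrite comp_lfunE dpairE comp_lfunE dfstE dsndE dfstE.
have SP : ses FP gP.
  split; first by split; rewrite /FP /gP; auto with hom.
  - case=> u z; rewrite FPE => -[F1 F2 ->]; congr (_, _); apply: Fm.
    by rewrite [LHS]surjective_pairing F1 F2.
  - by move=> x; have [[u y] <-] := ge x; exists (u, (y, 0)); rewrite gPE.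
  - by case=> u z; rewrite FPE gPE -surjective_pairing gF.
  - case=> u [y z]; rewrite gPE => /gex[u' uE].
    by exists (u', z); rewrite FPE uE.
have [V [e [h1 [h2 [SV SW]]]]] := ses_comp SG SP.
exists (dsum2 Q P), V, (FP \o G)%VF, e; split=> //.
  exact: pd_le_ext SW Wd Xd.
move=> u; rewrite comp_lfunE [G u]surjective_pairing FPE GE /=.
by rewrite !comp_lfunE dfstE.
Qed.

(** Let K be the nilpotent part of f.  An iterate of F has first component zero on K
    and without K-component on all of U, so that K is a direct summand of its
    cokernel.  The part where f is invertible cancels from the presentation of X. *)
Lemma endo_cokernel : exists K (F' : 'Hom(K, dsum2 K Q)) (g' : 'Hom(dsum2 K Q, X)),
  [/\ retract K U, pd_le d K & ses F' g'].
Proof.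
have [[FH gH] Fm ge gF gex] := S.
have fH : amod_hom f by rewrite /f; auto with hom.
have [n [K [I [i [j [p [q [n0 B iE jE]]]]]]]] := fitting fH.
have [[iH jH] [pH qH] [pi qj] [pj qi] ijpq] := B.
have piE x : p (i x) = x by rewrite -comp_lfunE pi id_lfunE.
have pjE x : p (j x) = 0 by rewrite -comp_lfunE pj zero_lfunE.
have ijE x : i (p x) + j (q x) = x by rewrite -!comp_lfunE -add_lfunE ijpq id_lfunE.
have im_i x : fpow f n x = 0 -> i (p x) = x.
  move=> fx; have /mem_limgE[y <-] : x \in limg i by rewrite iE memv_ker fx.
  by rewrite piE.
have fi x : fpow f n (i x) = 0.
  by apply/eqP; rewrite -memv_ker -iE memv_img ?memvf.
have im_j x : p x = 0 -> exists y, fpow f n y = x.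
  move=> px; apply/mem_limgE; rewrite -jE; apply/mem_limgE; exists (q x).
  by rewrite -[RHS]ijE px linear0 add0r.
have pf x : p (fpow f n x) = 0.
  have /mem_limgE[y <-] : fpow f n x \in limg j by rewrite jE memv_img ?memvf.
  exact: pjE.
have fpowC m x : f (fpow f m x) = fpow f m (f x) by rewrite !fpowE -iterSr.
exists K.
have [P [W [G [h [SG Wd GE]]]]] := iterated_cokernel n.
have [[GH hH] _ _ hG _] := SG.
have Kd : pd_le d K.
  apply: pd_le_retract Wd.
  have [||t [tH tE]] := @epi_desc _ _ _ _ _ _ h (p \o dfst U P)%VF hH (ses_epi SG).
  - by auto with hom.
  - rewrite -(ses_exact SG); apply/subvP=> y /mem_limgE[u <-].
    by rewrite memv_ker comp_lfunE dfstE GE pf.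
  exists (h \o dinl U P \o i)%VF, t; split; auto with hom.
  apply/lfunP=> x; rewrite comp_lfunE !comp_lfunE -(comp_lfunE t) tE comp_lfunE.
  by rewrite dfstE dinlE piE id_lfunE.
exists (dpair (p \o dfst U Q \o F \o i)%VF (dsnd U Q \o F \o i)%VF).
exists (g \o dpair (i \o dfst K Q) (dsnd K Q))%VF.
split=> //; first by exists i, p.
have fE u : f u = (F u).1 by rewrite comp_lfunE dfstE.
set F' := dpair _ _; set g' := (g \o _)%VF.
have FE x : F' x = (p (f (i x)), (F (i x)).2).
  by rewrite dpairE !comp_lfunE !dfstE dsndE.
have gE u : g' u = g (i u.1, u.2).
  by rewrite comp_lfunE dpairE comp_lfunE dfstE dsndE.
have ipfi x : i (p (f (i x))) = f (i x).
  by apply: im_i; rewrite -fpowC fi linear0.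
have F'H : amod_hom F' /\ amod_hom g' by rewrite /F' /g'; auto 10 with hom.
split=> //.
- move=> x; rewrite FE => -[E1 E2]; rewrite -[x]piE; suff -> : i x = 0 by rewrite linear0.
  by apply: Fm; rewrite [LHS]surjective_pairing E2 -fE -ipfi E1 linear0.
- move=> x; have [[u y] <-] := ge x.
  have [c cE] : exists c, fpow f n c = j (q u) by apply: im_j.
  have [b bE] : exists b, fpow f n b = j (q c) by apply: im_j.
  have [v vE] : exists v, f v = j (q u).
    rewrite -cE -[c]ijE linearD /= fi add0r -bE.
    rewrite -[n in fpow f n (fpow f n b)](prednK n0) /=.
    by eexists; rewrite comp_lfunE.
  exists (p u, y - (F v).2); rewrite gE /=.
  have -> : (i (p u), y - (F v).2) = (u, y) - F v :> dsum2 U Q.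
    by congr (_, _); rewrite /= -fE vE -[X in X - _](ijE u) addrK.
  by rewrite linearB /= gF subr0.
- by move=> x; rewrite FE gE /= ipfi fE -surjective_pairing gF.
case=> x y; rewrite gE /= => /gex[u uE].
have fu : f u = i x by rewrite fE uE.
pose w := j (q u).
have fw : fpow f n (f w) = 0.
  rewrite -[u]ijE linearD /= in fu.
  rewrite /w -[f (j _)](addKr (f (i (p u)))) linearD /= fu fi linearN /= -fpowC fi.
  by rewrite linear0 oppr0 addr0.
have [z zE] : exists z, fpow f n z = w by apply: im_j; apply: pjE.
have fw0 : f w = 0.
  by rewrite -(im_i _ fw) -zE fpowC pf linear0.
have w0 : w = 0.
  rewrite -(im_i w) ?pjE ?linear0 //.
  by rewrite fpowE -(prednK n0) iterSr fw0 -fpowE linear0.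
have ipu : i (p u) = u by rewrite -[RHS]ijE -/w w0 addr0.
by exists (p u); rewrite FE ipu fu piE uE.
Qed.

End EndoCokernel.

Definition finite_pd M : Prop := exists n, pd_le n M.

Lemma finite_pd_bound (Xs : seq (amod A s)) :
  exists d, forall X, List.In X Xs -> finite_pd X -> pd_le d X.
Proof.
elim: Xs => [|X Xs [d dP]]; first by exists 0%N.
have [[n Xn]|Xinf] := pselect (finite_pd X).
  exists (maxn n d) => Y [<- _|YXs Yf]; first exact: pd_le_leq (leq_maxl _ _) Xn.
  by apply: pd_le_leq (leq_maxr _ _) _; apply: dP.
by exists d => Y [<-|] //; apply: dP.
Qed.

Section Bound.
Variables (r : nat) (V : 'I_r -> amod A s).

Definition sumV (ls : seq 'I_r) : amod A s := dsum [seq V j | j <- ls].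

Lemma mult_Omn_sumV n C ls : indec C -> ~ projective C ->
  mult C (Omn n (sumV ls)) = (\sum_(j <- ls) mult C (Omn n (V j)))%N.
Proof.
move=> Ci Cp; elim: ls => [|j ls IH].
  rewrite big_nil; apply: mult_projective => //.
  exact/projective_Omn/projective_zero/zero_amod0.
rewrite big_cons -IH -mult_dsum2; apply: mult_stable => //.
exact: Omn_dsum2.
Qed.

(** The vector v stands for a difference of multiplicity vectors of two modules in
    add V; the equations say that their n-th syzygies contain every nonprojective
    indecomposable module equally often. *)
Definition syzygy_relation n (v : 'rV[rat]_r) : Prop :=
  forall C, indec C -> ~ projective C ->
    \sum_j v 0 j * (mult C (Omn n (V j)))%:R = 0.

Lemma syzygy_relation_stable n ls ls' (v : 'rV[rat]_r) (N : rat) : N != 0 ->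
  (forall m : 'I_r -> nat, N * (\sum_j v 0 j * (m j)%:R)
     = (\sum_(j <- ls) m j)%N%:R - (\sum_(j <- ls') m j)%N%:R) ->
  syzygy_relation n v <-> stable (Omn n (sumV ls)) (Omn n (sumV ls')).
Proof.
move=> N0 vE; split=> [rel|st C Ci Cp].
  apply: stable_of_mult => C Ci Cp; rewrite !mult_Omn_sumV //; apply/eqP.
  by rewrite -(@Num.Theory.eqr_nat rat) -subr_eq0 -vE rel // mulr0.
apply: (mulfI N0); rewrite vE mulr0 -!mult_Omn_sumV //.
by rewrite (mult_stable Ci Cp st) subrr.
Qed.

(** After clearing denominators, v is a difference of two vectors of natural numbers,
    that is, of multiplicity vectors of modules; for these the relation means stable
    isomorphism, which passes to syzygies. *)
Lemma syzygy_relation_increasing n v : syzygy_relation n v -> syzygy_relation n.+1 v.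
Proof.
have [N [a [c [N0 vE]]]] := clear_denominators v.
have key (m : 'I_r -> nat) : N * (\sum_j v 0 j * (m j)%:R)
    = (\sum_(j <- multiples a) m j)%N%:R - (\sum_(j <- multiples c) m j)%N%:R.
  rewrite !sum_multiples mulr_sumr !natr_sum -sumrB; apply: eq_bigr => j _.
  by rewrite mulrA vE mulrBl !natrM.
by move/(syzygy_relation_stable n N0 key)/stable_Om/(syzygy_relation_stable n.+1 N0 key).
Qed.

Lemma stable_syzygies : exists m, forall n ls ls',
  stable (Omn n (sumV ls)) (Omn n (sumV ls')) ->
  stable (Omn m (sumV ls)) (Omn m (sumV ls')).
Proof.
have [|||m mP] := @chain_stabilizes r syzygy_relation.
- by move=> n C _ _; rewrite big1 // => j _; rewrite mxE mul0r.
- move=> n c x y Rx Ry C Ci Cp.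
  under eq_bigr do rewrite !mxE mulrDl -mulrA.
  by rewrite big_split /= -mulr_sumr Rx // Ry // mulr0 addr0.
- exact: syzygy_relation_increasing.
exists m => n ls ls'.
pose v : 'rV[rat]_r := \row_j ((count_mem j ls)%:R - (count_mem j ls')%:R).
have key (m' : 'I_r -> nat) : 1 * (\sum_j v 0 j * (m' j)%:R)
    = (\sum_(j <- ls) m' j)%N%:R - (\sum_(j <- ls') m' j)%N%:R.
  rewrite mul1r (sum_count_mem ls) (sum_count_mem ls') !natr_sum -sumrB; apply: eq_bigr => j _.
  by rewrite mxE mulrBl !natrM.
have R t := syzygy_relation_stable t (oner_neq0 rat) key.
by move/(R n)/mP/(R m).
Qed.

(** The n-th syzygies of X1 and X0 are stably isomorphic for n the projective
    dimension of X, because the n-th syzygy of the sequence splits; hence so are the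
    m-th ones, where m depends on V only, and [endo_cokernel] applies to the m-th
    syzygy of the sequence. *)
Theorem igusa_todorov : exists d, forall ls0 ls1 X1 X0 X i f,
  @ses _ _ _ X1 X0 X i f -> stable X1 (sumV ls1) -> stable X0 (sumV ls0) ->
  finite_pd X -> pd_le d X.
Proof.
have [m mP] := stable_syzygies.
have [d dP] := finite_pd_bound
  (flatten [seq decomposition (Omn m (V j)) | j <- enum 'I_r]).
exists (d.+1 + m)%N => ls0 ls1 X1 X0 X i f S st1 st0 [n Xn].
have st : stable (Omn m X0) (Omn m X1).
  apply: stable_trans (stable_Omn m st0) (stable_trans _ (stable_Omn m (stable_sym st1))).
  apply: (mP n); have [W [j [g [WY SW]]]] := ses_Omn n S.
  have Xp : projective (Omn n X) by apply/pd_leP.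
  apply: stable_trans (stable_Omn n (stable_sym st0)) _.
  apply: stable_trans (stable_sym WY) _.
  apply: stable_trans (iso_stable (projective_split SW Xp)) _.
  exact: stable_trans (stable_addr _ Xp) (stable_Omn n st1).
have [W [j [g [WY SW]]]] := ses_Omn m S.
have [P [Q [Pp Qp /isoP[h hI]]]] := stable_trans WY st.
have [j' [g' S']] := ses_iso_m (ses_addr P SW) hI.
have XPn : pd_le n (dsum2 (Omn m X) P).
  apply/pd_le_dsum2; split; last exact/pd_leP/projective_Omn.
  by apply/pd_leP; rewrite -OmnD addnC OmnD; apply/projective_Omn/pd_leP.
have [K [F [e [KU Kn SK]]]] := endo_cokernel S' XPn.
have Kd : pd_le d K.
  apply: pd_le_iso (iso_sym (decomposition_iso K)) _.
  apply: pd_le_dsum => C CK; have Ci := decomposition_indec CK.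
  have CrK : retract C K.
    apply: retract_trans (retract_dsum CK) _.
    exact/iso_retract/iso_sym/decomposition_iso.
  have [Cp|Cp] := pselect (projective C); first exact/pd_leP/projective_Omn.
  have := mult_gt0 Ci (retract_trans CrK KU).
  rewrite (mult_stable Ci Cp (stable_Omn m st1)).
  rewrite mult_Omn_sumV // lt0n sum_nat_seq_neq0 => /hasP[l _].
  rewrite /= -lt0n => /isocount_In[Y [Yl CY]].
  apply: pd_le_iso (iso_sym CY) _; apply: dP; last first.
    by exists n; apply: pd_le_iso CY _; apply: pd_le_retract CrK Kn.
  elim: (enum 'I_r) (mem_enum 'I_r l) => [|x t IH] //=.
  rewrite inE => /orP[/eqP <-|lt]; apply: List.in_or_app; first by left.
  by right; apply: IH.
have Kd' : pd_le d (dsum2 K Q).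
  by apply/pd_le_dsum2; split=> //; apply/pd_leP/projective_Omn.
have /pd_le_dsum2[/pd_leP Xm _] := pd_le_cone SK Kd Kd'.
by apply/pd_leP; rewrite OmnD.
Qed.

End Bound.
End IgusaTodorov.

(** * Traces of linear endomorphisms *)

Section Trace.
Variable k : fieldType.
Implicit Types U V W : vectType k.

Definition ltrace V (f : 'End(V)) : k :=
  \sum_i coord (vbasis {:V}) i (f (vbasis {:V})`_i).

Lemma ltraceB V (f g : 'End(V)) : ltrace (f - g) = ltrace f - ltrace g.
Proof.
by rewrite -sumrB; apply: eq_bigr => i _; rewrite add_lfunE opp_lfunE linearB.
Qed.

Lemma ltrace_sum V (I : finType) (f : I -> 'End(V)) :
  ltrace (\sum_i f i) = \sum_i ltrace (f i).
Proof.
rewrite exchange_big; apply: eq_bigr => i _.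
by rewrite sum_lfunE linear_sum.
Qed.

Lemma ltraceC V (f g : 'End(V)) : ltrace (f \o g)%VF = ltrace (g \o f)%VF.
Proof.
suff E (u v : 'End(V)) : ltrace (u \o v)%VF =
    \sum_(i < \dim {:V}) \sum_(j < \dim {:V}) coord (vbasis {:V}) j (v (vbasis {:V})`_i) *
                  coord (vbasis {:V}) i (u (vbasis {:V})`_j).
  rewrite !E exchange_big; apply: eq_bigr => i _; apply: eq_bigr => j _.
  exact: mulrC.
apply: eq_bigr => i _; rewrite comp_lfunE.
rewrite {1}(coord_vbasis (memvf (v (vbasis {:V})`_i))) !linear_sum.
by apply: eq_bigr => j _; rewrite !linearZ.
Qed.

Definition rank1 V W (i : 'I_(\dim {:V})) (x : W) : 'Hom(V, W) :=
  linfun (fun v => coord (vbasis {:V}) i v *: x).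

Lemma rank1E V W i (x : W) v : rank1 i x v = coord (vbasis {:V}) i v *: x.
Proof.
apply: (@linfunE _ V W (fun v => coord (vbasis {:V}) i v *: x)) => c u w.
by rewrite linearP scalerDl scalerA.
Qed.

Lemma rank1P V W i c (x y : W) : rank1 i (c *: x + y) = c *: rank1 i x + @rank1 V W i y.
Proof.
apply/lfunP=> v; rewrite add_lfunE scale_lfunE !rank1E scalerDr !scalerA.
by rewrite mulrC.
Qed.

Lemma rank1_sum V W (u : 'Hom(V, W)) : \sum_i rank1 i (u (vbasis {:V})`_i) = u.
Proof.
apply/lfunP=> v; rewrite [in RHS](coord_vbasis (memvf v)) sum_lfunE linear_sum.
by apply: eq_bigr => i _; rewrite rank1E linearZ.
Qed.

Lemma coord_vbasis_delta V (i j : 'I_(\dim {:V})) :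
  coord (vbasis {:V}) i (vbasis {:V})`_j = (j == i)%:R.
Proof. exact/coord_free/basis_free/vbasisP. Qed.

Lemma functional_trace V W (l : 'Hom('Hom(V, W), k^o)) :
  exists w : 'Hom(W, V), forall u, l u = ltrace (w \o u)%VF.
Proof.
pose w x : V := \sum_i (l (rank1 i x) : k) *: (vbasis {:V})`_i.
have w_lin : linear w.
  move=> c x y; rewrite /w scaler_sumr -big_split; apply: eq_bigr => i _ /=.
  by rewrite rank1P linearP scalerDl scalerA.
exists (linfun w) => u; rewrite -[in LHS](rank1_sum u) linear_sum.
apply: eq_bigr => i _; rewrite comp_lfunE (linfunE w_lin) linear_sum.
rewrite (bigD1 i) //= linearZ /= coord_vbasis_delta eqxx mulr1 big1 ?addr0 // => j ji.
by rewrite linearZ /= coord_vbasis_delta (negPf ji) mulr0.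
Qed.

Lemma ltrace_nondegenerate V W (w : 'Hom(W, V)) :
  (forall u : 'Hom(V, W), ltrace (w \o u)%VF = 0) -> w = 0.
Proof.
move=> w0; apply/lfunP=> x; rewrite zero_lfunE (coord_vbasis (memvf (w x))).
apply: big1 => i _; suff -> : coord (vbasis {:V}) i (w x) = 0 by rewrite scale0r.
rewrite -[RHS](w0 (rank1 i x)) /ltrace (bigD1 i) //= big1 ?addr0 => [|j ji].
  by rewrite comp_lfunE rank1E coord_vbasis_delta eqxx scale1r.
by rewrite comp_lfunE rank1E coord_vbasis_delta (negPf ji) scale0r !linear0.
Qed.

Lemma factor_functional_family V W (I : finType) (D : I -> 'Hom(V, W))
    (m : 'Hom(V, k^o)) : (forall x, (forall i, D i x = 0) -> m x = 0) ->
  exists l : I -> 'Hom(W, k^o), forall x, m x = \sum_i l i (D i x).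
Proof.
move=> Dm; pose F x : {ffun I -> W} := [ffun i => D i x].
have F_lin : linear F by move=> c x y; apply/ffunP=> i; rewrite !ffunE linearP.
have [|l lE] := @factor_functional _ _ _ (linfun F) m.
  move=> x Fx; apply: Dm => i.
  by move/ffunP/(_ i): Fx; rewrite (linfunE F_lin) !ffunE.
pose d i (y : W) : {ffun I -> W} := [ffun j => if j == i then y else 0].
have d_lin i : linear (d i).
  move=> c x y; apply/ffunP=> j; rewrite !ffunE.
  by case: eqP; rewrite // scaler0 addr0.
exists (fun i => l \o linfun (d i))%VF => x.
rewrite -lE comp_lfunE (linfunE F_lin).
under eq_bigr do rewrite comp_lfunE (linfunE (d_lin _)).
rewrite -linear_sum; congr (l _); apply/ffunP=> j; rewrite sum_ffunE !ffunE.
rewrite (bigD1 j) //= !ffunE eqxx big1 ?addr0 // => i ij.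
by rewrite ffunE eq_sym (negPf ij).
Qed.

End Trace.

(** * Right almost split maps *)

Section AlmostSplit.
Variables (k : fieldType) (A : falgType k).

Lemma reg_actC s (a b : A) : reg_act s a b = reg_act (op s) b a.
Proof. by rewrite /reg_act; case: s; rewrite !lfunE. Qed.

Lemma reg_actA s (a b c : A) :
  reg_act s (reg_act s a b) c = reg_act s a (reg_act s b c).
Proof. by rewrite /reg_act; case: s; rewrite !lfunE /= ?mulrA. Qed.

Section Coinduced.
Variables (s : side) (C : amod A s).

Definition coind_fun (a : A) (t : 'Hom(A, C)) : 'Hom(A, C) :=
  (t \o reg_act (op s) a)%VF.
Fact coind_fun_linear a : linear (coind_fun a).
Proof. by move=> c f g; rewrite /coind_fun comp_lfunDl -comp_lfunZl. Qed.

Definition coind_act (a : A) : 'End('Hom(A, C)) := linfun (coind_fun a).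

Fact coind_actE a t b : coind_act a t b = t (reg_act s b a).
Proof. by rewrite (linfunE (coind_fun_linear a)) comp_lfunE -reg_actC. Qed.

Fact coind_act_linear : linear coind_act.
Proof.
move=> c a b; apply/lfunP=> t; apply/lfunP=> x.
by rewrite add_lfunE scale_lfunE add_lfunE scale_lfunE !coind_actE !linearP.
Qed.

Fact coind_act1 : coind_act 1 = \1%VF.
Proof. by apply/lfunP=> t; apply/lfunP=> x; rewrite coind_actE id_lfunE reg_act_1. Qed.

Fact coind_actM a b : coind_act (a * b) = side_comp s (coind_act a) (coind_act b).
Proof.
suff key t : (forall x, reg_act s x (a * b) =
      match t with Left => reg_act s (reg_act s x a) b
                 | Right => reg_act s (reg_act s x b) a end) ->
    coind_act (a * b) = side_comp t (coind_act a) (coind_act b).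
  by apply: key => x; rewrite /reg_act; case: (s); rewrite !lfunE /= mulrA.
by case: t => E; apply/lfunP=> t; apply/lfunP=> x;
   rewrite comp_lfunE !coind_actE E.
Qed.

(** Hom_k(A, C), which represents the functor X |-> Hom_k(X, C) on A-modules: a linear
    map psi corresponds to the A-map that sends x to a |-> psi (a x). *)
Definition coind : amod A s := AMod coind_act_linear coind_act1 coind_actM.
End Coinduced.

Variable s : side.
Implicit Types (C E I K M N P X Y Z : amod A s).

Definition right_almost_split E C (e : 'Hom(E, C)) : Prop :=
  [/\ amod_hom e, ~ split_epi e
    & forall X (h : 'Hom(X, C)), amod_hom h -> ~ split_epi h ->
      exists h' : 'Hom(X, E), amod_hom h' /\ (e \o h')%VF = h].

Lemma is_iso_scale M c (f : 'End(M)) : is_iso (c *: f) -> amod_hom f -> is_iso f.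
Proof.
move=> cfI fH; apply: endo_mono_iso => //; apply/lker0E=> x fx.
have [/lker0E cf _] := (is_isoP (hom_scale c fH)).1 cfI.
by apply: cf; rewrite scale_lfunE fx scaler0.
Qed.

(** The endomorphisms of C that are not invertible form a subspace, as End_A(C) is
    local. *)
Lemma radical_functional C : indec C ->
  exists l : 'Hom('End(C), k^o), l \1%VF <> 0 /\
    forall f : 'End(C), amod_hom f -> ~ is_iso f -> l f = 0.
Proof.
move=> Ci; have [C0 _] := Ci.
have [||R RE] := @vspace_of_pred _ _ (fun f : 'End(C) => amod_hom f /\ ~ is_iso f).
- split; first exact: hom_0.
  case=> g [_ _ g0 _]; apply: C0; apply/zero_id.
  by rewrite -g0 comp_lfun0r.
- move=> c f g [fH fI] [gH gI]; split; first by auto with hom.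
  move=> fgI; have [cfI|//] := indec_local Ci (hom_scale c fH) gH fgI.
  exact/fI/(is_iso_scale cfI).
have [|l [lR l1]] := @separating_functional _ _ R (\1%VF : 'End(C)).
  apply/negP=> /RE[_ []]; exists \1%VF; split; rewrite ?comp_lfun1l //; exact: hom_id.
by exists l; split=> // f fH fI; apply/lR/RE.
Qed.

Lemma hom_of_basis M N (f : 'Hom(M, N)) :
  (forall i : 'I_(\dim {:A}), hom_defect (vbasis {:A})`_i f = 0) -> amod_hom f.
Proof.
move=> f0; apply/homvP/subv_bigcapP=> i _.
by rewrite -memvE memv_ker lfunE /= f0.
Qed.

(** If h : X -> C is not a split epimorphism, no h u with u in Hom_A(C, X) is
    invertible, so l (h u) = 0 for a functional l as in [radical_functional].  Write l
    as the trace form tr (g -).  Since Hom_A(C, X) is the common kernel of the maps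
    u |-> u a - a u on Hom_k(C, X), for a in a basis of A, nondegeneracy of the trace
    gives g h = sum_a (a psi_a - psi_a a) for some psi_a in Hom_k(X, C).  The pairs
    (h, psi) with this property are the A-maps into a submodule E of the direct sum of
    C and of copies of Hom_k(A, C).  For X = C and h = 1 there is no such psi, because
    the trace of a sum of commutators is zero while l 1 <> 0. *)
Lemma right_almost_split_ex C : indec C ->
  exists E (e : 'Hom(E, C)), right_almost_split e.
Proof.
move=> Ci; have [l [l1 lrad]] := radical_functional Ci.
have [g lE] := functional_trace l.
pose d := \dim {:A}; pose eA (i : 'I_d) : A := (vbasis {:A})`_i.
pose J := power 'I_d (coind C).
have JE a (t : J) i b : act J a t i b = t i (reg_act s b a).
  by rewrite power_actffunE [act _ a]/= coind_actE.
(* The equation g h = sum_a (a psi_a - psi_a a) at b x, for u = (h x, psi (- x)). *)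
pose good (u : dsum2 C J) := forall b,
  g (act C b u.1) = \sum_i (act C (eA i) (u.2 i b) - u.2 i (reg_act s (eA i) b)).
have [|||E [w [wH wm wE]]] := @submodule_ex _ _ _ (dsum2 C J) good.
- move=> b; rewrite !linear0 big1 // => i _.
  by rewrite ffunE !zero_lfunE linear0 subrr.
- move=> c u v gu gv b; rewrite !linearP /= gu gv scaler_sumr -big_split.
  apply: eq_bigr => i _ /=; rewrite !ffunE !add_lfunE !scale_lfunE !linearP /=.
  by rewrite scalerBr scalerN addrACA.
- move=> a u gu b; rewrite dsum2_actE /= -act_reg gu; apply: eq_bigr => i _.
  by rewrite !JE reg_actA.
exists E, (dfst C J \o w)%VF.
have wgood y : good (w y) by apply/wE; exists y.
split; first by auto with hom.
- case=> t [tH et].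
  pose psi i c : C := (w (t c)).2 i 1.
  have psi_lin i : linear (psi i).
    by move=> c x y; rewrite /psi !linearP /= !ffunE add_lfunE scale_lfunE.
  have psiE i c a : psi i (act C a c) = (w (t c)).2 i a.
    by rewrite /psi !homE // dsum2_actE /= JE reg_actC reg_act_1.
  apply: l1; rewrite lE comp_lfun1r.
  have -> : g = \sum_i ((act C (eA i) \o linfun (psi i))
                        - (linfun (psi i) \o act C (eA i)))%VF.
    apply/lfunP=> c; have := wgood (t c) 1; rewrite act_1.
    have -> : (w (t c)).1 = c.
      by rewrite -dfstE -!comp_lfunE -comp_lfunA comp_lfunA et id_lfunE.
    move=> ->; rewrite sum_lfunE; apply: eq_bigr => i _.
    rewrite add_lfunE opp_lfunE !comp_lfunE !(linfunE (psi_lin i)) psiE.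
    by rewrite reg_act_1.
  by rewrite ltrace_sum big1 // => i _; rewrite ltraceB ltraceC subrr.
move=> X h hH hs.
have hu (u : 'Hom(C, X)) : amod_hom u -> l (h \o u)%VF = 0.
  move=> uH; apply: lrad; first by auto with hom.
  by case=> v [_ vH _ huv]; apply: hs; exists (u \o v)%VF; split; rewrite ?comp_lfunA //;
    auto with hom.
pose m_fun (u : 'Hom(C, X)) : k^o := l (h \o u)%VF.
have m_lin : linear m_fun.
  by move=> c u v; rewrite /m_fun comp_lfunDr -comp_lfunZr linearP.
have [|L LE] := @factor_functional_family _ _ _ 'I_d
   (fun i => linfun (@hom_defect _ _ _ C X (eA i))) (linfun m_fun).
  move=> u u0; rewrite (linfunE m_lin); apply/hu/hom_of_basis => i.
  by have := u0 i; rewrite lfunE.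
have /choice[psi psiE] i := functional_trace (L i).
have gh : (g \o h)%VF = \sum_i ((act C (eA i) \o psi i) - (psi i \o act X (eA i)))%VF.
  apply/eqP; rewrite -subr_eq0; apply/eqP; apply: ltrace_nondegenerate => u.
  rewrite comp_lfunDl comp_lfunNl ltraceB -comp_lfunA -lE.
  have := LE u; rewrite (linfunE m_lin) /m_fun => ->.
  apply/eqP; rewrite subr_eq0; apply/eqP.
  have -> : (\sum_i ((act C (eA i) \o psi i) - (psi i \o act X (eA i)))%VF \o u)%VF
     = \sum_i ((act C (eA i) \o (psi i \o u)) - (psi i \o (act X (eA i) \o u)))%VF.
    apply/lfunP=> x; rewrite comp_lfunE !sum_lfunE; apply: eq_bigr => i _.
    by rewrite !add_lfunE !opp_lfunE !comp_lfunE.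
  rewrite ltrace_sum; apply: eq_bigr => i _.
  rewrite psiE lfunE /= /hom_defect comp_lfunDr comp_lfunNr !ltraceB.
  by rewrite comp_lfunA ltraceC.
have T_lin i x : linear (fun b => psi i (act X b x)).
  by move=> c a b; rewrite act_linear add_lfunE scale_lfunE linearP.
pose T x : J := [ffun i => linfun (fun b => psi i (act X b x))].
have TE x i b : T x i b = psi i (act X b x) by rewrite ffunE (linfunE (T_lin i x)).
have T_lin2 : linear T.
  move=> c x y; apply/ffunP=> i; apply/lfunP=> b.
  by rewrite TE !ffunE add_lfunE scale_lfunE !(linfunE (T_lin i _)) !linearP.
pose v : 'Hom(X, dsum2 C J) := dpair h (linfun T).
have vE x : v x = (h x, T x) by rewrite dpairE (linfunE T_lin2).
have TH : amod_hom (linfun T : 'Hom(X, J)).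
  apply/amod_homP=> a x; rewrite !(linfunE T_lin2); apply/ffunP=> i.
  by apply/lfunP=> b; rewrite JE !TE act_reg.
have vH : amod_hom v by rewrite /v; auto with hom.
have [|h' [hH' hE']] := mono_lift wH wm vH.
  apply/subvP=> u /mem_limgE[x <-]; apply/mem_limgE/wE => b.
  rewrite vE /= -homE // -comp_lfunE gh sum_lfunE; apply: eq_bigr => i _.
  by rewrite add_lfunE opp_lfunE !comp_lfunE !TE act_reg.
exists h'; split=> //; rewrite -comp_lfunA hE'.
by apply/lfunP=> x; rewrite comp_lfunE dfstE vE.
Qed.

(** By Fitting's lemma e factors through the restriction of e to the image of a power
    of t. *)
Lemma endo_iso_or_smaller E C (e : 'Hom(E, C)) (t : 'End(E)) : amod_hom t -> (e \o t)%VF = e ->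
  is_iso t \/ exists I (j : 'Hom(I, E)) (r : 'Hom(E, I)),
    [/\ amod_hom j, amod_hom r, (e \o j \o r)%VF = e, retract I E
      & (\dim {:I} < \dim {:E})%N].
Proof.
move=> tH et; have [n [K [I [i [j [p [q [n0 B iE jE]]]]]]]] := fitting tH.
have [[iH jH] [pH qH] [pi qj] [pj qi] ijpq] := B.
have [K0|K0] := pselect (is_zero K).
  left; apply: endo_mono_iso => //; apply/lker0E=> x tx.
  have /mem_limgE[y <-] : x \in limg i.
    by rewrite iE memv_ker fpowE -(prednK n0) iterSr tx -fpowE linear0.
  by move/zeroP: K0 => /(_ y) ->; rewrite linear0.
right; exists I, j, (q \o fpow t n)%VF; split; auto with hom.
- have etn x : e (fpow t n x) = e x.
    rewrite fpowE; elim: n {n0 iE jE} => //= n IH.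
    by rewrite -comp_lfunE et.
  apply/lfunP=> x; rewrite !comp_lfunE -[RHS]etn.
  have /mem_limgE[y <-] : fpow t n x \in limg j by rewrite jE memv_img ?memvf.
  by rewrite -(comp_lfunE q) qj id_lfunE.
- by exists j, q.
- rewrite (iso_dim (biproduct_iso B)) dim_dsum2 -[X in (X < _)%N]add0n ltn_add2r.
  by rewrite lt0n; apply/eqP.
Qed.

Lemma minimal_right_almost_split C : indec C ->
  exists E (e : 'Hom(E, C)), right_almost_split e /\
    forall t : 'End(E), amod_hom t -> (e \o t)%VF = e -> is_iso t.
Proof.
move=> Ci.
pose good n := `[< exists E (e : 'Hom(E, C)), right_almost_split e /\ \dim {:E} = n >].
have ex0 : exists n, good n.
  have [E [e eR]] := right_almost_split_ex Ci.
  by exists (\dim {:E}); apply/asboolP; exists E, e.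
case: (ex_minnP ex0) => n /asboolP[E [e [eR dE]]] minn.
exists E, e; split=> // t tH et; have [//|] := endo_iso_or_smaller tH et.
case=> I [j [r [jH rH ejr IE dI]]].
have [eH es ef] := eR.
have: good (\dim {:I}).
  apply/asboolP; exists I, (e \o j)%VF; split=> //; split; first by auto with hom.
    by case=> u [uH ju]; apply: es; exists (j \o u)%VF; split; rewrite ?comp_lfunA //;
      auto with hom.
  move=> X h hH hs; have [h' [hH' eh']] := ef X h hH hs.
  exists (r \o h')%VF; split; first by auto with hom.
  by rewrite comp_lfunA ejr.
by move/minn; rewrite -dE leqNgt dI.
Qed.

(** If e i = h g and h is not a split epimorphism, then h = e h' for some h'.  Replacing
    the X-component i of the identity of E by h' g gives an endomorphism t with e t = e,
    which is invertible by minimality; as t i = h' g, the map g is a split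
    monomorphism. *)
Lemma minimal_component_irreducible E C (e : 'Hom(E, C)) X (i : 'Hom(X, E)) (p : 'Hom(E, X)) :
  indec C -> right_almost_split e ->
  (forall t : 'End(E), amod_hom t -> (e \o t)%VF = e -> is_iso t) ->
  indec X -> amod_hom i -> amod_hom p -> (p \o i)%VF = \1%VF ->
  irreducible_hom (e \o i)%VF.
Proof.
move=> Ci [eH es ef] emin Xi iH pH pi.
have eis : ~ split_epi (e \o i)%VF.
  case=> u [uH eiu]; apply: es; exists (i \o u)%VF.
  by split; rewrite ?comp_lfunA //; auto with hom.
split=> //; first by auto with hom.
  case=> u [uH uei]; apply: eis; exists u; split=> //.
  by have [] := indec_retract (proj1 Xi) Ci (hom_comp eH iH) uH uei.
move=> Z g h gH hH hg; have [hs|hs] := pselect (split_epi h); [by right|left].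
have [h' [hH' eh']] := ef Z h hH hs.
pose t : 'End(E) := ((h' \o g \o p) + (\1 - (i \o p)))%VF.
have tH : amod_hom t by rewrite /t; auto 10 with hom.
have [|u [_ uH ut _]] := emin t tH.
  rewrite comp_lfunDr comp_lfunDr comp_lfunNr comp_lfun1r !comp_lfunA eh' hg.
  by rewrite addrCA subrr addr0.
exists (p \o u \o h')%VF; split; first by auto with hom.
have -> : ((p \o u \o h') \o g = p \o (u \o (t \o i)))%VF.
  apply/lfunP=> x; rewrite !comp_lfunE; congr (p (u _)).
  rewrite !(add_lfunE, opp_lfunE, comp_lfunE) id_lfunE -(comp_lfunE p) pi id_lfunE.
  by rewrite subrr addr0.
by rewrite (comp_lfunA u) ut comp_lfun1l.
Qed.

Lemma hom_zero_dsum K (Xs : seq (amod A s)) :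
  (forall X, List.In X Xs -> hom_zero K X) -> hom_zero K (dsum Xs).
Proof.
elim: Xs => [|X Xs IH] KX h hH.
  by apply/lfunP=> x; rewrite [LHS]thinmx0 [RHS]thinmx0.
have h1 : (dfst X (dsum Xs) \o h)%VF = 0 by apply: KX; [left | auto with hom].
have h2 : (dsnd X (dsum Xs) \o h)%VF = 0.
  by apply: IH => [Y YXs|]; [apply: KX; right | auto with hom].
apply/lfunP=> x; rewrite [LHS]surjective_pairing -dfstE -dsndE -!comp_lfunE h1 h2.
by rewrite !zero_lfunE.
Qed.

Lemma hom_zero_iso K X Y : iso X Y -> hom_zero K X -> hom_zero K Y.
Proof.
case/isoP=> f [g [fH gH gf fg]] KX h hH.
by rewrite -[h]comp_lfun1l -fg -comp_lfunA (KX (g \o h)%VF) ?comp_lfun0r //; auto with hom.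
Qed.

(** The map h factors through a minimal right almost split map, whose source is a direct
    sum of modules E as in the hypothesis. *)
Lemma hom_zero_of_arrows K C (h : 'Hom(K, C)) :
  indec C -> (forall E, AR_arrow E C -> hom_zero K E) ->
  amod_hom h -> ~ split_epi h -> h = 0.
Proof.
move=> Ci KE hH hs; have [E [e [eR emin]]] := minimal_right_almost_split Ci.
have [eH _ ef] := eR; have [h' [hH' <-]] := ef K h hH hs.
suff -> : h' = 0 by rewrite comp_lfun0r.
apply: (hom_zero_iso (iso_sym (decomposition_iso E))) => //.
apply: hom_zero_dsum => X XE; apply: KE.
have Xi := decomposition_indec XE.
have [i [p [iH pH pi]]] := retract_trans (retract_dsum XE)
  (iso_retract (iso_sym (decomposition_iso E))).
split=> //; exists (e \o i)%VF.
exact: minimal_component_irreducible pi.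
Qed.

End AlmostSplit.

(** * Duals of projective modules *)

Lemma lfun_sum (k : fieldType) (U V : vectType k) (f : 'Hom(U, V)) (I : Type)
    (r : seq I) (F : I -> U) : f (\sum_(i <- r) F i) = \sum_(i <- r) f (F i).
Proof. exact: linear_sum. Qed.

Section Exactness.
Variables (k : fieldType) (A : falgType k) (s : side).
Implicit Types (I P X Y Z : amod A s).

Lemma proj_lift_exact P X Z (f : 'Hom(X, Z)) (h : 'Hom(P, Z)) :
  projective P -> amod_hom f -> amod_hom h -> (limg h <= limg f)%VS ->
  exists g : 'Hom(P, X), amod_hom g /\ (f \o g)%VF = h.
Proof.
move=> Pp fH hH sub; have [I [i [iH im iE]]] := image_ex fH.
have [|f' [fH' f'E]] := mono_lift iH im fH; first by rewrite iE subvv.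
have [|h' [hH' h'E]] := mono_lift iH im hH; first by rewrite iE.
have fe : is_epi f'.
  apply/limgTE=> y; have /mem_limgE[x xE] : i y \in limg f by rewrite -iE memv_img ?memvf.
  exists x; apply/eqP; rewrite -subr_eq0; apply/eqP.
  have /lker0E := im; apply; rewrite linearB /= -comp_lfunE f'E xE subrr //.
have [g [gH gE]] := Pp _ _ f' h' fH' fe hH'.
by exists g; split=> //; rewrite -f'E -comp_lfunA gE.
Qed.

Lemma comp0_limg X Y Z (f : 'Hom(Y, Z)) (h : 'Hom(X, Y)) :
  (f \o h)%VF = 0 -> (limg h <= lker f)%VS.
Proof.
move=> fh; apply/subvP=> y /mem_limgE[x <-].
by rewrite memv_ker -comp_lfunE fh zero_lfunE.
Qed.

End Exactness.

Section Star.
Variables (k : fieldType) (A : falgType k) (s : side).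
Implicit Types (K M N P Q X Y Z : amod A s) (T L : amod A (op s)).

(** The pairs (p i, phi i) are a dual basis of P: a family of generators with A-linear
    coordinate functions.  One exists exactly when P is projective. *)
Definition dual_basis P n (p : 'I_n -> P) (phi : 'I_n -> star P) : Prop :=
  forall x : P, x = \sum_i act P (vsval (phi i) x) (p i).

Lemma star_hom P (f : star P) : amod_hom (vsval f : 'Hom(P, reg A s)).
Proof. by apply/(@homvP _ _ s P (reg A s)); apply: subvsP. Qed.

Lemma hom_star P (f : 'Hom(P, reg A s)) : amod_hom f ->
  exists g : star P, vsval g = f.
Proof.
by move=> /homvP fH; exists (vsproj (homv P (reg A s)) f); rewrite vsprojK.
Qed.

Lemma star_mod P (f : star P) (a : A) x : vsval f (act P a x) = reg_act s a (vsval f x).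
Proof. by have /amod_homP -> := star_hom f. Qed.

Lemma star_actE P (a : A) (f : star P) x :
  vsval (act (star P) a f) x = reg_act s (vsval f x) a.
Proof.
rewrite [act (star P) a]/= /star_act (linfunE (@star_fun_linear _ _ s P a)).
by rewrite vsval_star_fun comp_lfunE -reg_actC.
Qed.

Lemma star_eq P (f g : star P) : (forall x, vsval f x = vsval g x) -> f = g.
Proof. by move=> E; apply: subvs_inj; apply/lfunP. Qed.

Lemma star_sum P n (f : 'I_n -> star P) x : vsval (\sum_i f i) x = \sum_i vsval (f i) x.
Proof. by rewrite linear_sum sum_lfunE. Qed.

Lemma dual_basis_ex P : projective P -> exists n p phi, @dual_basis P n p phi.
Proof.
move=> Pp; have [n [f [fH fe]]] := free_cover P.
have [t [tH ft]] := Pp _ _ f \1%VF fH fe (hom_id P).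
have /choice[phi phiE] i : exists g : star P, vsval g = (power_pr (reg A s) i \o t)%VF.
  by apply: hom_star; auto with hom.
exists n, (fun i => f (power_in (reg A s) i 1)), phi => x.
rewrite -[LHS]id_lfunE -ft comp_lfunE -[t x in LHS]id_lfunE -power_in_pr sum_lfunE lfun_sum.
apply: eq_bigr => i _; rewrite -(homE _ _ fH) phiE comp_lfunE; congr (f _).
rewrite comp_lfunE -(homE _ _ (hom_power_in _ i)); congr (power_in _ i _).
by rewrite [act _ _]/= reg_act_1.
Qed.

Lemma star_basis P n p phi : @dual_basis P n p phi ->
  forall f : star P, f = \sum_i act (star P) (vsval f (p i)) (phi i).
Proof.
move=> D f; apply: star_eq => x; rewrite star_sum {1}(D x) lfun_sum.
by apply: eq_bigr => i _; rewrite star_mod star_actE.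
Qed.

Lemma projective_star P : projective P -> projective (star P).
Proof.
move=> Pp; have [n [p [phi D]]] := dual_basis_ex Pp.
apply: (@projective_retract _ _ _ _ (power 'I_n (reg A (op s)))); last first.
  exact/projective_power/projective_reg.
pose i_fun (f : star P) : power 'I_n (reg A (op s)) := [ffun i => vsval f (p i)].
have i_lin : linear i_fun.
  move=> c f g; apply/ffunP=> i; rewrite !ffunE.
  by rewrite (linearP vsval) add_lfunE scale_lfunE.
exists (linfun i_fun), (power_sum (fun i => reg_ev (phi i))); split.
- apply/amod_homP=> a f; rewrite !(linfunE i_lin); apply/ffunP=> i.
  by rewrite power_actffunE !ffunE star_actE reg_actC.
- by apply: hom_power_sum => i; apply: hom_reg_ev.
apply/lfunP=> f; rewrite comp_lfunE power_sumE (linfunE i_lin) id_lfunE.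
rewrite [RHS](star_basis D); apply: eq_bigr => i _.
by rewrite ffunE reg_evE.
Qed.

Lemma star_mapE P Q (d : 'Hom(P, Q)) (f : star Q) x : amod_hom d ->
  vsval (star_map d f) x = vsval f (d x).
Proof. by move=> dH; rewrite vsval_star_map // comp_lfunE. Qed.

Lemma hom_star_map P Q (d : 'Hom(P, Q)) : amod_hom d -> amod_hom (star_map d).
Proof.
move=> dH; apply/amod_homP=> a f; apply: star_eq => x.
by rewrite star_mapE // !star_actE star_mapE.
Qed.

Definition star_ev P T (x : P) (t : T) : 'Hom(star P, T) :=
  linfun (fun f : star P => act T (vsval f x) t).

Lemma star_evE P T (x : P) (t : T) f : star_ev x t f = act T (vsval f x) t.
Proof.
apply: (@linfunE _ (star P) T (fun f : star P => act T (vsval f x) t)) => c u v.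
by rewrite (linearP vsval) add_lfunE scale_lfunE act_linear add_lfunE scale_lfunE.
Qed.

Lemma hom_star_ev P T (x : P) (t : T) : amod_hom (star_ev x t).
Proof.
apply/amod_homP=> a f; rewrite !star_evE star_actE reg_actC.
exact: act_reg.
Qed.

(** If P1 -> P0 -> Y -> 0 is a projective presentation, this condition means
    Hom(T, D Y) = 0.  Here D Y is, for a minimal presentation, the translate tau Z of
    the cokernel Z of star P0 -> star P1. *)
Definition extends P1 P0 (p1 : 'Hom(P1, P0)) T : Prop :=
  forall u : 'Hom(star P0, T), amod_hom u ->
    exists v : 'Hom(star P1, T), amod_hom v /\ (v \o star_map p1)%VF = u.

(** Such a form b is a map T -> D Y.  If y = p0 x, the map phi |-> phi(x) t extends along
    star p1 to a map v; expanding x and the phi o p1 in dual bases turns b t (p0 x)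
    into a sum of terms b (v chi) (p0 (p1 q)). *)
Lemma extends_form_zero P1 P0 Y (p1 : 'Hom(P1, P0)) (p0 : 'Hom(P0, Y)) T
    (b : T -> 'Hom(Y, k^o)) :
  projective P1 -> projective P0 -> amod_hom p1 -> amod_hom p0 ->
  is_epi p0 -> limg p1 = lker p0 -> extends p1 T -> linear b ->
  (forall a t y, b (act T a t) y = b t (act Y a y)) -> forall t y, b t y = 0.
Proof.
move=> P1p P0p pH1 pH0 /limgTE pe pE ext b_lin bA t y.
have [x <-] := pe y; have [n [p [phi D]]] := dual_basis_ex P0p.
have [m [q [chi D']]] := dual_basis_ex P1p.
have [v [vH vE]] := ext (star_ev x t) (hom_star_ev x t).
have bsum I (r : seq I) (F : I -> T) z :
    b (\sum_(i <- r) F i) z = \sum_(i <- r) b (F i) z.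
  rewrite -(linfunE b_lin) lfun_sum sum_lfunE; apply: eq_bigr => i _.
  by rewrite (linfunE b_lin).
have p01 z : p0 (p1 z) = 0 by apply/eqP; rewrite -memv_ker -pE memv_img ?memvf.
have uE i : act T (vsval (phi i) x) t = \sum_j act T (vsval (phi i) (p1 (q j))) (v (chi j)).
  rewrite -star_evE -vE comp_lfunE (star_basis D' (star_map p1 (phi i))) lfun_sum.
  by apply: eq_bigr => j _; rewrite star_mapE // homE.
rewrite {1}(D x) lfun_sum lfun_sum.
under eq_bigr => i _ do rewrite homE // -bA uE bsum.
rewrite exchange_big big1 // => j _.
under eq_bigr => i _ do rewrite bA -homE //.
by rewrite -!lfun_sum -D p01 linear0.
Qed.

Section Minimality.
Variables (P1 P0 Y : amod A s) (p1 : 'Hom(P1, P0)) (p0 : 'Hom(P0, Y)).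
Hypotheses (pres : minimal_presentation p1 p0) (Yi : indec Y).

Lemma presentation_nonprojective T (c : 'Hom(star P1, T)) :
  is_epi c -> ~ is_zero T -> ~ projective Y.
Proof.
move=> /limgTE ce T0 Yp; apply: T0.
have [[P1p P0p] [pH1 pH0] pe pE [ess1 ess0]] := pres.
have [t [tH pt]] := Yp _ _ p0 \1%VF pH0 pe (hom_id Y).
have te : is_epi t by apply: ess0 => //; rewrite pt lim1g pe.
have p0m : lker p0 = 0%VS.
  apply/lker0E=> x; have /limgTE/(_ x)[y <-] := te.
  by rewrite -comp_lfunE pt id_lfunE => ->; rewrite linear0.
have P10 : is_zero P1.
  have : is_epi (0 : 'Hom(amod0 A s, P1)).
    apply: ess1; first exact: hom_0.
    by rewrite comp_lfun0r lim0g pE p0m.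
  by move/limgTE=> e0; apply/zeroP=> x; have [y <-] := e0 x; rewrite zero_lfunE.
apply/zeroP=> z; have [f <-] := ce z; suff -> : f = 0 by rewrite linear0.
apply: star_eq => x; move/zeroP: P10 => /(_ x) ->.
by rewrite !linear0.
Qed.

(** Minimality of the presentation of Y passes to its dual: an endomorphism e of
    star P0 over star p1 is dual to an endomorphism of P0 of the form
    1 - t p0, and p0 t is nilpotent. *)
Lemma star_map_minimal (e : 'End(star P0)) : ~ projective Y ->
  amod_hom e -> (star_map p1 \o e)%VF = star_map p1 -> is_iso e.
Proof.
move=> Yp eH ep1; have [[P1p P0p] [pH1 pH0] pe pE _] := pres.
have [n [p [phi D]]] := dual_basis_ex P0p.
pose h x : P0 := \sum_i act P0 (vsval (e (phi i)) x) (p i).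
have h_lin : linear h.
  move=> c x y; rewrite /h scaler_sumr -big_split; apply: eq_bigr => i _ /=.
  by rewrite !linearP /= add_lfunE scale_lfunE.
pose eta : 'End(P0) := linfun h.
have etaE x : eta x = \sum_i act P0 (vsval (e (phi i)) x) (p i) by apply: linfunE.
have etaH : amod_hom eta.
  apply/amod_homP=> a x; rewrite !etaE lfun_sum; apply: eq_bigr => i _.
  by rewrite star_mod act_reg.
have fe (f : star P0) x : vsval f (eta x) = vsval (e f) x.
  rewrite [in RHS](star_basis D f) lfun_sum star_sum etaE lfun_sum.
  by apply: eq_bigr => i _; rewrite star_mod homE // star_actE.
have sep x y : (forall f : star P0, vsval f x = vsval f y) -> x = y.
  by move=> xy; rewrite (D x) (D y); apply: eq_bigr => i _; rewrite xy.
have etap y : eta (p1 y) = p1 y.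
  by apply: sep => f; rewrite fe -!star_mapE // -comp_lfunE ep1.
have [||t [tH tE]] := @epi_desc _ _ _ _ _ _ p0 (\1 - eta)%VF pH0 pe.
- by auto with hom.
- rewrite -pE; apply/subvP=> x /mem_limgE[y <-].
  by rewrite memv_ker add_lfunE opp_lfunE id_lfunE etap subrr.
have etaE' x : eta x = x - t (p0 x).
  by rewrite -[t _]comp_lfunE tE add_lfunE opp_lfunE id_lfunE subKr.
have p0tH : amod_hom (p0 \o t)%VF by auto with hom.
have [I0|[m nil]] := indec_endo Yi p0tH.
  case: Yp; apply: projective_retract P0p; exact: retract_of_iso I0.
have [/lker0E inj _] := (is_isoP (hom_sub (hom_id _) p0tH)).1
   (nilpotent_sub_iso p0tH nil).
have etaI : is_iso eta.
  apply: endo_mono_iso => //; apply/lker0E=> x; rewrite etaE' => /eqP.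
  rewrite subr_eq0 => /eqP xE; suff p0x : p0 x = 0 by rewrite xE p0x linear0.
  apply: inj; rewrite add_lfunE opp_lfunE id_lfunE comp_lfunE -xE.
  by rewrite subrr.
have [_ /limgTE etae] := (is_isoP etaH).1 etaI.
apply: endo_mono_iso => //; apply/lker0E=> f ef; apply: star_eq => x.
by have [y <-] := etae x; rewrite fe ef !(linear0 vsval) !zero_lfunE.
Qed.

(** The maps Z -> T -> Z lift to maps a, b between the presentations
    star P0 -> star P1 -> Z and R1 -> R0 -> T.  As Z -> T -> Z is the identity, b a is
    homotopic to the identity, up to an endomorphism w of star P0 over star p1, which
    is invertible by [star_map_minimal]. *)
Lemma extends_of_presentation (Z T R1 R0 : amod A (op s)) (c : 'Hom(star P1, Z))
    (r1 : 'Hom(R1, R0)) (r0 : 'Hom(R0, T)) :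
  amod_hom c -> is_epi c -> lker c = limg (star_map p1) -> ~ is_zero Z ->
  retract Z T -> projective R1 -> projective R0 -> amod_hom r1 -> amod_hom r0 ->
  is_epi r0 -> limg r1 = lker r0 ->
  (forall u : 'Hom(R1, T), amod_hom u ->
     exists v : 'Hom(R0, T), amod_hom v /\ (v \o r1)%VF = u) ->
  extends p1 T.
Proof.
move=> cH ce cE Z0 [zi [zp [ziH zpH zpi]]] R1p R0p rH1 rH0 re rE ext u uH.
have [[P1p P0p] [pH1 pH0] _ _ _] := pres.
have Yp := presentation_nonprojective ce Z0.
have Q1p := projective_star P1p; have Q0p := projective_star P0p.
pose d := star_map p1; have dH : amod_hom d by apply: hom_star_map.
have cd : (c \o d = 0)%VF.
  apply/lfunP=> f; rewrite comp_lfunE zero_lfunE; apply/eqP.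
  by rewrite -memv_ker cE memv_img ?memvf.
have r01 : (r0 \o r1 = 0)%VF.
  apply/lfunP=> f; rewrite comp_lfunE zero_lfunE; apply/eqP.
  by rewrite -memv_ker -rE memv_img ?memvf.
have [a0 [aH0 aE0]] := Q1p _ _ r0 (zi \o c)%VF rH0 re (hom_comp ziH cH).
have [b0 [bH0 bE0]] := R0p _ _ c (zp \o r0)%VF cH ce (hom_comp zpH rH0).
have [||a1 [aH1 aE1]] := @proj_lift_exact _ _ _ _ _ _ r1 (a0 \o d)%VF Q0p rH1.
- by auto with hom.
- by rewrite rE; apply: comp0_limg; rewrite comp_lfunA aE0 -comp_lfunA cd comp_lfun0r.
have [||b1 [bH1 bE1]] := @proj_lift_exact _ _ _ _ _ _ d (b0 \o r1)%VF R1p dH.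
- by auto with hom.
- by rewrite -cE; apply: comp0_limg; rewrite comp_lfunA bE0 -comp_lfunA r01 comp_lfun0r.
have [||t [tH tE]] := @proj_lift_exact _ _ _ _ _ _ d ((b0 \o a0) - \1)%VF Q1p dH.
- by auto with hom.
- rewrite -cE; apply: comp0_limg.
  rewrite comp_lfunDr comp_lfunNr comp_lfun1r comp_lfunA bE0 -comp_lfunA aE0.
  by rewrite comp_lfunA zpi comp_lfun1l subrr.
pose w := ((b1 \o a1) - (t \o d))%VF.
have wH : amod_hom w by rewrite /w; auto with hom.
have dw : (d \o w)%VF = d.
  rewrite comp_lfunDr comp_lfunNr !comp_lfunA bE1 tE -comp_lfunA aE1.
  by rewrite comp_lfunDl comp_lfunNl comp_lfun1l comp_lfunA opprD addrA subrr add0r opprK.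
have [w' [_ wH' w'w _]] := star_map_minimal Yp wH dw.
have [|v [vH vE]] := ext (u \o w' \o b1)%VF; first by auto with hom.
exists ((v \o a0) - (u \o w' \o t))%VF; split; first by auto with hom.
rewrite -[RHS]comp_lfun1r -w'w (comp_lfunA u) /w.
rewrite [RHS]comp_lfunDr comp_lfunNr !comp_lfunA -vE.
by rewrite comp_lfunDl comp_lfunNl -!comp_lfunA aE1.
Qed.

End Minimality.
End Star.

(** * Almost split translates and the kernel of an approximation *)

Section Presentations.
Variables (k : fieldType) (A : falgType k) (s : side).
Implicit Types (I K M P X Y Z : amod A s).

(** An epimorphism from a projective module of minimal dimension is essential, by
    [endo_iso_or_smaller]. *)
Lemma projective_cover M : exists P (f : 'Hom(P, M)),
  [/\ projective P, amod_hom f, is_epi f & essential f].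
Proof.
pose good n := `[< exists P (f : 'Hom(P, M)),
  [/\ projective P, amod_hom f, is_epi f & \dim {:P} = n] >].
have ex0 : exists n, good n.
  have [n [f [fH fe]]] := free_cover M.
  eexists; apply/asboolP; exists (power 'I_n (reg A s)), f; split=> //.
  exact/projective_power/projective_reg.
case: (ex_minnP ex0) => n /asboolP[P [f [Pp fH fe dP]]] minn.
exists P, f; split=> // X g gH fg.
have fge : is_epi (f \o g)%VF by rewrite /is_epi fg fe.
have [h [hH fgh]] := Pp _ _ (f \o g)%VF f (hom_comp fH gH) fge fH.
have fgh' : (f \o (g \o h) = f)%VF by rewrite comp_lfunA.
have [[u [_ _ _ ghu]]|[I [j [r [jH rH fjr IP dI]]]]] :=
  endo_iso_or_smaller (hom_comp gH hH) fgh'.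
  by apply: (@epi_retraction _ _ _ _ _ (h \o u)%VF); rewrite comp_lfunA.
have: good (\dim {:I}).
  apply/asboolP; exists I, (f \o j)%VF; split=> //; first exact: projective_retract IP Pp.
    by auto with hom.
  apply/limgTE=> y; have /limgTE/(_ y)[x <-] := fe.
  by exists (r x); rewrite -comp_lfunE fjr.
by move/minn; rewrite -dP leqNgt dI.
Qed.

Lemma minimal_presentation_ex M : exists P1 P0 (p1 : 'Hom(P1, P0)) (p0 : 'Hom(P0, M)),
  minimal_presentation p1 p0.
Proof.
have [P0 [p0 [P0p pH0 pe ess0]]] := projective_cover M.
have [K [i [iH im iE]]] := kernel_ex pH0.
have [P1 [f [P1p fH fe ess1]]] := projective_cover K.
exists P1, P0, (i \o f)%VF, p0; split=> //; first by split=> //; auto with hom.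
  by rewrite limg_comp fe iE.
split=> // X g gH; rewrite -comp_lfunA !limg_comp => /eqP.
rewrite eq_limg_ker0 ?im // => /eqP E; apply: ess1 => //.
by rewrite limg_comp.
Qed.

End Presentations.

Lemma functional_eq (k : fieldType) (V : vectType k) (x y : V) :
  (forall phi : 'Hom(V, k^o), phi x = phi y) -> x = y.
Proof.
move=> E; apply/eqP; rewrite -subr_eq0 -memv0; apply/negPn/negP.
by case/separating_functional=> l [_]; rewrite linearB /= E subrr.
Qed.

Lemma dual_actE (k : fieldType) (A : falgType k) s (M : amod A s) a (phi : dual M) x :
  act (dual M) a phi x = (phi : 'Hom(M, k^o)) (act M a x).
Proof.
rewrite [act (dual M) a]/= /dual_act (linfunE (@dual_fun_linear _ _ s M a)).
by rewrite comp_lfunE.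
Qed.

Section Translate.
Variables (k : fieldType) (A : falgType k).
Implicit Types (E K M N P R T X Y Z : amod A Right).

(** The cokernel of Hom(R0, T) -> Hom(R1, T) is dual to Hom(T, tau T): a functional l on
    Hom(R1, T) that vanishes on the maps through R0 defines t |-> (phi |-> l (phi(-) t))
    from T to D (star R1), with image in the dual of the cokernel of star r1. *)
Lemma tau_rigid_extends T R1 R0 (r1 : 'Hom(R1, R0)) (r0 : 'Hom(R0, T)) :
  tau_rigid T -> minimal_presentation r1 r0 ->
  forall u : 'Hom(R1, T), amod_hom u ->
    exists v : 'Hom(R0, T), amod_hom v /\ (v \o r1)%VF = u.
Proof.
move=> Tr pres u uH; have [[R1p R0p] [rH1 rH0] re rE _] := pres.
have [||W WE] := @vspace_of_pred _ _
  (fun w : 'Hom(R1, T) => exists v : 'Hom(R0, T), amod_hom v /\ (v \o r1)%VF = w).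
- by exists 0; split; rewrite ?comp_lfun0l //; auto with hom.
- move=> c _ _ [v [vH <-]] [v' [vH' <-]]; exists (c *: v + v').
  by split; [auto with hom | rewrite comp_lfunDl -comp_lfunZl].
have [/WE //|/negP uW] := pselect (u \in W).
have [l [lW lu]] := separating_functional uW.
case: lu; have [n [p [phi D]]] := dual_basis_ex R1p.
have [X [c [cH ce cE]]] := cokernel_ex (hom_star_map rH1).
have TrX : is_Tr T X by exists R1, R0, r1, r0, c; split.
pose m_fun t (f : star R1) : k^o := l (reg_ev t \o vsval f)%VF.
have m_lin t : linear (m_fun t).
  move=> a f g; rewrite /m_fun (linearP vsval) comp_lfunDr -comp_lfunZr.
  by rewrite linearP.
pose b t : 'Hom(X, k^o) := (linfun (m_fun t) \o c^-1)%VF.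
have bE t f : b t (c f) = m_fun t f.
  rewrite comp_lfunE -(linfunE (m_lin t) f); apply/eqP; rewrite -subr_eq0 -linearB /=.
  have /mem_limgE[g <-] : (c^-1)%VF (c f) - f \in limg (star_map r1).
    by rewrite -cE memv_ker linearB /= limg_lfunVK ?memv_img ?memvf // subrr.
  rewrite (linfunE (m_lin t)) /m_fun vsval_star_map // comp_lfunA.
  apply/eqP/lW/WE; exists (reg_ev t \o vsval g)%VF; split=> //.
  by apply: hom_comp; [apply: hom_reg_ev | apply: star_hom].
have b_lin : linear b.
  move=> a t t'; apply/lfunP=> y; have /limgTE/(_ y)[f <-] := ce.
  rewrite add_lfunE scale_lfunE !bE /m_fun -linearP; congr (l _).
  by apply/lfunP=> x; rewrite add_lfunE scale_lfunE !comp_lfunE !reg_evE linearP.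
have bH : amod_hom (linfun b : 'Hom(T, dual X)).
  apply/amod_homP=> a t; rewrite !(linfunE b_lin); apply/lfunP=> y.
  have /limgTE/(_ y)[f <-] := ce; rewrite dual_actE -homE // !bE.
  congr (l _); apply/lfunP=> x; rewrite !comp_lfunE !reg_evE star_actE.
  by rewrite act_reg.
have b0 : (linfun b : 'Hom(T, dual X)) = 0.
  by apply: (Tr (dual X)) => //; exists X; split=> //; apply: iso_refl.
have -> : u = \sum_i (reg_ev (u (p i)) \o vsval (phi i))%VF.
  apply/lfunP=> x; rewrite {1}(D x) lfun_sum sum_lfunE; apply: eq_bigr => i _.
  by rewrite homE // comp_lfunE reg_evE.
rewrite lfun_sum big1 // => i _.
by rewrite -[LHS]bE -(linfunE b_lin) b0 !zero_lfunE.
Qed.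

(** X is reflexive over k, so g is the transpose of the map e whose i-th coordinate is
    the image under g of the i-th coordinate function of X. *)
Lemma dual_endo X (g : 'End(dual X)) : amod_hom g ->
  exists e : 'End(X), amod_hom e /\ forall (phi : 'Hom(X, k^o)) x, g phi x = phi (e x).
Proof.
move=> gH; pose n := \dim {:X}.
have co_lin (i : 'I_n) : linear (fun x => coord (vbasis {:X}) i x : k^o).
  by move=> c x y; rewrite linearP.
pose co (i : 'I_n) : 'Hom(X, k^o) := linfun (fun x => coord (vbasis {:X}) i x : k^o).
pose h x : X := \sum_(i < n) (g (co i) x : k) *: (vbasis {:X})`_i.
have h_lin : linear h.
  move=> c x y; rewrite /h scaler_sumr -big_split; apply: eq_bigr => i _ /=.
  by rewrite linearP scalerDl scalerA.
have hE phi x : g phi x = phi (linfun h x).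
  rewrite (linfunE h_lin) /h lfun_sum.
  have {1}-> : phi = \sum_(i < n) (phi (vbasis {:X})`_i : k) *: co i.
    apply/lfunP=> y; rewrite sum_lfunE {1}(coord_vbasis (memvf y)) lfun_sum.
    apply: eq_bigr => i _; rewrite scale_lfunE (linfunE (co_lin i)) linearZ.
    exact: mulrC.
  rewrite lfun_sum sum_lfunE; apply: eq_bigr => i _.
  by rewrite !linearZ scale_lfunE; apply: mulrC.
exists (linfun h); split=> //; apply/amod_homP=> a x.
apply: functional_eq => phi; rewrite -hE.
have -> : g phi (act X a x) = act (dual X) a (g phi) x by rewrite dual_actE.
by rewrite -homE // hE dual_actE.
Qed.

(** An idempotent of D X is the transpose of an idempotent of X. *)
Lemma indec_dual X : indec X -> indec (dual X).
Proof.
move=> Xi; split=> [/zeroP D0|M N MN].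
  case: (Xi) => X0 _; apply: X0; apply/zeroP=> x; apply: functional_eq => phi.
  by rewrite (D0 phi) !zero_lfunE.
have [i [j [p [q [[iH jH] [pH qH] [pi qj] [pj qi] ijpq]]]]] := iso_biproduct MN.
have [e [eH eE]] := dual_endo (hom_comp iH pH).
have idem x : e (e x) = e x.
  apply: functional_eq => phi; rewrite -!eE; congr (_ _).
  by rewrite !comp_lfunE -(comp_lfunE p) pi id_lfunE.
have [[f [_ _ fe _]]|[n en]] := indec_endo Xi eH.
  have e1 x : e x = x by have := congr1 f (idem x); rewrite -!(comp_lfunE f e) fe !id_lfunE.
  right; apply/zero_id; rewrite -qj.
  suff -> : j = 0 by rewrite comp_lfun0r.
  apply/lfunP=> y; rewrite zero_lfunE.
  have -> : j y = (i \o p)%VF (j y) by apply/lfunP=> x; rewrite eE e1.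
  by rewrite comp_lfunE -(comp_lfunE p) pj zero_lfunE linear0.
have e0 x : e x = 0.
  have : fpow e n (e x) = e x by rewrite fpowE; elim: n {en} => //= n ->.
  by rewrite en zero_lfunE.
left; apply/zero_id; rewrite -pi; suff -> : i = 0 by rewrite comp_lfun0r.
apply/lfunP=> y; rewrite zero_lfunE.
have -> : i y = (i \o p)%VF (i y) by rewrite comp_lfunE -(comp_lfunE p) pi id_lfunE.
by apply/lfunP=> x; rewrite eE e0 linear0 zero_lfunE.
Qed.

Lemma extends_power (P1 P0 : amod A Left) (p1 : 'Hom(P1, P0)) T (J : finType) :
  extends p1 T -> extends p1 (power J T).
Proof.
move=> ext u uH.
have /choice[v vP] j : exists v : 'Hom(star P1, T),
    amod_hom v /\ (v \o star_map p1)%VF = (power_pr T j \o u)%VF.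
  by apply: ext; auto with hom.
exists (\sum_j (power_in T j \o v j)%VF); split.
  apply: (big_ind (@amod_hom _ _ _ (star P1) (power J T))); first exact: hom_0.
    by move=> *; apply: hom_add.
  by move=> j _; apply: hom_comp; [apply: hom_power_in | case: (vP j)].
rewrite -[RHS]comp_lfun1l -power_in_pr; apply/lfunP=> f.
rewrite !comp_lfunE !sum_lfunE; apply: eq_bigr => j _.
by rewrite !comp_lfunE -[v j _]comp_lfunE (vP j).2 comp_lfunE.
Qed.

(** A map u : star P0 -> K extends to v : star P1 -> M.  The map f v kills the image of
    star P0, so it induces Z -> X, which lifts to h' : Z -> M; then v - h' c extends u and
    takes its values in K. *)
Lemma extends_kernel (P1 P0 : amod A Left) (p1 : 'Hom(P1, P0)) Z (c : 'Hom(star P1, Z))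
    K M X (i : 'Hom(K, M)) (f : 'Hom(M, X)) :
  amod_hom p1 -> amod_hom c -> is_epi c -> lker c = limg (star_map p1) ->
  ses i f ->
  (forall h : 'Hom(Z, X), amod_hom h ->
     exists h' : 'Hom(Z, M), amod_hom h' /\ (f \o h')%VF = h) ->
  extends p1 M -> extends p1 K.
Proof.
move=> pH1 cH ce cE S univ ext u uH; have [[iH fH] _ _ fi _] := S.
have [v [vH vE]] := ext (i \o u)%VF (hom_comp iH uH).
have [||h [hH hE]] := @epi_desc _ _ _ _ _ _ c (f \o v)%VF cH ce.
- by auto with hom.
- rewrite cE; apply/subvP=> y /mem_limgE[x <-].
  by rewrite memv_ker comp_lfunE -(comp_lfunE v) vE comp_lfunE fi.
have [h' [hH' hE']] := univ h hH.
have [||w [wH wE]] := @ses_lift _ _ _ _ _ _ _ _ _ (v - (h' \o c))%VF S.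
- by auto with hom.
- move=> x; rewrite add_lfunE opp_lfunE linearB /= comp_lfunE -(comp_lfunE f h') hE'.
  by rewrite -(comp_lfunE h c) hE comp_lfunE subrr.
exists w; split=> //; apply: (mono_cancel (ses_mono S)).
rewrite comp_lfunA wE -vE comp_lfunDl comp_lfunNl.
suff -> : (h' \o c \o star_map p1 = 0)%VF by rewrite subr0.
apply/lfunP=> x; rewrite zero_lfunE comp_lfunE comp_lfunE.
have /eqP -> : c (star_map p1 x) == 0 by rewrite -memv_ker cE memv_img ?memvf.
by rewrite linear0.
Qed.

(** Here X = tau Z, and Hom(T, X) = 0 because T is tau-rigid.  In the form [extends] this
    vanishing passes from T to powers of T and to the kernel K of f. *)
Lemma hom_zero_kernel T X Z M (J : finType) K (i : 'Hom(K, power J T))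
    (f : 'Hom(power J T, M)) :
  tau_rigid T -> indec X -> is_tau_inv X Z -> ~ is_zero Z -> retract Z T ->
  ses i f ->
  (forall h : 'Hom(T, M), amod_hom h ->
     exists h' : 'Hom(T, power J T), amod_hom h' /\ (f \o h')%VF = h) ->
  hom_zero K X.
Proof.
move=> Trig Xi [P1 [P0 [p1 [p0 [c [pres cH ce cE]]]]]] Z0 ZT S univ g gH.
have [[P1p P0p] [pH1 pH0] pe pE _] := pres.
have [R1 [R0 [r1 [r0 pres']]]] := minimal_presentation_ex T.
have [[R1p R0p] [rH1 rH0] re rE _] := pres'.
have extT : extends p1 T.
  exact: (extends_of_presentation pres (indec_dual Xi) cH ce cE Z0 ZT R1p R0p
           rH1 rH0 re rE (tau_rigid_extends Trig pres')).
have extK : extends p1 K.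
  apply: (extends_kernel pH1 cH ce cE S _ (extends_power extT)) => h hH.
  have [zi [zp [ziH zpH zpi]]] := ZT.
  have [h' [hH' hE']] := univ (h \o zp)%VF (hom_comp hH zpH).
  exists (h' \o zi)%VF; split; first by auto with hom.
  by rewrite comp_lfunA hE' -comp_lfunA zpi comp_lfun1r.
pose b_fun m (phi : 'Hom(X, k^o)) : k^o := phi (g m).
have bf_lin m : linear (b_fun m).
  by move=> a u v; rewrite /b_fun add_lfunE scale_lfunE.
pose b m : 'Hom(dual X, k^o) := linfun (b_fun m).
have bE m (phi : dual X) : b m phi = b_fun m phi by apply: (linfunE (bf_lin m)).
have b_lin : linear b.
  by move=> a m m'; apply/lfunP=> phi; rewrite add_lfunE scale_lfunE !bE /b_fun !linearP.
have bA a m (phi : dual X) : b (act K a m) phi = b m (act (dual X) a phi).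
  by rewrite !bE /b_fun dual_actE homE.
have bz := extends_form_zero P1p P0p pH1 pH0 pe pE extK b_lin bA.
apply/lfunP=> m; rewrite zero_lfunE; apply: functional_eq => phi.
by have := bz m phi; rewrite bE /b_fun linear0.
Qed.

End Translate.

(** * Modules generated or cogenerated by a tau-slice *)

Section AddGen.
Variables (k : fieldType) (A : falgType k) (s : side).
Implicit Types (C E K L M N T X Y Z : amod A s).

Lemma in_add_dsum T M : in_add T M ->
  exists Ys : seq (amod A s), (forall Y, List.In Y Ys -> retract Y T) /\ iso M (dsum Ys).
Proof.
case=> n [X [XT MX]]; exists [seq X i | i : 'I_n]; split=> // Y.
by case/List.in_map_iff=> i [<- _]; apply/summandP.
Qed.

Lemma approximation_lift T M X (f : 'Hom(M, X)) (Ys : seq (amod A s)) :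
  amod_hom f ->
  (forall h : 'Hom(T, X), amod_hom h ->
     exists h' : 'Hom(T, M), amod_hom h' /\ (f \o h')%VF = h) ->
  (forall Y, List.In Y Ys -> retract Y T) ->
  forall g : 'Hom(dsum Ys, X), amod_hom g ->
    exists g' : 'Hom(dsum Ys, M), amod_hom g' /\ (f \o g')%VF = g.
Proof.
move=> fH univ; elim: Ys => [|Y Ys IH] YT /= g gH.
  exists 0; split; first exact: hom_0.
  apply/lfunP=> x; rewrite ((zeroP (amod0 A s)).1 (zero_amod0 A s) x).
  by rewrite !linear0.
have [g1 [gH1 gE1]] := IH (fun Z ZY => YT Z (or_intror ZY))
  (g \o dinr Y (dsum Ys))%VF (hom_comp gH (hom_dinr _ _)).
have [i [p [iH pH pi]]] := YT Y (or_introl erefl).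
have [|h [hH hE]] := univ (g \o dinl Y (dsum Ys) \o p)%VF.
  by apply: hom_comp pH; apply: hom_comp gH (hom_dinl _ _).
exists (dcase (h \o i)%VF g1); split; first by auto with hom.
apply/lfunP=> -[x y]; rewrite comp_lfunE dcaseE linearD /= -!comp_lfunE.
rewrite comp_lfunA hE gE1 -comp_lfunA pi comp_lfun1r !comp_lfunE dinlE dinrE -linearD /=.
by congr (g (_, _)); rewrite /= ?addr0 ?add0r.
Qed.

Lemma approximation_ex T X : exists n (f : 'Hom(power 'I_n T, X)),
  amod_hom f /\ forall h : 'Hom(T, X), amod_hom h ->
     exists h' : 'Hom(T, power 'I_n T), amod_hom h' /\ (f \o h')%VF = h.
Proof.
pose H := homv T X; pose b (i : 'I_(\dim H)) : 'Hom(T, X) := (vbasis H)`_i.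
have bH i : amod_hom (b i).
  by apply/homvP/vbasis_mem/mem_nth; rewrite size_tuple.
exists (\dim H), (power_sum b); split; first exact: hom_power_sum.
move=> h /homvP hH; pose c i := coord (vbasis H) i h.
exists (\sum_i (c i *: power_in T i)); split.
  apply: (big_ind (@amod_hom _ _ _ T (power _ T))); first exact: hom_0.
    by move=> *; apply: hom_add.
  by move=> i _; apply/hom_scale/hom_power_in.
rewrite [RHS](coord_vbasis hH); apply/lfunP=> x.
rewrite comp_lfunE [X in power_sum b X]sum_lfunE lfun_sum [RHS]sum_lfunE.
apply: eq_bigr => i _.
by rewrite !scale_lfunE linearZ /= -[power_sum b _]comp_lfunE power_sum_in.
Qed.

Lemma in_Gen_approximation_epi T X n (f : 'Hom(power 'I_n T, X)) :
  in_Gen T X -> amod_hom f ->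
  (forall h : 'Hom(T, X), amod_hom h ->
     exists h' : 'Hom(T, power 'I_n T), amod_hom h' /\ (f \o h')%VF = h) ->
  is_epi f.
Proof.
case=> M [g [/in_add_dsum[Ys [YT /isoP[a [a' [aH aH' a'a aa']]]]] gH /limgTE ge]] fH univ.
have [h [hH hE]] := approximation_lift fH univ YT (hom_comp gH aH').
apply/limgTE=> x; have [y <-] := ge x; exists (h (a y)).
by rewrite -comp_lfunE hE comp_lfunE -(comp_lfunE a') a'a id_lfunE.
Qed.

Lemma AR_arrow_iso Y' Y C : iso Y' Y -> AR_arrow Y C -> AR_arrow Y' C.
Proof.
move=> YY [Yi Ci [f [fH fm fe ff]]]; have Yi' := iso_indec (iso_sym YY) Yi.
have [h [h' [hH hH' h'h hh']]] := (isoP _ _).1 YY.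
split=> //; exists (f \o h)%VF; split; first by auto with hom.
- case=> g [gH gfh]; apply: fm; exists (h \o g)%VF; split; first by auto with hom.
  rewrite -[LHS]comp_lfun1r -hh' !comp_lfunA -(comp_lfunA h) -(comp_lfunA h).
  by rewrite -(comp_lfunA g) gfh comp_lfun1r.
- case=> g [gH fhg]; apply: fe; exists (h \o g)%VF; split; first by auto with hom.
  by rewrite comp_lfunA.
move=> Z g e gH eH eg.
have egh : (e \o (g \o h'))%VF = f by rewrite comp_lfunA eg -comp_lfunA hh' comp_lfun1r.
have [[u [uH ugh]]|es] := ff Z _ e (hom_comp gH hH') eH egh.
- left; exists (h' \o u)%VF; split; first by auto with hom.
  have : ((h' \o (u \o (g \o h'))) \o h)%VF = \1%VF by rewrite ugh comp_lfun1r.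
  by rewrite -!comp_lfunA h'h comp_lfun1r comp_lfunA.
- by right.
Qed.

End AddGen.

Section Slice.
Variables (k : fieldType) (A : falgType k).
Implicit Types (C E K L M N T X Y Z : amod A Right).

Definition summand_at T (j : 'I_(size (decomposition T))) : amod A Right :=
  nth T (decomposition T) j.
Arguments summand_at : clear implicits.

Section Arrows.
Variable T : amod A Right.
Let Sg X := indec X /\ summand X T.
Let arrow Y Z := [/\ Sg Y, Sg Z & AR_arrow Y Z].
Hypothesis acyclic : forall X, ~ clos_trans _ arrow X X.

Lemma Sg_iso X Y : iso X Y -> Sg X -> Sg Y.
Proof.
move=> XY [Xi /summandP XT]; split; first exact: iso_indec XY Xi.
apply/summandP; apply: retract_trans XT; exact/iso_retract/iso_sym.
Qed.

Lemma arrow_iso X Y Z : iso X Y -> arrow Y Z -> arrow X Z.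
Proof.
by move=> XY [SY SZ YZ]; split=> //; [apply: Sg_iso (iso_sym XY) SY | apply: AR_arrow_iso YZ].
Qed.

(** The first arrow of a path from Y to X may be moved to start at X. *)
Lemma no_path_iso X Y : iso X Y -> ~ clos_trans _ arrow Y X.
Proof.
move=> XY YX; apply: (acyclic (X := X)).
have key a b : clos_trans _ arrow a b -> iso X a -> clos_trans _ arrow X b.
  move=> ab; elim: ab => {a b} [a b ab Xa|a b c _ IH bc _ Xa].
    by apply: t_step; apply: arrow_iso ab.
  exact: t_trans (IH Xa) bc.
exact: key YX XY.
Qed.

Lemma slice_summand C : Sg C ->
  exists j, iso C (summand_at T j).
Proof.
case=> Ci /summandP CT.
have [Y [YT CY]] := indec_retract_dsum Ci
  (retract_trans CT (iso_retract (decomposition_iso T))).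
have CisoY := indec_retract_iso (proj1 Ci) (decomposition_indec YT) CY.
have [Y1 [Y2 E]] := In_split YT.
have lt : (size Y1 < size (decomposition T))%N.
  by rewrite E size_cat /= addnS ltnS leq_addr.
by exists (Ordinal lt); rewrite /summand_at /= E nth_cat ltnn subnn.
Qed.

(** The indecomposable summands of T form a finite acyclic quiver: along an arrow,
    more members of a decomposition of T become predecessors. *)
Lemma slice_ind (P : amod A Right -> Prop) :
  (forall C, Sg C -> (forall E, Sg E -> AR_arrow E C -> P E) -> P C) ->
  forall C, Sg C -> P C.
Proof.
move=> ind C.
pose V := summand_at T.
pose before X := [set j | `[< clos_trans _ arrow (V j) X >]].
have [n] := ubnP #|before C|; elim: n C => // n IH C; rewrite ltnS => ltC SC.
apply: ind => // E SE EC; apply: IH => //; apply: leq_trans ltC.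
apply: proper_card; apply/properP; split.
  apply/subsetP=> j; rewrite !inE => /asboolP jE; apply/asboolP.
  by apply: t_trans jE _; apply: t_step.
have [j Ej] := slice_summand SE; exists j; rewrite inE.
  by apply/asboolP/t_step; apply: arrow_iso (iso_sym Ej) _.
by apply/asboolPn/no_path_iso.
Qed.

End Arrows.

Lemma hom_zero_power (J : finType) K T : hom_zero K T -> hom_zero K (power J T).
Proof.
move=> KT h hH; rewrite -[h]comp_lfun1l -power_in_pr.
apply/lfunP=> x; rewrite comp_lfunE sum_lfunE zero_lfunE big1 // => j _.
rewrite comp_lfunE -(comp_lfunE _ h) (KT (power_pr T j \o h)%VF) ?zero_lfunE ?linear0 //.
by auto with hom.
Qed.

(** If an indecomposable summand C of the kernel K of an approximation were not a
    summand of T, every map from C to a summand of T would factor through the sources of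
    arrows in the Auslander-Reiten quiver and so, inductively, through sources outside
    the slice.  Those are translates of summands of T and receive no nonzero map
    from K. *)
Lemma slice_presentation T X : tau_slice T -> in_Gen T X ->
  exists n (Ks : seq (amod A Right)) (i : 'Hom(dsum Ks, power 'I_n T))
    (f : 'Hom(power 'I_n T, X)),
  [/\ forall C, List.In C Ks -> indec C /\ retract C T, ses i f
    & forall h : 'Hom(T, X), amod_hom h ->
       exists h' : 'Hom(T, power 'I_n T), amod_hom h' /\ (f \o h')%VF = h].
Proof.
case=> Trig [_ acyclic _ _ presec] TX.
have [n [f [fH univ]]] := approximation_ex T X.
have fe := in_Gen_approximation_epi TX fH univ.
have [K [i S]] := epi_ses fH fe; have [[iH _] im _ _ _] := S.
have [a [a' [aH aH' a'a aa']]] := (isoP _ _).1 (decomposition_iso K).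
have aI : is_iso a' by exists a.
exists n, (decomposition K), (i \o a')%VF, f; split=> //; last first.
  split; [by split; auto with hom | | exact/limgTE | |].
  - move=> x; rewrite comp_lfunE => /im ax.
    by rewrite -(id_lfunE x) -aa' comp_lfunE ax linear0.
  - by move=> x; rewrite comp_lfunE; have [_ _ _ fi _] := S; apply: fi.
  - move=> y fy; have [_ _ _ _ ex] := S; have [x <-] := ex y fy.
    by exists (a x); rewrite comp_lfunE -(comp_lfunE a') a'a id_lfunE.
move=> C CK; have Ci := decomposition_indec CK; split=> //.
apply: contrapT => CT.
have [j [q [jH qH qj]]] : retract C K.
  apply: retract_trans (retract_dsum CK) _.
  exact/iso_retract/iso_sym/decomposition_iso.
have C0 : hom_zero C T.
  apply: (hom_zero_iso (iso_sym (decomposition_iso T))); apply: hom_zero_dsum => Y YT.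
  have : indec Y /\ summand Y T.
    split; first exact: decomposition_indec YT.
    apply/summandP; apply: retract_trans (retract_dsum YT) _.
    exact/iso_retract/iso_sym/decomposition_iso.
  apply: (slice_ind acyclic (P := hom_zero C)) => {YT} {}Y SY IH h hH.
  have [Yi /summandP YT] := SY.
  apply: (hom_zero_of_arrows Yi) => // [E EY|[g [gH hg]]]; last first.
    apply: CT; apply: retract_trans YT; apply/iso_retract/iso_sym.
    by apply: indec_retract_iso => //; [case: Yi | exists g, h].
  have [[SE|[Z [EZ [Zi /summandP ZT]]]] _] := presec E Y EY SY; first exact: IH.
  have Ei : indec E by case: EY.
  have KE := hom_zero_kernel Trig Ei EZ (proj1 Zi) ZT S univ.
  move=> g gH; rewrite -[g]comp_lfun1r -qj comp_lfunA.
  by rewrite (KE (g \o q)%VF) ?comp_lfun0l //; auto with hom.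
have := @hom_zero_power 'I_n C T C0 (i \o j)%VF (hom_comp iH jH).
case: Ci => Cnz _ ij; apply: Cnz; apply/zeroP=> x.
rewrite -(id_lfunE x) -qj comp_lfunE (_ : j x = 0) ?linear0 //.
by apply: im; rewrite -comp_lfunE ij zero_lfunE.
Qed.

End Slice.
Arguments summand_at {k A} T j.

(** * Bounds on projective dimensions *)

Section Bounds.
Variables (k : fieldType) (A : falgType k).
Implicit Types (B C E K L M N T X Y Z : amod A Right).

Section SummandsOf.
Variable T : amod A Right.

Let V := summand_at T.

Lemma sumV_cat (ls ls' : seq 'I_(size (decomposition T))) :
  iso (sumV V (ls ++ ls')) (dsum2 (sumV V ls) (sumV V ls')).
Proof. by rewrite /sumV map_cat; apply: dsum_cat. Qed.

Lemma summand_sumV (Ks : seq (amod A Right)) :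
  (forall C, List.In C Ks -> indec C /\ retract C T) ->
  exists ls, iso (dsum Ks) (sumV V ls).
Proof.
elim: Ks => [|C Ks IH] KT; first by exists [::]; apply: iso_refl.
have [|ls lsE] := IH; first by move=> Y YK; apply: KT; right.
have [Ci CT] := KT C (or_introl erefl).
have [j jE] : exists j, iso C (V j) by apply: slice_summand; split=> //; apply/summandP.
by exists (j :: ls); apply: iso_dsum2.
Qed.

Lemma retract_sumV (Ys : seq (amod A Right)) :
  (forall Y, List.In Y Ys -> retract Y T) -> exists ls, iso (dsum Ys) (sumV V ls).
Proof.
elim: Ys => [|Y Ys IH] YT; first by exists [::]; apply: iso_refl.
have [|ls lsE] := IH; first by move=> Z ZY; apply: YT; right.
have [|ls' ls'E] := @summand_sumV (decomposition Y).
  move=> C CY; split; first exact: decomposition_indec CY.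
  apply: retract_trans (retract_dsum CY) _.
  apply: retract_trans (YT Y (or_introl erefl)).
  exact/iso_retract/iso_sym/decomposition_iso.
exists (ls' ++ ls); apply: iso_trans _ (iso_sym (sumV_cat _ _)).
by apply: iso_dsum2 => //; apply: iso_trans (decomposition_iso Y) _.
Qed.

Lemma power_sumV n : exists ls, iso (power 'I_n T) (sumV V ls).
Proof.
have [|ls lsE] := @retract_sumV (nseq n T).
  elim: n => //= n IH Y [<-|/IH //]; exact: retract_refl.
by exists ls; apply: iso_trans (power_iso_dsum n T) _.
Qed.

Lemma Om_sumV ls : stable (Om (sumV V ls)) (sumV (fun j => Om (V j)) ls).
Proof.
elim: ls => [|j ls IH].
  apply: projective_stable; last exact/projective_zero/zero_amod0.
  exact/projective_Om/projective_zero/zero_amod0.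
apply: stable_trans (Om_dsum2 _ _) _.
exact: stable_dsum2 (stable_refl _) IH.
Qed.

End SummandsOf.

Lemma in_Gen_bound T : tau_slice T ->
  exists d, forall X, in_Gen T X -> finite_pd X -> pd_le d X.
Proof.
move=> Tt; have [d dP] := igusa_todorov (summand_at T).
exists d => X TX; have [n [Ks [i [f [KT S _]]]]] := slice_presentation Tt TX.
have [ls1 E1] := summand_sumV KT; have [ls0 E0] := power_sumV T n.
exact: (dP ls0 ls1 _ _ _ _ _ S (iso_stable E1) (iso_stable E0)).
Qed.

(** If P -> Y is an epimorphism from a projective module, the kernel L of P -> Y -> Z is a
    syzygy of Z; it maps onto X, and the kernel of L -> X is the kernel of P -> Y. *)
Lemma ses_rotate X Y Z i f : @ses k A Right X Y Z i f ->
  exists L (j : 'Hom(Om Y, L)) (g : 'Hom(L, X)), stable L (Om Z) /\ ses j g.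
Proof.
move=> S; have [[iH fH] im fe fi ex] := S.
have [P [u [p [Pp Sp]]]] := OmP Y; have [[uH pH] um pe pu pex] := Sp.
have fpH : amod_hom (f \o p)%VF by auto with hom.
have fpe : is_epi (f \o p)%VF.
  by rewrite /is_epi limg_comp (ses_epi Sp) (ses_epi S).
have [L [l Sl]] := epi_ses fpH fpe; have [[lH _] lm _ fpl lex] := Sl.
have [|j [jH jE]] := ses_lift Sl uH.
  by move=> x; rewrite comp_lfunE pu linear0.
have [|g [gH gE]] := ses_lift S (hom_comp pH lH).
  by move=> x; rewrite comp_lfunE -(comp_lfunE f) fpl.
have lj x : l (j x) = u x by rewrite -comp_lfunE jE.
have ig x : i (g x) = p (l x) by rewrite -comp_lfunE gE comp_lfunE.
exists L, j, g; split; first exact: Om_ses Sl Pp.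
split=> //.
- by move=> x jx; apply: um; rewrite -lj jx linear0.
- move=> x; have [y yE] := pe (i x).
  have [|z zE] := lex y; first by rewrite comp_lfunE yE fi.
  exists z; apply/eqP; rewrite -subr_eq0; apply/eqP/im.
  by rewrite linearB /= ig zE yE subrr.
- by move=> x; apply: im; rewrite ig lj pu.
- move=> y gy; have [|x xE] := pex (l y); first by rewrite -ig gy linear0.
  exists x; apply/eqP; rewrite -subr_eq0; apply/eqP/lm.
  by rewrite linearB /= lj xE subrr.
Qed.

(** The map (x, m) |-> j x + h m from K + M to N is onto, since f is.  An element (x, m) of
    its kernel satisfies f m = g (h m) = 0, and x is determined by m. *)
Lemma ses_switch X M Z K N (i : 'Hom(X, M)) (f : 'Hom(M, Z)) (j : 'Hom(K, N))
    (g : 'Hom(N, Z)) (h : 'Hom(M, N)) :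
  ses i f -> ses j g -> amod_hom h -> (g \o h)%VF = f ->
  exists (i' : 'Hom(X, dsum2 K M)) (f' : 'Hom(dsum2 K M, N)), ses i' f'.
Proof.
move=> S S' hH gh; have [[iH fH] im fe fi ex] := S; have [[jH gH] jm ge gj gex] := S'.
have ghE x : g (h x) = f x by rewrite -comp_lfunE gh.
have [|l [lH lE]] := ses_lift S' (hom_comp hH iH).
  by move=> x; rewrite comp_lfunE ghE fi.
have jl x : j (l x) = h (i x) by rewrite -comp_lfunE lE comp_lfunE.
exists (dpair (- l) i), (dcase j h); split; first by split; auto with hom.
- by move=> x; rewrite dpairE => -[_ /im].
- move=> y; have [m mE] := fe (g y).
  have [|x xE] := gex (y - h m); first by rewrite linearB /= ghE mE subrr.
  by exists (x, m); rewrite dcaseE /= xE subrK.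
- by move=> x; rewrite dpairE dcaseE /= opp_lfunE linearN /= jl addNr.
case=> x m; rewrite dcaseE => /= E.
have [|y yE] := ex m.
  by rewrite -ghE -[h m](addKr (j x)) E addr0 linearN /= gj oppr0.
exists y; rewrite dpairE yE; congr (_, _); rewrite opp_lfunE.
apply/eqP; rewrite -subr_eq0; apply/eqP/jm.
by rewrite linearB linearN /= jl yE -opprD addrC E oppr0.
Qed.

(** A module X in Cogen T is the kernel of an epimorphism in add T, by [ses_switch] and
    [slice_presentation] for the cokernel of X -> M; rotation makes it a cokernel. *)
Lemma in_Cogen_bound T : tau_slice T ->
  exists d, forall X, in_Cogen T X -> finite_pd X -> pd_le d X.
Proof.
move=> Tt; pose V := summand_at T.
have [d dP] := igusa_todorov (fun j => Om (V j)).
exists d => X [M [i [TM iH im]]].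
have [Z [f S]] := mono_ses iH im.
have TZ : in_Gen T Z.
  by exists M, f; split=> //; [case: S => -[] | apply: ses_epi S].
have [n [Ks [j [g [KT S' univ]]]]] := slice_presentation Tt TZ.
have [[_ gH] _ _ _ _] := S'; have [[_ fH] _ _ _ _] := S.
have [Ys [YT MY]] := in_add_dsum TM.
have [a [a' [aH aH' a'a aa']]] := (isoP _ _).1 MY.
have [h [hH hE]] := approximation_lift gH univ YT (hom_comp fH aH').
have [|i' [f' S'']] := ses_switch S S' (hom_comp hH aH).
  by rewrite comp_lfunA hE -comp_lfunA a'a comp_lfun1r.
have [L [l [q [LS SL]]]] := ses_rotate S''.
have [ls1 E1] := summand_sumV KT; have [ls2 E2] := retract_sumV YT.
have [ls3 E3] := power_sumV T n.
apply: (dP ls3 (ls1 ++ ls2) _ _ _ _ _ SL).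
  apply: stable_trans (Om_sumV _); apply/stable_Om/iso_stable.
  apply: iso_trans (iso_sym (sumV_cat _ _)).
  by apply: iso_dsum2 => //; apply: iso_trans MY _.
apply: stable_trans LS _; apply: stable_trans (Om_sumV _).
exact/stable_Om/iso_stable.
Qed.

Lemma indec_in_YA m n (T : 'I_m -> amod A Right) (S : 'I_n -> amod A Right) X :
  indec X -> ~ in_union_Gen T X -> ~ in_union_Cogen S X -> in_YA T S X.
Proof.
move=> Xi XT XS; exists 1%N, (fun _ => X); split=> //.
have -> : [seq X | _ : 'I_1] = [:: X] by rewrite /image_mem enum_ordSl enum_ord0.
exact/iso_sym/dsum2_zeror/zero_amod0.
Qed.

End Bounds.

Theorem corollary4p7 (k : closedFieldType) (A : falgType k)
    (s t : nat) (T : 'I_s -> amod A Right) (S : 'I_t -> amod A Right)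
    (hA : determined_by_tau_slices T S)
    (hLR : (forall X : amod A Right,
              indec X -> in_union_Cogen S X -> left_part X) \/
           (forall X : amod A Right,
              indec X -> in_union_Gen T X -> right_part X)) :
  findim_finite A.
Proof.
move=> {hLR}; case: hA => [[Tt St _] _ [r [Z ZP]] _ _].
have /choice[dT dTP] i := in_Gen_bound (Tt i).
have /choice[dS dSP] j := in_Cogen_bound (St j).
have [dZ dZP] := finite_pd_bound [seq Z i | i <- enum 'I_r].
pose d := maxn dZ (maxn (\max_i dT i) (\max_j dS j)).
exists d => M [n Mn].
apply: pd_le_iso (iso_sym (decomposition_iso M)) _.
apply: pd_le_dsum => X XM; have Xi := decomposition_indec XM.
have Xn : pd_le n X.
  apply: pd_le_retract Mn; apply: retract_trans (retract_dsum XM) _.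
  exact/iso_retract/iso_sym/decomposition_iso.
have [[i XT]|XT] := pselect (in_union_Gen T X).
  apply: pd_le_leq (dTP i X XT _); last by exists n.
  by rewrite /d !leq_max (leq_bigmax i) orbT.
have [[j XS]|XS] := pselect (in_union_Cogen S X).
  apply: pd_le_leq (dSP j X XS _); last by exists n.
  by rewrite /d !leq_max (leq_bigmax j) !orbT.
have [i XZ] := ZP X Xi (indec_in_YA Xi XT XS).
apply: pd_le_iso (iso_sym XZ) _; apply: pd_le_leq (leq_maxl _ _) _.
apply: dZP; last by exists n; apply: pd_le_iso Xn.
by apply: List.in_map; elim: (enum 'I_r) (mem_enum 'I_r i) => //= x l IH;
  rewrite inE => /orP[/eqP ->|/IH]; [left | right].
Qed.
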